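(* Let $Y,Z_1,Z_2$ be reflexive and separable Banach spaces, $T>0$, $Q=[0,T]$, $0=\tau_0<\tau_1<\cdots<\tau_m<\tau_{m+1}=T$, and $z_0\in Z_1$. Let $f:Q\times Z_1\times Z_2\to Z_1$, $A:Q\times Z_2\to Z_2^*$, $N:Z_2\to Y$, $J:Q\times Y\to\mathbb{R}$, $g:Q\times Z_1\to Z_2^*$ and $\Theta_j:Z_1\to Z_1$ ($j=1,\dots,m$) satisfy the following. (Hf) (i) For any $(z,y)\in Z_1\times Z_2$, $f(\cdot,z,y)$ is continuous; (ii) there is $M_1>0$ with $\|f(t,z_1,y_1)-f(t,z_2,y_2)\|_{Z_1}\le M_1(\|z_1-z_2\|_{Z_1}+\|y_1-y_2\|_{Z_2})$ for all $t\in Q$, $z_1,z_2\in Z_1$, $y_1,y_2\in Z_2$; (iii) there is a nonnegative $\phi\in L^{1/p}[0,T]$, where $0<p<\kappa<1$, with $\|f(t,z,y)\|_{Z_1}\le\phi(t)$ for all $(t,z,y)\in Q\times Z_1\times Z_2$. (HI) For each $j\in\{1,\dots,m\}$, $\Theta_j$ is bounded and there is $d_j>0$ with $\|\Theta_j(z_1)-\Theta_j(z_2)\|_{Z_1}\le d_j\|z_1-z_2\|_{Z_1}$ for all $z_1,z_2\in Z_1$. (HA) (i) For any $y\in Z_2$, $A(\cdot,y)$ is continuous; (ii) for any $t\in Q$, $A(t,\cdot)$ is bounded, demicontinuous, and strongly monotone with constant $m_A>0$ (independent of $t$). (HN) $N\in L(Z_2,Y)$ is a compact and surjective operator. (HJ)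 (i) For any $x\in Y$, $J(\cdot,x)$ is continuous; (ii) for any $t\in Q$, $J(t,\cdot)$ is locally Lipschitz; (iii) there is $m_J>0$ with $\|\partial J(t,x)\|_{Y^*}\le m_J(\|x\|_Y+1)$ for all $(t,x)\in Q\times Y$; (iv) there is $c_J>0$ with $\langle\theta_1-\theta_2,y_1-y_2\rangle\ge -c_J\|y_1-y_2\|_Y^2$ for all $t\in Q$, $y_i\in Y$, $\theta_i\in\partial J(t,y_i)$, $i=1,2$. (Hg) (i) For any $z\in Z_1$, $g(\cdot,z)$ is continuous; (ii) there is $m_g>0$ with $\|g(t,z_1)-g(t,z_2)\|_{Z_2^*}\le m_g\|z_1-z_2\|_{Z_1}$ for all $t\in Q$, $z_1,z_2\in Z_1$. (HO) (i) $m_A>c_J\|N\|^2$, where $\|N\|=\|N\|_{L(Z_2,Y)}$; (ii) $\dfrac{T^\kappa M_1m_g}{\kappa(m_A-c_J\|N\|^2)\Gamma(\kappa)}<1$. Then the problem $$\begin{cases}{}^{C}D_0^\kappa z(t)=f(t,z(t),y(t)),\quad t\in Q,\ t\ne\tau_j,\ j=1,\dots,m,\\ z(\tau_j^+)-z(\tau_j^-)=\Theta_j(z(\tau_j^-)),\quad j=1,\dots,m,\\ z(0)=z_0,\\ A(t,y(t))+N^*\partial J(t,Ny(t))\ni g(t,z(t)),\quad t\in Q,\end{cases}$$ admits a unique solution $(z,y)\in\mathcal{I}C(Q;Z_1)\times\mathcal{I}C(Q;Z_2)$.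
   Context: $\mathcal{I}C(Q;X)$ (for a Banach space $X$) is the space of functions $x:Q\to X$ that are continuous on $Q\setminus\{\tau_1,\dots,\tau_m\}$ and such that the one-sided limits $x(\tau_j^+)$, $x(\tau_j^-)$ exist with $x(\tau_j)=x(\tau_j^-)$. Solution: a pair $(z,y)\in\mathcal{I}C(Q;Z_1)\times\mathcal{I}C(Q;Z_2)$ is a solution of the problem if $$z(t)=z_0+\sum_{i=1}^{j}\Theta_i(z(\tau_i^-))+\frac1{\Gamma(\kappa)}\int_0^t(t-s)^{\kappa-1}f(s,z(s),y(s))\,ds\quad\text{for }t\in(\tau_j,\tau_{j+1}],\ j=0,1,\dots,m,$$ (with $z(0)=z_0$ and the empty sum being $0$ for $j=0$), and for every $t\in Q$ there is $\eta\in N^*\partial J(t,Ny(t))$ with $A(t,y(t))+\eta=g(t,z(t))$. (${}^{C}D_0^\kappa$ is the Caputo derivative of order $\kappa$; the problem is understood through this definition of solution.) For a locally Lipschitz functional $F:X\to\mathbb{R}$ on a Banach space, $F^\circ(x;z)=\limsup_{y\to x,\ \mu\to0^+}\frac{F(y+\mu z)-F(y)}{\mu}$ and $\partial F(v)=\{\eta\in X^*: F^\circ(v;z)\ge\langle\eta,z\rangle\ \forall z\in X\}$ (Clarke generalized gradient). $\partial J(t,x)$ is the generalized gradient of $J(t,\cdot)$ at $x$; $\|\partial J(t,x)\|\le c$ means every element has norm at most $c$. $N^*:Y^*\to Z_2^*$ is the adjoint of $N$. An operator $B:Z_2\to Z_2^*$ is strongly monotone with constant $m_B>0$ if $\langle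 Bx_1-Bx_2,x_1-x_2\rangle\ge m_B\|x_1-x_2\|^2$ for all $x_1,x_2$; demicontinuous if $z_n\to z$ in $Z_2$ implies $Bz_n\to Bz$ weakly in $Z_2^*$. A map is bounded if it sends bounded sets to bounded sets. $\Gamma$ is the gamma function. *)

(* Defs.v *)
From HB Require Import structures.
From mathcomp Require Import all_boot all_order all_algebra.
From mathcomp Require Import all_classical all_reals all_analysis.

Set Implicit Arguments.
Unset Strict Implicit.
Unset Printing Implicit Defensive.

Import Order.TTheory GRing.Theory Num.Theory.
Import numFieldNormedType.Exports.

Local Open Scope classical_set_scope.
Local Open Scope ring_scope.

Section bounded_operators.
Context {R : realType}.
Variables X Y : normedModType R.

Definition is_blin : {pred X -> Y} := mem [set f | linear f /\ continuous f].

Lemma is_blinP (f : X -> Y) : reflect (linear f /\ continuous f) (f \in is_blin).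
Proof. by apply: (iffP idP) => [/set_mem|/mem_set]. Qed.

Lemma is_blin_submod : submod_closed is_blin.
Proof.
split=> [|a f g /is_blinP[lf cf] /is_blinP[lg cg]]; apply/is_blinP; split.
- by move=> a x y /=; rewrite scaler0 addr0.
- exact: cst_continuous.
- move=> b x y; have -> : forall z, (a *: f + g) z = a *: f z + g z by [].
  rewrite lf lg !scalerDr !scalerA addrACA; congr (_ + _).
  by rewrite (mulrC b).
- by move=> x; apply: cvgD; [apply: cvgZr; exact: cf|exact: cg].
Qed.

HB.instance Definition _ :=
  GRing.isSubmodClosed.Build R (X -> Y) is_blin is_blin_submod.

Record blin := BLin {
  blin_fun :> X -> Y;
  blin_subproof : blin_fun \in is_blin }.

HB.instance Definition _ := [isSub for blin_fun].
HB.instance Definition _ := [Choice of blin by <:].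
HB.instance Definition _ := [SubChoice_isSubLmodule of blin by <:].

Implicit Types f g : blin.

Lemma blin_linear f : linear f.
Proof. by have /is_blinP[] := blin_subproof f. Qed.

HB.instance Definition _ f :=
  GRing.isLinear.Build R X Y _ (blin_fun f) (blin_linear f).

Lemma blin_continuous f : continuous f.
Proof. by have /is_blinP[] := blin_subproof f. Qed.

Definition opnorm f : R := sup [set `|f x| | x in [set x : X | `|x| <= 1]].

Lemma opnorm_has_sup f : has_sup [set `|f x| | x in [set x : X | `|x| <= 1]].
Proof.
split; first by exists `|f 0|; exists 0 => //=; rewrite normr0.
have /linear_bounded_continuous/bounded_funP/(_ 1)[M fM] :=
  @blin_continuous f.
by exists M => _ [x /= x1 <-]; exact: fM.
Qed.

Lemma blin_norm_le f x : `|f x| <= opnorm f * `|x|.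
Proof.
have [->|x0] := eqVneq x 0; first by rewrite linear0 !normr0 mulr0.
have nx : 0 < `|x| by rewrite normr_gt0.
rewrite -ler_pdivrMr//; apply: ub_le_sup; first exact: (opnorm_has_sup f).2.
exists (`|x|^-1 *: x) => /=.
  by rewrite normrZ ger0_norm ?invr_ge0// mulVf ?gt_eqF.
by rewrite linearZ normrZ ger0_norm ?invr_ge0// mulrC.
Qed.

Lemma opnorm_le f (M : R) :
  (forall x, `|x| <= 1 -> `|f x| <= M) -> opnorm f <= M.
Proof.
move=> fM; apply: ge_sup; first exact: (opnorm_has_sup f).1.
by move=> _ [x /= x1 <-]; exact: fM.
Qed.

Lemma opnorm_ge f x : `|x| <= 1 -> `|f x| <= opnorm f.
Proof.
move=> x1; apply: ub_le_sup; first exact: (opnorm_has_sup f).2.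
by exists x.
Qed.

Lemma ler_opnormD f g : opnorm (f + g) <= opnorm f + opnorm g.
Proof.
apply: opnorm_le => x x1.
rewrite (le_trans (ler_normD (f x) (g x)))//.
by apply: lerD; exact: opnorm_ge.
Qed.

Lemma opnormZ (a : R) f : opnorm (a *: f) = `|a| * opnorm f.
Proof.
have le b h : opnorm (b *: h) <= `|b| * opnorm h.
  apply: opnorm_le => x x1.
  have -> : (b *: h) x = b *: h x by [].
  by rewrite normrZ ler_wpM2l//; exact: opnorm_ge.
apply/eqP; rewrite eq_le le /=.
have [->|a0] := eqVneq a 0.
  rewrite normr0 mul0r (le_trans (normr_ge0 ((0 *: f : blin) 0)))//.
  by apply: opnorm_ge; rewrite normr0.
have na : 0 < `|a| by rewrite normr_gt0.
have := le a^-1 (a *: f); rewrite scalerA mulVf// scale1r normfV.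
by rewrite ler_pdivlMl.
Qed.

Lemma opnorm0_eq0 f : opnorm f = 0 -> f = 0.
Proof.
move=> f0; apply/val_inj/funext => x /=.
apply/eqP; rewrite -normr_le0.
by have := blin_norm_le f x; rewrite f0 mul0r.
Qed.

HB.instance Definition _ :=
  Lmodule_isNormed.Build R blin ler_opnormD opnormZ opnorm0_eq0.

End bounded_operators.

Notation "''L' ( X , Y )" := (blin X Y) (at level 8, format "''L' ( X ,  Y )").

Definition topdual {R : realType} (X : normedModType R) : normedModType R :=
  'L(X, R^o).

Section adjoint.
Context {R : realType} {X Y : normedModType R}.

Lemma adjoint_subproof (N : 'L(X, Y)) (eta : topdual Y) :
  (fun x => eta (N x)) \in @is_blin R X R^o.
Proof.
apply/is_blinP; split.
- by move=> a x y; rewrite !linearP.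
- by move=> x; apply: continuous_comp; exact: blin_continuous.
Qed.

Definition adjoint (N : 'L(X, Y)) (eta : topdual Y) : topdual X :=
  BLin (adjoint_subproof N eta).

End adjoint.

Section functional_analysis.
Context {R : realType}.
Implicit Types X Y : normedModType R.

Definition reflexive_space X :=
  forall Phi : topdual (topdual X),
    exists x : X, forall phi : topdual X, Phi phi = phi x.

Definition separable_space X := exists D : set X, countable D /\ dense D.

Definition weak_cvgn X (u : nat -> X) (x : X) :=
  forall phi : topdual X, phi (u n) @[n --> \oo] --> phi x.

Definition bounded_map X Y (F : X -> Y) :=
  forall B : set X, bounded_set B -> bounded_set (F @` B).

Definition demicontinuous X (B : X -> topdual X) :=
  forall (u : nat -> X) (x : X), u @ \oo --> x ->
    weak_cvgn (fun n => B (u n)) (B x).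

Definition strongly_monotone X (B : X -> topdual X) (mB : R) :=
  forall x1 x2 : X, mB * `|x1 - x2| ^+ 2 <= (B x1 - B x2) (x1 - x2).

Definition compact_operator X Y (N : X -> Y) :=
  forall B : set X, bounded_set B -> precompact (N @` B).

Definition locally_lipschitz X (F : X -> R) :=
  forall x : X, exists2 U, nbhs x U & [lipschitz F y | y in U].

Definition clarke_derivative X (F : X -> R) (x z : X) : \bar R :=
  limf_esup (fun p : X * R => ((F (p.1 + p.2 *: z) - F p.1) / p.2)%:E)
            (filter_prod (nbhs x) 0^'+).

Definition clarke_gradient X (F : X -> R) (v : X) : set (topdual X) :=
  [set eta : topdual X |
    forall z : X, ((eta z)%:E <= clarke_derivative F v z)%E].

End functional_analysis.

Section bochner.
Context {R : realType} {d : measure_display} {T : measurableType d}.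
Context {X : normedModType R}.
Variables (mu : {measure set T -> \bar R}) (D : set T).
Implicit Types (f s : T -> X).

Definition simple_on s := finite_set (range s) /\
  forall x, measurable (D `&` s @^-1` [set x]) /\
            (x != 0 -> (mu (D `&` s @^-1` [set x]) < +oo)%E).

(* The value 0 may be taken on a set of infinite measure; its term vanishes. *)
Definition simple_integral s : X :=
  \sum_(x \in range s) fine (mu (D `&` s @^-1` [set x])) *: x.

Definition strongly_measurable f := exists s : nat -> T -> X,
  (forall n, simple_on (s n)) /\
  {ae mu, forall t, D t -> s n t @[n --> \oo] --> f t}.

(* Strong measurability cannot be dropped: the library integral of a
   non-measurable nonnegative function is only a lower integral. *)
Definition is_bochner_integral f (v : X) := strongly_measurable f /\
  exists s : nat -> T -> X,
    [/\ forall n, simple_on (s n),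
        (\int[mu]_(t in D) `|f t - s n t|%:E)%E @[n --> \oo] --> 0%E &
        simple_integral (s n) @[n --> \oo] --> v].

End bochner.

Definition Gamma {R : realType} (a : R) : R :=
  \int[lebesgue_measure]_(x in `]0, +oo[) (x `^ (a - 1) * expR (- x)).

Section impulsive_problem.
Context {R : realType}.
Implicit Types X : normedModType R.

Definition left_limit X (x : R -> X) (t : R) : X := lim (x @ t^'-).

(* Functions on [0, T] are represented by total functions on R whose values
   outside [0, T] are irrelevant.  The impulse times are tau 1, ..., tau m. *)
Definition IC X (T : R) (m : nat) (tau : nat -> R) : set (R -> X) :=
  [set x |
    {within `[0, T] `\` [set tau j | j in [set j | (0 < j <= m)%N]],
      continuous x} /\
    forall j, (0 < j <= m)%N ->
      cvg (x @ (tau j)^'+) /\ x @ (tau j)^'- --> x (tau j)].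

(* For t in ]0, T] the integrand is singular at s = t; the value 0 `^ (kappa - 1)
   taken there is immaterial. *)
Definition is_solution (Y Z1 Z2 : normedModType R) (T kappa : R) (m : nat)
    (tau : nat -> R) (z0 : Z1) (f : R -> Z1 -> Z2 -> Z1)
    (A : R -> Z2 -> topdual Z2) (N : 'L(Z2, Y)) (J : R -> Y -> R)
    (g : R -> Z1 -> topdual Z2) (Theta : nat -> Z1 -> Z1)
    (z : R -> Z1) (y : R -> Z2) :=
  [/\ IC T m tau z, IC T m tau y, z 0 = z0,
      forall (j : nat) (t : R), (j <= m)%N -> tau j < t <= tau j.+1 ->
        exists2 I : Z1,
          is_bochner_integral lebesgue_measure `[0, t]
            (fun s => (t - s) `^ (kappa - 1) *: f s (z s) (y s)) I &
          z t = z0 + \sum_(1 <= i < j.+1) Theta i (left_limit z (tau i))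
                   + (Gamma kappa)^-1 *: I
    & forall t : R, 0 <= t <= T ->
        exists2 eta : topdual Z2,
          (adjoint N @` clarke_gradient (J t) (N (y t))) eta &
          A t (y t) + eta = g t (z t)].

End impulsive_problem.

(* Main.v *)
Require Import Defs.
From HB Require Import structures.
From mathcomp Require Import all_boot all_order all_algebra.
From mathcomp Require Import all_classical all_reals all_analysis.
From mathcomp Require Import measurable_realfun.
From mathcomp Require Import ring lra.

Set Implicit Arguments.
Unset Strict Implicit.
Unset Printing Implicit Defensive.

Import Order.TTheory GRing.Theory Num.Theory.
Import numFieldNormedType.Exports.

Local Open Scope classical_set_scope.
Local Open Scope ring_scope.

(** The system decouples.  At a fixed time [t] the inclusion
    [A(t,y) + N^* dJ(t,Ny) = b] has exactly one solution [sol t b], so that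
    [y(t) = sol t (g(t,z(t)))], and [z] solves an impulsive integral equation
    whose forcing [F(t,z) = f(t, z, sol t (g(t,z)))] is continuous in [t] and
    Lipschitz in [z].

    The inclusion.  Strong monotonicity of [A], relaxed monotonicity of [dJ] and
    [mA > cJ |N|^2] make [y |-> A(t,y) + N^* dJ(t,Ny)] strongly monotone
    ([inclusion_strongly_monotone]); this gives uniqueness and Lipschitz
    dependence on [b].  For existence, finitely many Minty inequalities
    [0 <= xi_i (v_i - x)] with [(v_i, xi_i)] in the graph are satisfied by a
    convex combination of the [v_i]: the optimal strategy of a matrix game whose
    payoff has a nonnegative quadratic form ([nonneg_game], [minty_finite]).
    Reflexivity passes to the whole graph over a ball, along an ultrafilter
    ([minty_ball]).  Letting the test points tend to the solution [x] yields the
    hemivariational inequality [0 <= (A x - b) u + J0(N x; N u)]; coercivity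
    places [x] inside the ball, so that [u] is arbitrary, and as [N] is onto, the
    functional [b - A x] factors through [N] as an element of the generalized
    gradient ([inclusion_solvable]).  The generalized gradient is accessible
    because its support function is the Clarke derivative
    ([clarke_gradient_max], from the Hahn-Banach theorem), and relaxed
    monotonicity integrates to a one-sided quadratic bound on the functional
    ([clarke_semiconvex]).  That bound only involves values of [J(t,.)], which are
    continuous in [t]; with compactness of [N] it yields continuity of [sol t b]
    in [t] ([solution_continuous]).

    The integral equation.  Removing the impulses, [z] is recovered from a
    continuous function [w] by adding the jumps one after the other
    ([with_impulses]), and this reconstruction is Lipschitz and causal.  Since
    the kernel [(t-s)^(kappa-1)] is integrable, its integral against
    [exp(lambda s)] is at most [eps exp(lambda t)] for large [lambda]
    ([integral_abel_expR_small]), so the fixed-point map for [w] halves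
    distances in the weight [exp(lambda t)], which gives existence
    ([picard_fixpoint]); the same estimate, used between consecutive impulses,
    gives uniqueness ([impulsive_integral_unique]).

    Vector integrals are treated by duality.  In a reflexive space the integral
    is the vector representing [phi |-> int (phi o f)]; in a separable one the
    nearest-point approximations show that it is the Bochner integral
    ([weak_integral_bochner]), and conversely ([is_bochner_integral_weak]). *)

(** * Hahn-Banach theorem and elementary duality *)

Section sublinear_functionals.
Context {R : realType} {V : lmodType R}.
Implicit Types (p q : V -> R) (x y h : V).

Definition sublinear q :=
  (forall x y, q (x + y) <= q x + q y) /\
  (forall a x, 0 < a -> q (a *: x) = a * q x).

Lemma sublinear0 q : sublinear q -> q 0 = 0.
Proof.
move=> [_ hom]; have := hom 2 0 ltac:(lra).
rewrite scaler0 => e; lra.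
Qed.

Lemma sublinear_opp q x : sublinear q -> - q (- x) <= q x.
Proof.
move=> sq; have := sq.1 x (- x); rewrite subrr (sublinear0 sq) => e; lra.
Qed.

Lemma sublinear_ge0Z q a x : sublinear q -> 0 <= a -> q (a *: x) = a * q x.
Proof.
move=> sq; rewrite le_eqVlt => /orP[/eqP<-|/sq.2//].
by rewrite scale0r mul0r sublinear0.
Qed.

(** The largest sublinear functional below [q] that decreases with slope
    [q h] in the direction [- h]: the one-step extension of the Hahn-Banach
    argument, carried out on sublinear functionals instead of on partially
    defined linear ones. *)
Definition tilt q h x := inf [set q (x + t *: h) - t * q h | t in [set t : R | 0 <= t]].

Lemma tilt_has_inf q h x : sublinear q ->
  has_inf [set q (x + t *: h) - t * q h | t in [set t : R | 0 <= t]].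
Proof.
move=> sq; split; first by exists (q (x + 0 *: h) - 0 * q h); exists 0 => /=.
exists (- q (- x)) => _ [t /= t0 <-].
have := sq.1 (x + t *: h) (- x).
rewrite addrAC subrr add0r (sublinear_ge0Z _ sq)// => e; lra.
Qed.

Lemma tilt_le q h x t : sublinear q -> 0 <= t ->
  tilt q h x <= q (x + t *: h) - t * q h.
Proof.
move=> sq t0; apply: ge_inf; first exact: (tilt_has_inf h x sq).2.
by exists t.
Qed.

Lemma le_tilt q h x M : sublinear q ->
  (forall t, 0 <= t -> M <= q (x + t *: h) - t * q h) -> M <= tilt q h x.
Proof.
move=> sq H; apply: lb_le_inf; first exact: (tilt_has_inf h x sq).1.
by move=> _ [t /= t0 <-]; exact: H.
Qed.

Lemma tilt_le_id q h x : sublinear q -> tilt q h x <= q x.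
Proof.
move=> sq; have := @tilt_le q h x 0 sq (lexx _).
by rewrite scale0r addr0 mul0r subr0.
Qed.

Lemma tiltN q h : sublinear q -> tilt q h (- h) <= - q h.
Proof.
move=> sq; have := @tilt_le q h (- h) 1 sq ler01.
by rewrite scale1r mul1r addNr sublinear0// sub0r.
Qed.

Lemma tilt_sublinear q h : sublinear q -> sublinear (tilt q h).
Proof.
move=> sq; split => [x y|a x a0].
  suff H t : 0 <= t -> forall s, 0 <= s ->
     tilt q h (x + y) - (q (y + t *: h) - t * q h) <= q (x + s *: h) - s * q h.
    rewrite -lerBlDl; apply: le_tilt => // t t0.
    rewrite lerBlDr -lerBlDl; apply: le_tilt => // s s0.
    exact: H.
  move=> t0 s s0; have := @tilt_le q h (x + y) (s + t) sq (addr_ge0 s0 t0).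
  have := sq.1 (x + s *: h) (y + t *: h).
  rewrite addrACA -scalerDl => e1 e2; lra.
apply/eqP; rewrite eq_le; apply/andP; split.
  rewrite mulrC -ler_pdivrMr//; apply: le_tilt => // t t0.
  rewrite ler_pdivrMr//.
  have := @tilt_le q h (a *: x) (a * t) sq (mulr_ge0 (ltW a0) t0).
  rewrite -scalerA -scalerDr sq.2// => /le_trans; apply.
  by rewrite le_eqVlt; apply/orP; left; apply/eqP; ring.
apply: le_tilt => // t t0; rewrite mulrC -ler_pdivlMr//.
have := @tilt_le q h x (a^-1 * t) sq (mulr_ge0 (ltW _) t0).
rewrite invr_gt0 => /(_ a0) /le_trans; apply.
have -> : x + (a^-1 * t) *: h = a^-1 *: (a *: x + t *: h).
  by rewrite scalerDr !scalerA mulVf ?gt_eqF// scale1r.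
rewrite sq.2 ?invr_gt0// le_eqVlt; apply/orP; left; apply/eqP; ring.
Qed.

(** Tilting along [x] cannot lower a minimal [q], and the tilted functional
    takes a value at most [- q x] at [- x]. *)
Lemma minimal_sublinear_odd q : sublinear q ->
  (forall q', sublinear q' -> (forall x, q' x <= q x) -> forall x, q' x = q x) ->
  forall x, q (- x) = - q x.
Proof.
move=> sq qmin x; apply/eqP; rewrite eq_le; apply/andP; split.
  rewrite -(qmin _ (tilt_sublinear x sq)) ?tiltN// => y; exact: tilt_le_id.
by rewrite lerNl; exact: sublinear_opp.
Qed.

Lemma minimal_sublinear_linear q : sublinear q ->
  (forall q', sublinear q' -> (forall x, q' x <= q x) -> forall x, q' x = q x) ->
  forall (a : R) x y, q (a *: x + y) = a * q x + q y.
Proof.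
move=> sq qmin; have qN := minimal_sublinear_odd sq qmin.
have qD x y : q (x + y) = q x + q y.
  apply/eqP; rewrite eq_le sq.1/=.
  have := sq.1 (- x) (- y); rewrite -opprD !qN => e; lra.
move=> a x y; rewrite qD; congr (_ + _).
have [a0|a0] := leP 0 a; first exact: sublinear_ge0Z.
have na : 0 <= - a by rewrite oppr_ge0 ltW.
have := sublinear_ge0Z x sq na; rewrite scaleNr qN mulNr => e; lra.
Qed.

(** Zorn's lemma for the reverse pointwise order: the pointwise infimum of a
    chain is sublinear because two members of the chain can be compared. *)
Lemma exists_minimal_sublinear p : sublinear p ->
  exists q, [/\ sublinear q, forall x, q x <= p x &
    forall q', sublinear q' -> (forall x, q' x <= q x) ->
      forall x, q' x = q x].
Proof.
move=> sp.
pose T := {q : V -> R | sublinear q /\ forall x, q x <= p x}.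
pose Rl (s t : T) := `[< forall x, sval t x <= sval s x >].
have Z := @Zorn T Rl; case: Z.
- by move=> t; apply/asboolP.
- move=> r s t /asboolP rs /asboolP st; apply/asboolP => x.
  exact: le_trans (st x) (rs x).
- move=> [s sP] [t tP] /asboolP st /asboolP ts.
  have e : s = t by apply/funext => x; apply/eqP; rewrite eq_le (ts x) (st x).
  by subst t; congr exist; exact: Prop_irrelevance.
- move=> A Atot; have [[q0 Aq0]|A0] := pselect (A !=set0); last first.
    exists (exist _ p (conj sp (fun x => lexx _))) => s As.
    by exfalso; apply: A0; exists s.
  pose I x := [set sval q x | q in A].
  have hI x : has_inf (I x).
    split; first by exists (sval q0 x); exists q0.
    exists (- p (- x)) => _ [[q [sq qp]] _ <-] /=.
    by apply: le_trans (sublinear_opp _ sq); rewrite lerN2.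
  pose m x := inf (I x).
  have mle x (q : T) : A q -> m x <= sval q x.
    by move=> Aq; apply: ge_inf; [exact: (hI x).2|exists q].
  have le_m x M : (forall q : T, A q -> M <= sval q x) -> M <= m x.
    move=> H; apply: lb_le_inf; first exact: (hI x).1.
    by move=> _ [q Aq <-]; exact: H.
  (* of two members of the chain the smaller one bounds the infimum at [x + y] *)
  have sm : sublinear m.
    split => [x y|a x a0].
      rewrite -lerBlDl; apply: (le_m) => q Aq.
      rewrite lerBlDr -lerBlDl; apply: (le_m) => q' Aq'.
      rewrite lerBlDr.
      case: (Atot _ _ Aq Aq') => /asboolP le.
        apply: le_trans (mle (x + y) _ Aq') _.
        apply: le_trans ((svalP q').1.1 _ _) _.
        by rewrite lerD2l.
      apply: le_trans (mle (x + y) _ Aq) _.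
      apply: le_trans ((svalP q).1.1 _ _) _.
      by rewrite lerD2r.
    apply/eqP; rewrite eq_le; apply/andP; split.
      rewrite mulrC -ler_pdivrMr//; apply: (le_m) => q Aq.
      rewrite ler_pdivrMr// mulrC -(svalP q).1.2//; exact: mle.
    apply: (le_m) => q Aq; rewrite (svalP q).1.2// ler_pM2l//; exact: mle.
  have mp x : m x <= p x by apply: le_trans (mle x _ Aq0) ((svalP q0).2 x).
  exists (exist _ m (conj sm mp)) => s As; apply/asboolP => x /=.
  exact: mle.
move=> [q [sq qp]] qmin; exists q; split => // q' sq' q'q x.
have q'p y : q' y <= p y by exact: le_trans (q'q y) (qp y).
have := qmin (exist _ q' (conj sq' q'p)) ltac:(exact/asboolP).
by move=> /(congr1 sval) /= ->.
Qed.

(** A minimal sublinear functional below [tilt p h] is linear, and it must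
    attain [p h] at [h] since [tilt p h (- h) <= - p h]. *)
Lemma hahn_banach_max p h : sublinear p ->
  exists l : V -> R, [/\ forall (a : R) x y, l (a *: x + y) = a * l x + l y,
    forall x, l x <= p x & l h = p h].
Proof.
move=> sp; have [l [sl lp lmin]] := exists_minimal_sublinear (tilt_sublinear h sp).
have llin := minimal_sublinear_linear sl lmin.
have lep x : l x <= p x by exact: le_trans (lp x) (tilt_le_id _ _ sp).
exists l; split => //; apply/eqP; rewrite eq_le lep/=.
have := lp (- h); rewrite (minimal_sublinear_odd sl lmin).
by move=> /le_trans/(_ (tiltN h sp)); rewrite lerN2.
Qed.

End sublinear_functionals.

Section dual.
Context {R : realType} {X : normedModType R}.

Implicit Types phi psi : topdual X.

Lemma dualZ phi (a : R) x : phi (a *: x) = a * phi x.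
Proof. by rewrite linearZ. Qed.

Lemma dualD phi x y : phi (x + y) = phi x + phi y.
Proof. by rewrite linearD. Qed.

Lemma dualN phi x : phi (- x) = - phi x.
Proof. by rewrite linearN. Qed.

Lemma dualB phi x y : phi (x - y) = phi x - phi y.
Proof. by rewrite linearB. Qed.

Lemma dual0 phi : phi 0 = 0.
Proof. by rewrite linear0. Qed.

Lemma dual_sum phi (I : Type) (r : seq I) (P : pred I) (F : I -> X) :
  phi (\sum_(i <- r | P i) F i) = \sum_(i <- r | P i) phi (F i).
Proof. exact: (big_morph phi (dualD phi) (dual0 phi)). Qed.

Lemma dualBE phi psi x : (phi - psi) x = phi x - psi x.
Proof. by []. Qed.

Lemma dualDE phi psi x : (phi + psi) x = phi x + psi x.
Proof. by []. Qed.

Lemma dual_le phi x : phi x <= `|phi| * `|x|.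
Proof. exact: le_trans (ler_norm _) (blin_norm_le phi x). Qed.

Lemma dual_norm_le phi x : `|phi x| <= `|phi| * `|x|.
Proof. exact: blin_norm_le phi x. Qed.

(** Entry point into the dual: a one-sided bound suffices for continuity. *)
Lemma bounded_functional (l : X -> R) (M : R) :
  (forall (a : R) x y, l (a *: x + y) = a * l x + l y) ->
  (forall x, l x <= M * `|x|) -> exists phi : topdual X, forall x, phi x = l x.
Proof.
move=> ll lM.
have lN x : l (- x) = - l x.
  have l0 : l 0 = 0 by have := ll 1 0 0; rewrite scale1r addr0 mul1r => e; lra.
  have := ll (-1) x 0; rewrite addr0 scaleN1r l0 => ->; ring.
have labs x : `|l x| <= M * `|x|.
  by rewrite ler_norml lM andbT lerNl -lN -(normrN x) lM.
have lc : continuous (l : X -> R^o).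
  move=> x; apply/cvgrPdist_le => e e0.
  have M1 : 0 < `|M| + 1 by rewrite ltr_pwDr.
  have : \forall y \near x, `|x - y| <= e / (`|M| + 1).
    have /cvgrPdist_le : id y @[y --> x] --> x by exact: cvg_id.
    by apply; rewrite divr_gt0.
  apply: filterS => y xy.
  have -> : l x - l y = l (x - y).
    by have := ll (-1) y x; rewrite scaleN1r addrC => ->; ring.
  apply: le_trans (labs _) _; apply: le_trans (ler_wpM2r _ (ler_norm M)) _ => //.
  apply: (@le_trans _ _ ((`|M| + 1) * `|x - y|)).
    by rewrite ler_wpM2r// lerDl.
  by rewrite mulrC -ler_pdivlMr.
have H : (l : X -> R^o) \in @is_blin R X R^o.
  by apply/is_blinP; split => // a x y; exact: ll.
by exists (BLin H).
Qed.

Lemma norming_functional (x : X) :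
  exists phi : topdual X, phi x = `|x| /\ forall y, `|phi y| <= `|y|.
Proof.
have sn : sublinear (fun x : X => `|x|).
  split; first exact: ler_normD.
  by move=> a y a0; rewrite normrZ gtr0_norm.
have [l [ll lle lx]] := hahn_banach_max x sn.
have [|phi phiE] := @bounded_functional l 1 ll; first by move=> y; rewrite mul1r.
exists phi; rewrite phiE; split => // y.
by rewrite ler_norml lerNl -linearN/= !phiE lle -(normrN y) lle.
Qed.

Lemma norm_le_dual (x : X) (M : R) :
  (forall phi : topdual X, (forall y, `|phi y| <= `|y|) -> phi x <= M) ->
  `|x| <= M.
Proof. by have [phi [<- le]] := norming_functional x; apply. Qed.

Lemma dual_separates (x y : X) :
  (forall phi : topdual X, phi x = phi y) -> x = y.
Proof.
move=> H; apply/eqP; rewrite -subr_eq0 -normr_le0; apply: norm_le_dual => phi _.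
by rewrite linearB/= H subrr.
Qed.

End dual.

(** * Clarke derivative and generalized gradient *)

Section clarke.
Context {R : realType} {X : normedModType R}.
Implicit Types (F : X -> R) (x y z h : X).

(** The filter [y --> x, mu --> 0+] of the definition of the Clarke
    derivative. *)
Definition clarke_base x : set_system (X * R) := filter_prod (nbhs x) 0^'+.

Global Instance clarke_base_filter x : ProperFilter (clarke_base x).
Proof. exact: filter_prod_proper. Qed.

Definition quot F z (p : X * R) : R := (F (p.1 + p.2 *: z) - F p.1) / p.2.

Lemma clarke_le F x z (a : R) :
  (\forall p \near clarke_base x, quot F z p <= a) ->
  (clarke_derivative F x z <= a%:E)%E.
Proof.
move=> H; apply: ge_ereal_inf; exists (ereal_sup ((EFin \o quot F z) @` [set p | quot F z p <= a])).
  by exists [set p | quot F z p <= a].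
by apply: ge_ereal_sup => _ [p /= pa <-]; rewrite lee_fin.
Qed.

Lemma clarke_lt F x z (a : R) :
  (clarke_derivative F x z < a%:E)%E ->
  \forall p \near clarke_base x, quot F z p < a.
Proof.
move=> /ereal_inf_lt[_ [V GV <-]] supa; apply: filterS GV => p Vp.
rewrite -lte_fin; apply: le_lt_trans supa.
by apply: ereal_sup_ubound; exists p.
Qed.

Lemma clarke_ge F x z (a : R) :
  (forall A : set (X * R), clarke_base x A -> exists2 p, A p & a <= quot F z p) ->
  (a%:E <= clarke_derivative F x z)%E.
Proof.
move=> H; rewrite leNgt; apply/negP => lt_a; have [p /= qa] := H _ (clarke_lt lt_a).
by rewrite leNgt qa.
Qed.

Lemma clarke_base_shift x z :
  (fun p : X * R => p.1 + p.2 *: z) @ clarke_base x --> x.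
Proof.
rewrite -[X in _ --> X]addr0; apply: cvgD; first exact: cvg_fst.
rewrite -[X in _ --> X](scale0r z); apply: cvgZl.
apply: (@cvg_trans _ (0 : R)^'+); first exact: cvg_snd.
exact: cvg_within.
Qed.

Lemma clarke_base_gt0 x : \forall p \near clarke_base x, 0 < p.2.
Proof.
have : \forall t \near (0 : R)^'+, 0 < t by exact: nbhs_right_gt.
by move=> /(@cvg_snd X R (nbhs x) (0 : R)^'+ _).
Qed.

Lemma locally_lipschitzP F x : locally_lipschitz F ->
  exists k : R, exists2 U, nbhs x U &
    0 <= k /\ forall y z, U y -> U z -> `|F y - F z| <= k * `|y - z|.
Proof.
move=> /(_ x)[U Ux]; rewrite /lipschitz_on => /pinfty_ex_gt0[k k0 H].
exists k, U => //; split; first exact: ltW.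
by move=> y z Uy Uz; apply: (H (y, z)).
Qed.

Lemma locally_lipschitz_continuous F : locally_lipschitz F -> continuous F.
Proof.
move=> FL x; have [k [U Ux [k0 lipU]]] := locally_lipschitzP x FL.
apply/cvgrPdist_le => e e0.
have H : \forall y \near x, `|x - y| <= e / (k + 1).
  have /cvgrPdist_le : id y @[y --> x] --> x by exact: cvg_id.
  by apply; rewrite divr_gt0 // ltr_wpDl.
near=> y.
have xy : `|x - y| <= e / (k + 1) by near: y.
apply: (le_trans (lipU _ _ _ _)).
- exact: nbhs_singleton.
- by near: y.
- apply: (@le_trans _ _ ((k + 1) * `|x - y|)); first by rewrite ler_wpM2r// lerDl.
  by rewrite mulrC -ler_pdivlMr// ltr_wpDl.
Unshelve. all: by end_near. Qed.

Lemma quot_bound F x : locally_lipschitz F ->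
  exists2 k : R, 0 <= k &
    forall z, \forall p \near clarke_base x, `|quot F z p| <= k * `|z|.
Proof.
move=> FL; have [k [U Ux [k0 lipU]]] := locally_lipschitzP x FL.
exists k => // z; near=> p.
have p0 : 0 < p.2 by near: p; exact: clarke_base_gt0.
rewrite /quot normrM normfV (gtr0_norm p0) ler_pdivrMr//.
apply: (le_trans (lipU _ _ _ _)).
- by near: p; apply: clarke_base_shift.
- by near: p; apply: (@cvg_fst X R (nbhs x) (0 : R)^'+ _).
- by rewrite addrAC subrr add0r normrZ gtr0_norm// -mulrA (mulrC p.2).
Unshelve. all: by end_near. Qed.

(** Nothing is lost by [fine]: the derivative of a locally Lipschitz functional
    is finite (see [clarke_derivE]). *)
Definition clarke_deriv F x z : R := fine (clarke_derivative F x z).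

Lemma clarke_derivE F x z : locally_lipschitz F ->
  clarke_derivative F x z = (clarke_deriv F x z)%:E.
Proof.
move=> FL; have [k k0 qk] := quot_bound x FL.
have le : (clarke_derivative F x z <= (k * `|z|)%:E)%E.
  by apply: clarke_le; apply: filterS (qk z) => p; exact/le_trans/ler_norm.
have ge : ((- (k * `|z|))%:E <= clarke_derivative F x z)%E.
  apply: clarke_ge => A GA.
  have [p [Ap qp]] := filter_ex (filterI GA (qk z)).
  by exists p => //; move: qp; rewrite ler_norml => /andP[].
rewrite /clarke_deriv fineK// fin_numE.
by apply/andP; split; apply/eqP => e; move: le ge; rewrite e.
Qed.

Lemma clarke_deriv_le F x z (a : R) : locally_lipschitz F ->
  (\forall p \near clarke_base x, quot F z p <= a) -> clarke_deriv F x z <= a.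
Proof. by move=> FL /clarke_le; rewrite clarke_derivE// lee_fin. Qed.

Lemma clarke_deriv_lt F x z (a : R) : locally_lipschitz F ->
  clarke_deriv F x z < a -> \forall p \near clarke_base x, quot F z p < a.
Proof. by move=> FL xa; apply: clarke_lt; rewrite clarke_derivE// lte_fin. Qed.

Lemma clarke_deriv_ge F x z (a : R) : locally_lipschitz F ->
  (forall A : set (X * R), clarke_base x A -> exists2 p, A p & a <= quot F z p) ->
  a <= clarke_deriv F x z.
Proof. by move=> FL /clarke_ge; rewrite clarke_derivE// lee_fin. Qed.

Lemma clarke_deriv_bound F x : locally_lipschitz F ->
  exists2 k : R, 0 <= k & forall z, clarke_deriv F x z <= k * `|z|.
Proof.
move=> FL; have [k k0 qk] := quot_bound x FL; exists k => // z.
by apply: clarke_deriv_le => //; apply: filterS (qk z) => p; exact/le_trans/ler_norm.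
Qed.

Lemma clarke_gradientP F x (eta : topdual X) : locally_lipschitz F ->
  clarke_gradient F x eta <-> forall z, eta z <= clarke_deriv F x z.
Proof.
by move=> FL; split => H z; have := H z; rewrite clarke_derivE// lee_fin.
Qed.

(** For subadditivity the increment along [z1 + z2] is split at the point
    [y + mu z2], which still tends to [x]; for homogeneity [mu] is rescaled. *)
Lemma clarke_deriv_sublinear F x : locally_lipschitz F ->
  sublinear (clarke_deriv F x).
Proof.
move=> FL; split => [z1 z2|a z a0].
  apply/ler_addgt0Pr => e e0.
  have e2 : 0 < e / 2 by rewrite divr_gt0.
  have H1 : \forall p \near clarke_base x, quot F z1 p < clarke_deriv F x z1 + e / 2.
    by apply: clarke_deriv_lt => //; rewrite ltrDl.
  have H2 : \forall p \near clarke_base x, quot F z2 p < clarke_deriv F x z2 + e / 2.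
    by apply: clarke_deriv_lt => //; rewrite ltrDl.
  have cv : (p.1 + p.2 *: z2, p.2) @[p --> clarke_base x] --> (nbhs x, (0 : R)^'+).
    by apply: cvg_pair; [exact: clarke_base_shift|exact: cvg_snd].
  apply: clarke_deriv_le => //; apply: filterS (filterI H2 (cv _ H1)) => p [/= q2 q1].
  have -> : quot F (z1 + z2) p = quot F z1 (p.1 + p.2 *: z2, p.2) + quot F z2 p.
    rewrite /quot /= -mulrDl; congr (_ / _).
    by rewrite [RHS]addrA subrK (addrC z1) scalerDr addrA.
  lra.
have main b y : 0 < b -> clarke_deriv F x (b *: y) <= b * clarke_deriv F x y.
  move=> b0; rewrite mulrC -ler_pdivrMr//; apply/ler_addgt0Pr => e e0.
  rewrite ler_pdivrMr//.
  have H1 : \forall p \near clarke_base x, quot F y p < clarke_deriv F x y + e.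
    by apply: clarke_deriv_lt => //; rewrite ltrDl.
  have cv : (p.1, b * p.2) @[p --> clarke_base x] --> (nbhs x, (0 : R)^'+).
    apply: cvg_pair; first exact: cvg_fst.
    apply: (@cvg_trans _ ((fun t : R => b * t) @ 0^'+)).
      move=> A; exact: (@cvg_snd X R (nbhs x) (0 : R)^'+ _).
    move=> A A0.
    have [d /= d0 dA] : nbhs_ball (0 : R) [set t : R | 0 < t -> A t].
      exact/nbhs_ballP.
    near=> t; apply: dA => //=; last by rewrite mulr_gt0.
      rewrite /ball/= sub0r normrN gtr0_norm ?mulr_gt0//.
      by rewrite mulrC -ltr_pdivlMr//; near: t; apply: nbhs_right_lt; rewrite divr_gt0.
  apply: clarke_deriv_le => //.
  apply: filterS (filterI (clarke_base_gt0 x) (cv _ H1)) => p [/= p0 q1].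
  have -> : quot F (b *: y) p = quot F y (p.1, b * p.2) * b.
    rewrite /quot /= scalerA (mulrC b p.2) invfM; field.
    by rewrite !gt_eqF.
  by rewrite ler_pM2r// ltW.
apply/eqP; rewrite eq_le main//=.
have := main a^-1 (a *: z); rewrite invr_gt0 scalerA mulVf ?gt_eqF// scale1r => /(_ a0).
by rewrite mulrC ler_pdivlMr// mulrC.
Unshelve. all: by end_near. Qed.

(** Hahn-Banach makes the Clarke derivative the support function of the
    generalized gradient. *)
Lemma clarke_gradient_max F x h : locally_lipschitz F ->
  exists2 eta : topdual X, clarke_gradient F x eta & eta h = clarke_deriv F x h.
Proof.
move=> FL; have [l [ll lle lh]] := hahn_banach_max h (clarke_deriv_sublinear x FL).
have [k k0 ck] := clarke_deriv_bound x FL.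
have [|eta etaE] := @bounded_functional R X l k ll.
  by move=> z; exact: le_trans (lle z) (ck z).
exists eta; last by rewrite etaE.
by apply/clarke_gradientP => // z; rewrite etaE.
Qed.

(** A bound on the difference quotients over a neighbourhood of [x] is such a
    bound for every nearby base point. *)
Lemma clarke_deriv_usc F x h (a : R) : locally_lipschitz F ->
  clarke_deriv F x h < a -> \forall y \near x, clarke_deriv F y h <= a.
Proof.
move=> FL /(clarke_deriv_lt FL)[[A B] /= [Ax B0] AB].
apply: filterS (nbhs_interior Ax) => y Ay; apply: clarke_deriv_le => //.
exists (A, B) => // p Ap; apply: ltW; exact: AB.
Qed.

(** Relaxed monotonicity integrates along the segment from [w] to [u].
    Subtracting from [F] its linear interpolation gives a function on [[0, 1]]
    with equal values at both ends, hence with an interior extremum; there the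
    Clarke derivative along [w - u] is at least [F w - F u], whether the
    extremum is a minimum or a maximum.  A gradient attaining this derivative
    is compared with [zeta]. *)
Lemma clarke_semiconvex F (c : R) w u (zeta : topdual X) : locally_lipschitz F ->
  0 <= c ->
  (forall y1 y2 theta1 theta2,
     clarke_gradient F y1 theta1 -> clarke_gradient F y2 theta2 ->
     - c * `|y1 - y2| ^+ 2 <= (theta1 - theta2) (y1 - y2)) ->
  clarke_gradient F w zeta ->
  zeta (u - w) - c * `|u - w| ^+ 2 <= F u - F w.
Proof.
move=> FL c0 mono zw; set h := u - w; set lam := F u - F w.
pose k r := F (w + r *: h) - r * lam.
have k0 : k 0 = F w by rewrite /k scale0r addr0 mul0r subr0.
have k1 : k 1 = F w by rewrite /k scale1r mul1r /h /lam subrKC subKr.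
have ck : {within `[0, 1], continuous k}.
  apply: continuous_subspaceT => r; apply: cvgB; last exact: mulrr_continuous.
  apply: continuous_comp; last exact: locally_lipschitz_continuous.
  by apply: cvgD; [exact: cvg_cst|exact: scalel_continuous].
have [cm cmI kmin] := EVT_min ler01 ck.
have [cM cMI kmax] := EVT_max ler01 ck.
have I01 : 0 \in `[0, 1 : R]%R by rewrite in_itv/= lexx ler01.
have I11 : 1 \in `[0, 1 : R]%R by rewrite in_itv/= lexx ler01.
have [r [r0 r1 ext]] : exists r, [/\ 0 < r, r < 1 &
    (forall t, t \in `[0, 1]%R -> k r <= k t) \/
    (forall t, t \in `[0, 1]%R -> k t <= k r)].
  have inn (r : R) : r \in `[0, 1]%R -> [\/ r = 0, r = 1 | 0 < r < 1].
    rewrite in_itv/= !le_eqVlt => /andP[/orP[/eqP<-|a] /orP[/eqP->|b]];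
    by [constructor 1|constructor 2|constructor 3; rewrite a b].
  have half : (1 / 2 : R) \in `[0, 1]%R by rewrite in_itv/=; apply/andP; split; lra.
  (* if both extrema are reached only at the endpoints, [k] is constant *)
  have [km|/andP[m0 m1]] : k cm = F w \/ 0 < cm < 1.
    by case: (inn _ cmI) => [->|->|?]; [left|left|right].
  - have [kM|/andP[M0 M1]] : k cM = F w \/ 0 < cM < 1.
      by case: (inn _ cMI) => [->|->|?]; [left|left|right].
    + exists (1 / 2); split; [lra|lra|left => t tI].
      by apply: le_trans (kmax _ half) _; rewrite kM -km; exact: kmin.
    + by exists cM; split => //; right.
  - by exists cm; split => //; left.
set x := w + r *: h.
have key : - lam <= clarke_deriv F x (- h).
  apply: clarke_deriv_ge => // A [[B C] /= [Bx C0] BCA].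
  (* at a minimum the quotients are based at [x] itself, at a maximum at [x + s h] *)
  case: ext => ext.
    near (0 : R)^'+ => s.
    have s0 : 0 < s by near: s; exact: nbhs_right_gt.
    have sr : s < r by near: s; exact: nbhs_right_lt.
    exists (x, s).
      by apply: BCA; split => /=; [exact: nbhs_singleton|near: s].
    rewrite /quot /= ler_pdivlMr//.
    have := ext (r - s); rewrite in_itv/= /k => H.
    have {}H := H ltac:(apply/andP; split; lra).
    rewrite /x -addrA scalerN -scalerBl.
    by move: H; lra.
  have cvx : x + s *: h @[s --> (0 : R)^'+] --> x.
    rewrite -[X in _ --> X]addr0; apply: cvgD; first exact: cvg_cst.
    rewrite -[X in _ --> X](scale0r h); apply: cvgZl; exact: cvg_within.
  near (0 : R)^'+ => s.
  have s0 : 0 < s by near: s; exact: nbhs_right_gt.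
  have sr : s < 1 - r by near: s; apply: nbhs_right_lt; rewrite subr_gt0.
  exists (x + s *: h, s).
    by apply: BCA; split => /=; near: s; [exact: cvx|].
  rewrite /quot /= ler_pdivlMr// scalerN addrK.
  have := ext (r + s); rewrite in_itv/= /k => H.
  have {}H := H ltac:(apply/andP; split; lra).
  rewrite /x -addrA -scalerDl.
  by move: H; lra.
have [xi xix xih] := clarke_gradient_max x (- h) FL.
have := mono _ _ _ _ xix zw.
have -> : x - w = r *: h by rewrite /x addrAC subrr add0r.
have -> : (xi - zeta) (r *: h) = r * (xi h - zeta h).
  by rewrite dualBE !dualZ mulrBr.
rewrite normrZ gtr0_norm//.
move: key; rewrite -xih dualN lerN2 => key.
have n0 : 0 <= `|h| ^+ 2 by rewrite exprn_ge0.
rewrite exprMn => H.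
have {}H : - (c * (r * `|h| ^+ 2)) <= xi h - zeta h.
  rewrite -(ler_pM2l r0); apply: le_trans H.
  by rewrite le_eqVlt; apply/orP; left; apply/eqP; ring.
have : c * (r * `|h| ^+ 2) <= c * `|h| ^+ 2.
  by apply: ler_wpM2l => //; apply: ler_piMl => //; exact: ltW.
lra.
Unshelve. all: by end_near. Qed.

End clarke.

(** * A minimax theorem for matrix games *)

Section matrix_game.
Context {R : realType}.

Lemma simplex_compact n :
  compact [set v : 'rV[R]_n | (forall i, 0 <= v ord0 i) /\ \sum_i v ord0 i = 1].
Proof.
pose C := [set v : 'rV[R]_n | forall i, v ord0 i \in `[0, 1]%R].
have cC : compact C.
  by apply: (@rV_compact _ _ (fun=> `[0 : R, 1]%classic)) => _; exact: segment_compact.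
pose s (v : 'rV[R]_n) : R := \sum_i v ord0 i.
have cs : continuous s.
  apply: continuous_big => [|i _]; first exact: add_continuous.
  exact: coord_continuous.
have -> : [set v : 'rV[R]_n | (forall i, 0 <= v ord0 i) /\ \sum_i v ord0 i = 1]
    = C `&` s @^-1` [set 1].
  apply/seteqP; split => v /=; last first.
    by move=> [Cv sv]; split => // i; have := Cv i; rewrite in_itv => /andP[].
  move=> [v0 sv]; split => // i; rewrite in_itv/= v0/= -sv (bigD1 i)//= lerDl.
  exact: sumr_ge0.
apply: compact_closedI => //.
by move/continuous_closedP : cs; apply; exact: closed_eq.
Qed.

(** Ville's form of the minimax theorem, by minimizing over the simplex the
    squared distance of the payoff vector to the nonnegative orthant. *)
Lemma nonneg_game n (a : 'I_n -> 'I_n -> R) : (0 < n)%N ->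
  (forall l : 'I_n -> R, (forall i, 0 <= l i) ->
     0 <= \sum_i \sum_j l i * l j * a i j) ->
  exists u : 'I_n -> R, [/\ forall i, 0 <= u i, \sum_i u i = 1 &
    forall i, 0 <= \sum_j a i j * u j].
Proof.
move=> n0 apos.
pose S := [set v : 'rV[R]_n | (forall i, 0 <= v ord0 i) /\ \sum_i v ord0 i = 1].
(* the distance from [x] to the nonnegative half-line *)
pose neg (x : R) := (`|x| - x) / 2.
have neg0 x : 0 <= neg x by rewrite /neg divr_ge0// subr_ge0 ler_norm.
have negM x : neg x * x = - neg x ^+ 2.
  by rewrite /neg; have [x0|x0] := leP 0 x; [rewrite ger0_norm//|rewrite ltr0_norm//]; field.
(* [x + neg x] is nonnegative, hence a competitor for the distance at [x + d] *)
have negD x d : neg (x + d) ^+ 2 <= neg x ^+ 2 - 2 * (neg x * d) + d ^+ 2.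
  rewrite /neg; have [x0|x0] := leP 0 x; [rewrite (ger0_norm x0)|rewrite (ltr0_norm x0)];
  (have [y0|y0] := leP 0 (x + d); [rewrite (ger0_norm y0)|rewrite (ltr0_norm y0)]); nra.
pose pay (v : 'rV[R]_n) i := \sum_j a i j * v ord0 j.
pose Phi (v : 'rV[R]_n) : R := \sum_i neg (pay v i) ^+ 2.
have cpay i : continuous (pay ^~ i).
  apply: continuous_big => [|j _ v]; first exact: add_continuous.
  exact: (cvgM (cvg_cst (a i j)) (@coord_continuous R 1 n ord0 j v)).
have cPhi : continuous Phi.
  apply: continuous_big => [|i _ v]; first exact: add_continuous.
  have cn : neg (pay u i) @[u --> v] --> neg (pay v i).
    exact: (cvgM (cvgB (cvg_norm (cpay i v)) (cpay i v)) (cvg_cst _)).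
  exact: (cvgM cn cn).
have S0 : S !=set0.
  exists (\row_j (j == Ordinal n0)%:R); split => [i|]; first by rewrite mxE.
  rewrite (bigD1 (Ordinal n0))//= mxE eqxx big1 ?addr0// => i ine.
  by rewrite mxE (negbTE ine).
have [v /set_mem[v0 v1] vmin] :=
  EVT_min_rV S0 (@simplex_compact n) (continuous_subspaceT cPhi).
pose l i := neg (pay v i).
have [l0|lne] := eqVneq (\sum_i l i) 0.
  exists (v ord0); split => // i.
  have : l i = 0.
    by apply: (psumr_eq0P _ l0) => // j _; exact: neg0.
  rewrite /l /neg => li0; have e : `|pay v i| = pay v i by lra.
  by rewrite -[X in 0 <= X]/(pay v i) -e normr_ge0.
exfalso.
have lsum : 0 < \sum_i l i by rewrite lt_def lne; apply: sumr_ge0 => i _; exact: neg0.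
(* the losses, normalized into a mixed strategy *)
pose w : 'rV[R]_n := \row_j (l j / \sum_i l i).
have Sw : S w.
  split => [i|]; first by rewrite mxE; apply: divr_ge0; [exact: neg0|exact: ltW].
  under eq_bigr do rewrite mxE.
  by rewrite -mulr_suml divff.
pose d i := pay w i - pay v i.
(* optimality of [v] against the points of the segment towards [w] *)
have step e : 0 < e -> e <= 1 -> 2 * \sum_i l i * d i <= e * \sum_i d i ^+ 2.
  move=> e0 e1; rewrite -(ler_pM2l e0).
  have Sve : S (v + e *: (w - v)).
    have E i : (v + e *: (w - v)) ord0 i = (1 - e) * v ord0 i + e * w ord0 i.
      by rewrite !mxE; ring.
    split => [i|].
      by rewrite E; apply: addr_ge0; apply: mulr_ge0 => //; [lra|exact: ltW|exact: Sw.1].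
    under eq_bigr do rewrite E.
    by rewrite big_split/= -!mulr_sumr v1 Sw.2; ring.
  have := vmin _ (mem_set Sve).
  have pe i : pay (v + e *: (w - v)) i = pay v i + e * d i.
    rewrite /d /pay -sumrB mulr_sumr -big_split/=; apply: eq_bigr => j _.
    by rewrite !mxE; ring.
  have : Phi (v + e *: (w - v)) <= Phi v - 2 * e * (\sum_i l i * d i)
      + e ^+ 2 * \sum_i d i ^+ 2.
    rewrite /Phi !mulr_sumr -sumrB -big_split/=; apply: ler_sum => i _.
    rewrite pe; apply: (le_trans (negD _ _)).
    by rewrite le_eqVlt; apply/orP; left; apply/eqP; rewrite /l; ring.
  by move=> h1 h2; have := le_trans h2 h1; nra.
have ld : \sum_i l i * d i <= 0.
  apply/ler_addgt0Pr => e e0; rewrite add0r.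
  have D0 : 0 <= \sum_i d i ^+ 2 by apply: sumr_ge0 => i _; exact: sqr_ge0.
  set D := \sum_i d i ^+ 2 in D0 step.
  have e'0 : 0 < Num.min 1 (e / (D + 1)).
    by rewrite lt_min ltr01 divr_gt0// ltr_wpDl.
  have e'1 : Num.min 1 (e / (D + 1)) <= 1 by rewrite ge_min lexx.
  have := step _ e'0 e'1.
  have : Num.min 1 (e / (D + 1)) * D <= e.
    apply: (@le_trans _ _ (e / (D + 1) * D)).
      by rewrite ler_wpM2r// ge_min lexx orbT.
    rewrite mulrAC ler_pdivrMr ?ltr_wpDl// ler_wpM2l ?ltW//; lra.
  by move=> h1 h2; have := le_trans h2 h1; lra.
have lw : 0 <= \sum_i l i * pay w i.
  have -> : \sum_i l i * pay w i = (\sum_i \sum_j l i * l j * a i j) / \sum_i l i.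
    rewrite mulr_suml; apply: eq_bigr => i _.
    rewrite /pay mulr_sumr mulr_suml; apply: eq_bigr => j _.
    by rewrite mxE; ring.
  by apply: divr_ge0; [apply: apos => i; exact: neg0|exact: ltW].
have lv : \sum_i l i * pay v i = - \sum_i l i ^+ 2.
  by rewrite -sumrN; apply: eq_bigr => i _; rewrite negM.
have l20 : \sum_i l i ^+ 2 <= 0.
  move: ld; rewrite /d; under eq_bigr do rewrite mulrBr.
  by rewrite sumrB lv; lra.
move/eqP: lne; apply; apply: big1 => i _.
have : \sum_i l i ^+ 2 = 0.
  by apply/eqP; rewrite eq_le l20 sumr_ge0// => j _; exact: sqr_ge0.
move=> l2; apply/eqP; rewrite -sqrf_eq0; apply/eqP.
by apply: (psumr_eq0P _ l2) => // j _; exact: sqr_ge0.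
Qed.

End matrix_game.

(** * Weak limits in reflexive spaces and Minty's inequalities *)

Section ultrafilters.

Lemma ultra_compact_cvg (I : Type) (T : topologicalType) (U : set_system I)
    (f : I -> T) (K : set T) : UltraFilter U -> compact K ->
  U (f @^-1` K) -> exists2 p, K p & f @ U --> p.
Proof.
move=> UU cK UK; have [p [Kp clp]] := cK (f @ U) _ UK.
exists p => // B Bp; have [//|UnB] := in_ultra_setVsetC (f @^-1` B) UU.
by have [y [/= nBy By]] := clp (~` B) B UnB Bp.
Qed.

(** Otherwise [F] together with the complement of some preimage generates a
    proper filter, and an ultrafilter finer than it contradicts the hypothesis. *)
Lemma cvg_ultra (I : Type) (T : topologicalType) (F : set_system I)
    (f : I -> T) (l : T) : Filter F ->
  (forall U : set_system I, UltraFilter U -> F `<=` U -> f @ U --> l) ->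
  f @ F --> l.
Proof.
move=> FF H B Bl; apply: contrapT => nFB.
have wF : ProperFilter (within (~` (f @^-1` B)) F).
  apply: Build_ProperFilter_ex => P wP; apply: contrapT => nP.
  apply: nFB; change (F (f @^-1` B)).
  have {}wP : F [set i | ~ B (f i) -> P i] := wP.
  apply: filterS wP => i Pi; apply: contrapT => nB.
  by apply: nP; exists i; exact: Pi.
have [U [UU FU]] := ultraFilterLemma wF.
have FU' : F `<=` U.
  by move=> P FP; apply: FU; rewrite /within/=; apply: filterS FP => i Pi _.
have UB : U (f @^-1` B) := H U UU FU' B Bl.
have UnB : U (~` (f @^-1` B)) by apply: FU; exact: withinT.
by have [x [/= Bx nBx]] := filter_ex (filterI UB UnB).
Qed.

End ultrafilters.

Section weak_compactness.
Context {R : realType} {X : normedModType R}.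

(** Bounded families in a reflexive space converge weakly along every
    ultrafilter: the limits of the values of the functionals form an element
    of the bidual. *)
Lemma ultra_weak_cvg (I : Type) (U : set_system I) (x : I -> X) (M : R) :
  reflexive_space X -> UltraFilter U -> (\forall i \near U, `|x i| <= M) ->
  exists2 y : X, `|y| <= M & forall phi : topdual X, phi (x i) @[i --> U] --> phi y.
Proof.
move=> refl UU xM.
have lim_ex (phi : topdual X) : exists2 r : R, r <= `|phi| * M & phi (x i) @[i --> U] --> r.
  have [|r] := @ultra_compact_cvg I R U (fun i => phi (x i))
    `[- (`|phi| * M), `|phi| * M]%classic UU (@segment_compact _ _ _).
    apply: (filterS _ xM) => i xiM /=; rewrite in_itv/= -ler_norml.
    by apply: le_trans (dual_norm_le phi (x i)) _; rewrite ler_wpM2l.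
  by rewrite /= in_itv/= => /andP[_ rM] xr; exists r.
pose l phi := sval (cid2 (lim_ex phi)).
have lM phi : l phi <= `|phi| * M by rewrite /l; case: cid2.
have lcvg (phi : topdual X) : phi (x i) @[i --> U] --> l phi by rewrite /l; case: cid2.
have [||Phi PhiE] := @bounded_functional R (topdual X) l M.
- move=> a phi psi; apply: (@cvg_unique _ _ ((fun i => (a *: phi + psi) (x i)) @ U)) => //.
    exact: lcvg.
  have -> : (fun i => (a *: phi + psi) (x i)) = (fun i => a * phi (x i) + psi (x i)).
    by apply/funext => i.
  by apply: cvgD; [apply: cvgM; [exact: cvg_cst|exact: lcvg]|exact: lcvg].
- by move=> phi; rewrite mulrC.
have [y yE] := refl Phi.
have yl (phi : topdual X) : phi y = l phi by rewrite -yE PhiE.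
exists y; last by move=> phi; rewrite yl; exact: lcvg.
apply: norm_le_dual => phi phi1; rewrite yl; apply: (cvgr_to_le (lcvg phi)).
apply: filterS xM => i; apply: le_trans.
exact: le_trans (ler_norm _) (phi1 _).
Qed.

Section minty.
Variables (G : set (X * topdual X)) (r : R).
Hypothesis G_mono : forall p q, G p -> G q -> 0 <= (p.2 - q.2) (p.1 - q.1).
Hypothesis r_ge0 : 0 <= r.

(** The matrix with entries p_i.2 (p_i.1 - p_j.1) has a nonnegative quadratic
    form, so the associated game provides the convex combination. *)
Lemma minty_finite (s : seq (X * topdual X)) :
  exists x, `|x| <= r /\
    forall p, p \in s -> G p -> `|p.1| <= r -> 0 <= p.2 (p.1 - x).
Proof.
pose s' := [seq p <- s | `[< G p /\ `|p.1| <= r >]].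
have [s0|sn0] := posnP (size s').
  exists 0; rewrite normr0; split => // p ps Gp pr.
  have : p \in s' by rewrite mem_filter ps andbT; apply/asboolP.
  by rewrite (size0nil s0).
pose P (i : 'I_(size s')) := nth (0, 0) s' i.
have PG i : G (P i) /\ `|(P i).1| <= r.
  have : P i \in s' by exact: mem_nth.
  by rewrite mem_filter => /andP[/asboolP].
pose a i j := (P i).2 ((P i).1 - (P j).1).
have [|u [u0 u1 au]] := @nonneg_game R (size s') a sn0.
  move=> l l0.
  have sym : \sum_i \sum_j l i * l j * a i j = \sum_i \sum_j l i * l j * a j i.
    by rewrite exchange_big/=; apply: eq_bigr => i _; apply: eq_bigr => j _; ring.
  have : 0 <= \sum_i \sum_j l i * l j * (a i j + a j i).
    apply: sumr_ge0 => i _; apply: sumr_ge0 => j _.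
    apply: mulr_ge0; first exact: mulr_ge0.
    have := G_mono (PG i).1 (PG j).1; rewrite dualBE /a.
    by rewrite -(opprB (P i).1 (P j).1) dualN.
  have -> : \sum_i \sum_j l i * l j * (a i j + a j i) =
    \sum_i \sum_j l i * l j * a i j + \sum_i \sum_j l i * l j * a j i.
    rewrite -big_split/=; apply: eq_bigr => i _.
    by rewrite -big_split/=; apply: eq_bigr => j _; ring.
  rewrite -sym; lra.
exists (\sum_j u j *: (P j).1); split.
  apply: le_trans (ler_norm_sum _ _ _) _.
  apply: (@le_trans _ _ (\sum_j u j * r)); last by rewrite -mulr_suml u1 mul1r.
  apply: ler_sum => j _; rewrite normrZ ger0_norm// ler_wpM2l//.
  exact: (PG j).2.
move=> p ps Gp pr.
have ps' : p \in s' by rewrite mem_filter ps andbT; apply/asboolP.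
have szp : (index p s' < size s')%N by rewrite index_mem.
have -> : p = P (Ordinal szp) by rewrite /P/= nth_index.
set i := Ordinal szp.
suff -> : (P i).2 ((P i).1 - \sum_j u j *: (P j).1) = \sum_j a i j * u j by exact: au.
have -> : (P i).1 - \sum_j u j *: (P j).1 = \sum_j u j *: ((P i).1 - (P j).1).
  under [RHS]eq_bigr do rewrite scalerBr.
  by rewrite sumrB -scaler_suml u1 scale1r.
rewrite dual_sum; apply: eq_bigr => j _.
by rewrite dualZ mulrC.
Qed.

(** The finite systems of [minty_finite] have the finite intersection
    property; along an ultrafilter containing all of them the identity has a weak
    limit, and the inequalities are weakly closed. *)
Lemma minty_ball : reflexive_space X ->
  exists x, `|x| <= r /\ forall p, G p -> `|p.1| <= r -> 0 <= p.2 (p.1 - x).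
Proof.
move=> refl.
pose C (s : seq (X * topdual X)) := [set x | `|x| <= r /\
    forall p, p \in s -> G p -> `|p.1| <= r -> 0 <= p.2 (p.1 - x)].
have FC : ProperFilter (filter_from setT C).
  apply: filter_from_proper; last by move=> s _; exact: minty_finite.
  apply: filter_fromT_filter; first by exists [::].
  move=> s s'; exists (s ++ s') => x [xr H]; split; split => // p ps;
  by apply: H; rewrite mem_cat ps ?orbT.
have [U [UU FU]] := ultraFilterLemma FC.
have UC s : U (C s) by apply: FU; exists s.
have [|y yr ycvg] := @ultra_weak_cvg X U id r refl UU.
  by apply: filterS (UC [::]) => x [].
exists y; split => // p Gp pr.
have cp : p.2 (p.1 - x) @[x --> U] --> p.2 (p.1 - y).
  rewrite dualB; under eq_fun do rewrite dualB.
  by apply: cvgB; [exact: cvg_cst|exact: ycvg].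
apply: (cvgr_to_ge cp); apply: filterS (UC [:: p]) => x [_]; apply => //.
by rewrite mem_head.
Qed.

End minty.
End weak_compactness.

(** * Solvability of the stationary inclusion *)

Definition relaxed_monotone {R : realType} {X : normedModType R}
    (F : X -> R) (c : R) :=
  forall y1 y2 theta1 theta2,
    clarke_gradient F y1 theta1 -> clarke_gradient F y2 theta2 ->
    - c * `|y1 - y2| ^+ 2 <= (theta1 - theta2) (y1 - y2).

Section hemivariational_inclusion.
Context {R : realType} {Y Z : normedModType R}.
Variables (B : Z -> topdual Z) (N : 'L(Z, Y)) (F : Y -> R) (mA c : R).
Hypothesis reflZ : reflexive_space Z.
Hypothesis B_demi : demicontinuous B.
Hypothesis B_mono : strongly_monotone B mA.
Hypothesis N_surj : forall x, exists y, N y = x.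
Hypothesis F_lip : locally_lipschitz F.
Hypothesis c_ge0 : 0 <= c.
Hypothesis F_mono : relaxed_monotone F c.
Hypothesis mA_gt : c * `|N| ^+ 2 < mA.

Lemma blinB (x y : Z) : N (x - y) = N x - N y.
Proof. by rewrite linearB. Qed.

Lemma blinD (x y : Z) : N (x + y) = N x + N y.
Proof. by rewrite linearD. Qed.

Lemma blinZ (a : R) (x : Z) : N (a *: x) = a *: N x.
Proof. by rewrite linearZ. Qed.

Lemma inclusion_strongly_monotone (v1 v2 : Z) (zeta1 zeta2 : topdual Y) :
  clarke_gradient F (N v1) zeta1 -> clarke_gradient F (N v2) zeta2 ->
  (mA - c * `|N| ^+ 2) * `|v1 - v2| ^+ 2 <=
    ((B v1 + adjoint N zeta1) - (B v2 + adjoint N zeta2)) (v1 - v2).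
Proof.
move=> z1 z2; have hB := B_mono v1 v2; have hF := F_mono z1 z2.
have nN : `|N v1 - N v2| ^+ 2 <= `|N| ^+ 2 * `|v1 - v2| ^+ 2.
  by rewrite -exprMn -blinB ler_sqr ?nnegrE ?mulr_ge0// blin_norm_le.
have {}nN := ler_wpM2l c_ge0 nN.
rewrite dualBE !dualDE -[adjoint N zeta1 _]/(zeta1 (N _)) -[adjoint N zeta2 _]/(zeta2 (N _)) blinB.
move: hB hF; rewrite !dualBE; lra.
Qed.

Lemma inclusion_lipschitz (v1 v2 : Z) (zeta1 zeta2 : topdual Y) (b1 b2 : topdual Z) :
  clarke_gradient F (N v1) zeta1 -> clarke_gradient F (N v2) zeta2 ->
  B v1 + adjoint N zeta1 = b1 -> B v2 + adjoint N zeta2 = b2 ->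
  `|v1 - v2| <= `|b1 - b2| / (mA - c * `|N| ^+ 2).
Proof.
move=> z1 z2 e1 e2; have := inclusion_strongly_monotone z1 z2; rewrite e1 e2.
move=> /le_trans/(_ (dual_le _ _)).
rewrite ler_pdivlMr ?subr_gt0//.
have [->|n0] := eqVneq (v1 - v2) 0; first by rewrite !normr0 mul0r.
by rewrite expr2 mulrA ler_pM2r ?normr_gt0// mulrC.
Qed.

Section solve.
Variable b : topdual Z.

Lemma clarke_gradient_nonempty (y : Y) : exists zeta, clarke_gradient F y zeta.
Proof. by have [zeta ? _] := clarke_gradient_max y 0 F_lip; exists zeta. Qed.

(** Minty's linearization: test points [x + s (w - x)] with [s --> 0] in the
    monotone inequalities.  Demicontinuity handles [B], upper semicontinuity of
    the Clarke derivative handles the gradients. *)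
Lemma variational_inequality_ball (r : R) : 0 <= r ->
  exists x, `|x| <= r /\ forall w, `|w| <= r ->
    0 <= (B x - b) (w - x) + clarke_deriv F (N x) (N (w - x)).
Proof.
move=> r0.
pose G := [set p : Z * topdual Z | exists2 zeta, clarke_gradient F (N p.1) zeta &
    p.2 = B p.1 + adjoint N zeta - b].
have Gm p q : G p -> G q -> 0 <= (p.2 - q.2) (p.1 - q.1).
  move=> [z1 G1 ->] [z2 G2 ->].
  have := inclusion_strongly_monotone G1 G2.
  rewrite opprB addrA subrK; apply: le_trans.
  by rewrite mulr_ge0 ?exprn_ge0 ?subr_ge0// ltW.
have [x [xr Hx]] := minty_ball Gm r0 reflZ.
exists x; split => // w wr.
set h := N (w - x); set D := (B x - b) (w - x); set E := clarke_deriv F (N x) h.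
rewrite leNgt; apply/negP => DE.
(* half of the supposed deficit, to be lost in the limit *)
pose e := - (D + E) / 2.
have e0 : 0 < e by rewrite /e; lra.
have usc : \forall y \near N x, clarke_deriv F y h <= E + e.
  by apply: clarke_deriv_usc => //; rewrite ltrDl.
pose s (n : nat) : R := n.+1%:R^-1.
have s0 n : 0 < s n by rewrite invr_gt0.
have s1 n : s n <= 1 by rewrite invf_le1// ler1n.
have scvg : s n @[n --> \oo] --> 0 by exact: cvg_harmonic.
pose v n := x + s n *: (w - x).
have vcvg : v n @[n --> \oo] --> x.
  rewrite -[X in _ --> X]addr0; apply: cvgD; first exact: cvg_cst.
  by rewrite -[X in _ --> X](scale0r (w - x)); apply: cvgZl.
have vr n : `|v n| <= r.
  have -> : v n = (1 - s n) *: x + s n *: w.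
    by rewrite /v scalerBr scalerBl scale1r addrA addrAC.
  apply: le_trans (ler_normD _ _) _.
  rewrite !normrZ (gtr0_norm (s0 n)) ger0_norm ?subr_ge0//.
  have h1 : (1 - s n) * `|x| <= (1 - s n) * r by rewrite ler_wpM2l// subr_ge0.
  have h2 : s n * `|w| <= s n * r by rewrite ler_wpM2l// ltW.
  lra.
have Nv : N (v n) @[n --> \oo] --> N x.
  by apply: continuous_cvg => //; exact: blin_continuous.
have key n : 0 <= (B (v n)) (w - x) - b (w - x) + clarke_deriv F (N (v n)) h.
  have [zeta zv] := clarke_gradient_nonempty (N (v n)).
  have Gv : G (v n, B (v n) + adjoint N zeta - b) by exists zeta.
  have : 0 <= (B (v n) + adjoint N zeta - b) (v n - x) by exact: Hx Gv (vr n).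
  have -> : v n - x = s n *: (w - x) by rewrite /v addrAC subrr add0r.
  rewrite dualZ pmulr_rge0// dualBE dualDE -[adjoint N zeta _]/(zeta h).
  have := (clarke_gradientP _ _ F_lip).1 zv h; lra.
have lim : B (v n) (w - x) - b (w - x) + (E + e) @[n --> \oo] --> D + (E + e).
  apply: cvgD; last exact: cvg_cst.
  rewrite /D dualBE; apply: cvgB; last exact: cvg_cst.
  have [phi phiE] : exists Phi : topdual (topdual Z), forall phi : topdual Z, Phi phi = phi (w - x).
    apply: (@bounded_functional _ _ _ `|w - x|) => // phi.
    by rewrite mulrC; exact: dual_le.
  have wc : weak_cvgn (fun n => B (v n)) (B x) := B_demi vcvg.
  have := wc phi; rewrite phiE; under eq_fun do rewrite phiE.
  by [].
have : 0 <= D + (E + e).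
  apply: (cvgr_to_ge lim); near=> n.
  apply: le_trans (key n) _; rewrite lerD2l; near: n.
  exact: Nv usc.
rewrite /e; lra.
Unshelve. all: by end_near. Qed.

(** Coercivity keeps the solution in the interior of a large ball. *)
Lemma hemivariational_inequality_solvable : exists x, forall u,
  0 <= (B x - b) u + clarke_deriv F (N x) (N u).
Proof.
have [zeta0 G0] := clarke_gradient_nonempty (N 0).
pose mm := mA - c * `|N| ^+ 2.
have mm0 : 0 < mm by rewrite subr_gt0.
pose xi0 := B 0 + adjoint N zeta0 - b.
(* strong monotonicity against the graph point over 0 bounds a zero by [|xi0| / mm] *)
pose r := `|xi0| / mm + 1.
have r0 : 0 <= r by rewrite addr_ge0// divr_ge0// ltW.
have [x [xr Hx]] := variational_inequality_ball r0.
have xlt : `|x| < r.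
  have [zeta Gz zmax] := clarke_gradient_max (N x) (N (0 - x)) F_lip.
  have := Hx 0; rewrite normr0 => /(_ r0).
  rewrite -zmax => h0.
  have := inclusion_strongly_monotone Gz G0.
  rewrite -/mm subr0 => h1.
  have h2 : mm * `|x| ^+ 2 <= `|xi0| * `|x|.
    apply: le_trans h1 _.
    apply: (@le_trans _ _ (- xi0 x)); last first.
      apply: le_trans (ler_norm _) _; rewrite normrN; exact: dual_norm_le.
    move: h0; rewrite /xi0 sub0r !dualBE !dualDE dualN dualN.
    rewrite -[adjoint N zeta x]/(zeta (N x)).
    have -> : N (- x) = - N x by rewrite linearN.
    rewrite dualN; lra.
  rewrite /r; apply: (@le_lt_trans _ _ (`|xi0| / mm)); last by rewrite ltrDl.
  rewrite ler_pdivlMr//.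
  have [->|n0] := eqVneq x 0; first by rewrite !normr0 mul0r.
  by move: h2; rewrite expr2 mulrA ler_pM2r ?normr_gt0// mulrC.
exists x => u.
pose s := (r - `|x|) / (`|u| + 1).
have s0 : 0 < s by rewrite divr_gt0 ?subr_gt0// ltr_wpDl.
have wr : `|x + s *: u| <= r.
  apply: le_trans (ler_normD _ _) _.
  rewrite normrZ gtr0_norm// -lerBrDl /s mulrAC ler_pdivrMr ?ltr_wpDl//.
  by rewrite ler_wpM2l ?subr_ge0 ?ltW// ltrDl.
have := Hx _ wr.
have -> : x + s *: u - x = s *: u by rewrite addrAC subrr add0r.
rewrite dualZ blinZ (sublinear_ge0Z _ (clarke_deriv_sublinear _ F_lip) (ltW s0)).
by rewrite -mulrDr pmulr_rge0.
Qed.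

(** The inequality forces [b - B x] to vanish on the kernel of [N], so that it
    factors through the surjection [N]; the factor lies below the Clarke
    derivative, which is what membership in the gradient means. *)
Lemma inclusion_solvable : exists x, exists2 eta,
  (adjoint N @` clarke_gradient F (N x)) eta & B x + eta = b.
Proof.
have [x Hx] := hemivariational_inequality_solvable.
have sF := clarke_deriv_sublinear (N x) F_lip.
pose l (y : Y) : R := (b - B x) (sval (cid (N_surj y))).
have lN u : l (N u) = (b - B x) u.
  rewrite /l; case: cid => u' /= e.
  have ker v : N v = 0 -> 0 <= (B x - b) v.
    by move=> Nv; have := Hx v; rewrite Nv (sublinear0 sF) addr0.
  have h1 := ker (u' - u); have h2 := ker (u - u').
  move: h1 h2; rewrite !blinB e subrr !dualB !dualBE => /(_ erefl) h1 /(_ erefl) h2.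
  by have : b u' - B x u' = b u - B x u :> R by lra.
have ll (a : R) y1 y2 : l (a *: y1 + y2) = a * l y1 + l y2.
  have [u1 <-] := N_surj y1; have [u2 <-] := N_surj y2.
  by rewrite -blinZ -blinD !lN dualD dualZ.
have lle y : l y <= clarke_deriv F (N x) y.
  have [u <-] := N_surj y; rewrite lN; have := Hx u; rewrite !dualBE; lra.
have [k k0 ck] := clarke_deriv_bound (N x) F_lip.
have [|eta etaE] := @bounded_functional R Y l k ll.
  by move=> y; exact: le_trans (lle y) (ck y).
exists x, (adjoint N eta).
  by exists eta => //; apply/clarke_gradientP => // y; rewrite etaE.
apply/val_inj/funext => u; change (B x u + eta (N u) = b u).
by rewrite etaE lN dualBE addrC subrK.
Qed.

End solve.
End hemivariational_inclusion.

(** * Dependence of the stationary solution on time *)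

Section strong_weak.
Context {R : realType} {X : normedModType R}.

(** Strongly convergent functionals applied to a bounded, weakly convergent
    family. *)
Lemma cvg_dual_weak (I : Type) (U : set_system I) (x : I -> X) (y : X)
    (phi : I -> topdual X) (psi : topdual X) (M : R) : Filter U ->
  (\forall i \near U, `|x i| <= M) ->
  (forall chi : topdual X, chi (x i) @[i --> U] --> chi y) ->
  phi @ U --> psi -> phi i (x i) @[i --> U] --> psi y.
Proof.
move=> FU xM xy phipsi.
have d0 : (phi i - psi) (x i) @[i --> U] --> (0 : R).
  apply/cvgrPdist_le => e e0.
  have M0 : 0 < `|M| + 1 by rewrite ltr_wpDl.
  have /cvgrPdist_le/(_ (e / (`|M| + 1))) := phipsi.
  rewrite divr_gt0// => /(_ isT) H.
  near=> i; rewrite sub0r normrN.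
  apply: le_trans (dual_norm_le _ _) _.
  have h1 : `|phi i - psi| <= e / (`|M| + 1) by rewrite distrC; near: i.
  have h2 : `|x i| <= `|M| + 1.
    apply: (@le_trans _ _ M); first by near: i.
    by apply: le_trans (ler_norm M) _; rewrite lerDl.
  by rewrite -[leRHS](divfK (lt0r_neq0 M0)); exact: ler_pM.
have -> : (fun i => phi i (x i)) = (fun i => psi (x i) + (phi i - psi) (x i)).
  by apply/funext => i; rewrite dualBE addrC subrK.
rewrite -[X in _ --> X]addr0; apply: cvgD => //; exact: xy.
Unshelve. all: by end_near. Qed.

End strong_weak.

Section continuous_dependence.
Context {R : realType} {Y Z : normedModType R}.
Variables (T : R) (A : R -> Z -> topdual Z) (N : 'L(Z, Y)) (J : R -> Y -> R).
Variables (mA c mJ : R) (b : topdual Z) (y : R -> Z) (eta : R -> topdual Y).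
Hypothesis reflZ : reflexive_space Z.
Hypothesis A_cont : forall v, {within `[0, T], continuous (fun t => A t v)}.
Hypothesis A_demi : forall t, 0 <= t <= T -> demicontinuous (A t).
Hypothesis A_mono : forall t, 0 <= t <= T -> strongly_monotone (A t) mA.
Hypothesis N_compact : compact_operator N.
Hypothesis J_cont : forall x, {within `[0, T], continuous (fun t => J t x)}.
Hypothesis J_lip : forall t, 0 <= t <= T -> locally_lipschitz (J t).
Hypothesis J_growth : forall t, 0 <= t <= T -> forall x theta,
  clarke_gradient (J t) x theta -> `|theta| <= mJ * (`|x| + 1).
Hypothesis c_ge0 : 0 <= c.
Hypothesis J_mono : forall t, 0 <= t <= T -> relaxed_monotone (J t) c.
Hypothesis mA_gt : c * `|N| ^+ 2 < mA.
Hypothesis y_sol : forall t, 0 <= t <= T ->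
  clarke_gradient (J t) (N (y t)) (eta t) /\ A t (y t) + adjoint N (eta t) = b.

Let mm := mA - c * `|N| ^+ 2.
Let mm_gt0 : 0 < mm. Proof. by rewrite subr_gt0. Qed.

(** Strong monotonicity compared at an arbitrary test point [v], where any
    gradient of [J t] at [N v] may be used; this allows [v] to be fixed while
    [t] varies. *)
Lemma test_inequality t v zeta : 0 <= t <= T -> clarke_gradient (J t) (N v) zeta ->
  mm * `|y t - v| ^+ 2 <= (b - A t v) (y t - v) - zeta (N (y t - v)).
Proof.
move=> tT Gz; have [Ge e] := y_sol tT.
have := inclusion_strongly_monotone (A_mono tT) c_ge0 (J_mono tT) Ge Gz.
rewrite e -/mm !dualBE dualDE => /le_trans; apply.
by rewrite -[adjoint N zeta _]/(zeta (N _)) opprD addrA.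
Qed.

Section at_point.
Variables (t0 : R) (U : set_system R).
Hypothesis t0T : 0 <= t0 <= T.
Hypothesis UU : UltraFilter U.
Hypothesis U_T : \forall t \near U, 0 <= t <= T.
Hypothesis U_A : forall v, A t v @[t --> U] --> A t0 v.
Hypothesis U_J : forall x, J t x @[t --> U] --> J t0 x.

Lemma solution_bounded : exists M, \forall t \near U, `|y t| <= M.
Proof.
pose K := mJ * (`|N (y t0)| + 1).
pose L := `|b - A t0 (y t0)| + 1 + K * `|N|.
exists (L / mm + `|y t0|).
have H1 : \forall t \near U, `|A t0 (y t0) - A t (y t0)| <= 1.
  by have /cvgrPdist_le := @U_A (y t0); apply.
near=> t.
have tT : 0 <= t <= T by near: t.
have [zeta Gz] := clarke_gradient_nonempty (J_lip tT) (N (y t0)).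
have zK : `|zeta| <= K := J_growth tT Gz.
have K0 : 0 <= K := le_trans (normr_ge0 _) zK.
have := test_inequality tT Gz.
set d := y t - y t0 => h.
have h1 : (b - A t (y t0)) d <= (`|b - A t0 (y t0)| + 1) * `|d|.
  apply: le_trans (dual_le _ _) _; rewrite ler_wpM2r//.
  rewrite -(subrKA (A t0 (y t0))).
  by apply: le_trans (ler_normD _ _) _; rewrite lerD2l; near: t.
have h2 : - zeta (N d) <= K * `|N| * `|d|.
  apply: le_trans (ler_norm _) _; rewrite normrN.
  apply: le_trans (dual_norm_le _ _) _.
  by rewrite -mulrA; apply: ler_pM => //; exact: blin_norm_le.
have h3 : mm * `|d| ^+ 2 <= L * `|d|.
  apply: le_trans h _; rewrite /L mulrDl; lra.
have dL : `|d| <= L / mm.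
  rewrite ler_pdivlMr//; have [->|n0] := eqVneq d 0.
    by rewrite normr0 mul0r /L; rewrite !addr_ge0// mulr_ge0.
  by move: h3; rewrite expr2 mulrA ler_pM2r ?normr_gt0// mulrC.
by have := ler_normD d (y t0); rewrite /d subrK => /le_trans; apply; rewrite lerD2r.
Unshelve. all: by end_near. Qed.

(** With [yb] the weak limit of [y t], test at [v = y t0 + s (yb - y t0)].
    Compactness of [N] gives strong convergence of [N (y t)], so the gradients
    chosen at [N v] matter only in the direction [h = N (yb - y t0)], where
    [clarke_semiconvex] bounds them by values of [J t]; these converge.  The
    limit of [mm |y t - v|^2] is then at most [|w s|], which vanishes with [s]. *)
Lemma ultra_continuity : y @ U --> y t0.
Proof.
have [M yM] := solution_bounded.
have [yb ybM ycvg] := ultra_weak_cvg reflZ UU yM.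
have Ny : N (y t) @[t --> U] --> N yb.
  have cK : compact (closure (N @` [set v | `|v| <= M])).
    rewrite -precompactE; apply: N_compact; exists M; split; first exact: num_real.
    by move=> x Mx v vM; exact: le_trans vM (ltW Mx).
  have [|x _ xcvg] := ultra_compact_cvg UU cK (f := fun t => N (y t)).
    by apply: filterS yM => t yt; apply: subset_closure; exists (y t).
  suff <- : x = N yb by [].
  apply: dual_separates => phi.
  apply: (@cvg_unique _ _ ((fun t => phi (N (y t))) @ U)) => //.
    by apply: continuous_cvg => //; exact: blin_continuous.
  exact: ycvg (adjoint N phi).
pose k := yb - y t0; pose h := N k; pose x := N (y t0).
have [Ge e] := y_sol t0T.
(* twice the loss of [clarke_semiconvex]: it is applied at [x] and at [x + s h] *)
pose w (s : R) : R := (A t0 (y t0) - A t0 (y t0 + s *: k)) k + 2 * c * s * `|h| ^+ 2.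
have step s (eps : R) : 0 < s -> s <= 1 -> 0 < eps ->
    \forall t \near U, mm * `|y t - (y t0 + s *: k)| ^+ 2 <= `|w s| + eps.
  move=> s0 s1 e0; set v := y t0 + s *: k.
  have ybv : yb - v = (1 - s) *: k.
    by rewrite /v opprD addrA -/k scalerBl scale1r.
  have Nv : N v = x + s *: h by rewrite /v blinD blinZ.
  pose K := mJ * (`|N v| + 1).
  pose a t : R := (b - A t v) (y t - v) + K * `|N (y t) - N yb| +
    (1 - s) * ((J t x - J t (x + s *: h)) / s + c * s * `|h| ^+ 2).
  have aub : \forall t \near U, mm * `|y t - v| ^+ 2 <= a t.
    apply: filterS U_T => t tT.
    have [zeta Gz] := clarke_gradient_nonempty (J_lip tT) (N v).
    apply: le_trans (test_inequality tT Gz) _.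
    rewrite /a; move: ((b - A t v) (y t - v)) => q.
    rewrite -[leRHS]addrA lerD2l.
    have -> : N (y t - v) = (N (y t) - N yb) + (1 - s) *: h.
      by rewrite -blinZ -ybv !blinB addrA subrK.
    rewrite dualD dualZ opprD; apply: lerD.
      apply: le_trans (ler_norm _) _; rewrite normrN.
      apply: le_trans (dual_norm_le _ _) _; rewrite ler_wpM2r//.
      exact: J_growth Gz.
    rewrite -mulrN ler_wpM2l ?subr_ge0//.
    have := clarke_semiconvex x (J_lip tT) c_ge0 (J_mono tT) Gz.
    have -> : x - N v = - (s *: h) by rewrite Nv opprD addrA subrr add0r.
    rewrite dualN dualZ normrN normrZ (gtr0_norm s0) Nv => sc.
    rewrite -(ler_pM2l s0) mulrDr (mulrC s (_ / s)) divfK ?gt_eqF//.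
    move: sc; rewrite exprMn; lra.
  pose al : R := (b - A t0 v) (yb - v) + K * 0 +
    (1 - s) * ((J t0 x - J t0 (x + s *: h)) / s + c * s * `|h| ^+ 2).
  have acvg : a t @[t --> U] --> al.
    apply: cvgD; first apply: cvgD.
    - have [Mv yvM] : exists Mv, \forall t \near U, `|y t - v| <= Mv.
        exists (M + `|v|); apply: filterS yM => t yt.
        by apply: le_trans (ler_normB _ _) _; rewrite lerD2r.
      apply: (@cvg_dual_weak _ _ _ U (fun t => y t - v) (yb - v)
        (fun t => b - A t v) (b - A t0 v) Mv _ yvM).
        move=> chi; rewrite dualB; under eq_fun do rewrite dualB.
        by apply: cvgB; [exact: ycvg|exact: cvg_cst].
      by apply: cvgB; [exact: cvg_cst|exact: U_A].
    - apply: cvgM; first exact: cvg_cst.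
      rewrite -(normr0 Y) -(subrr (N yb)); apply: cvg_norm.
      by apply: cvgB => //; exact: cvg_cst.
    - apply: cvgM; first exact: cvg_cst.
      apply: cvgD; last exact: cvg_cst.
      apply: cvgM; last exact: cvg_cst.
      by apply: cvgB; exact: U_J.
  have alw : al <= `|w s|.
    apply: (@le_trans _ _ ((1 - s) * w s)); last first.
      apply: le_trans (ler_norm _) _; rewrite normrM ger0_norm ?subr_ge0//.
      by rewrite ler_piMl//; lra.
    rewrite /al ybv mulr0 addr0 dualZ -mulrDr ler_wpM2l ?subr_ge0//.
    have := clarke_semiconvex (x + s *: h) (J_lip t0T) c_ge0 (J_mono t0T) Ge.
    have -> : x + s *: h - N (y t0) = s *: h by rewrite addrAC subrr add0r.
    rewrite dualZ normrZ (gtr0_norm s0) -/x => sc.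
    have hk : eta t0 h = (b - A t0 (y t0)) k.
      by rewrite -e addrAC subrr add0r.
    have sc' : (J t0 x - J t0 (x + s *: h)) / s <= - eta t0 h + c * s * `|h| ^+ 2.
      rewrite ler_pdivrMr//; move: sc; rewrite exprMn; lra.
    move: sc'; rewrite hk /w -/v !dualBE; lra.
  have ale : \forall t \near U, a t <= `|w s| + eps.
    by move/cvgr_le: acvg; apply; rewrite (le_lt_trans alw)// ltrDl.
  by apply: filterS2 aub ale => t; exact: le_trans.
have w0 : w (n.+1%:R^-1) @[n --> \oo] --> (0 : R).
  have scvg : (n.+1%:R^-1 : R) @[n --> \oo] --> 0 by exact: cvg_harmonic.
  have vcvg : y t0 + n.+1%:R^-1 *: k @[n --> \oo] --> y t0.
    rewrite -[X in _ --> X]addr0; apply: cvgD; first exact: cvg_cst.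
    by rewrite -[X in _ --> X](scale0r k); apply: cvgZl.
  rewrite -[X in _ --> X]addr0; apply: cvgD.
    rewrite -(subrr (A t0 (y t0) k)).
    under eq_fun do rewrite dualBE.
    apply: cvgB; first exact: cvg_cst.
    have [phi phiE] : exists Phi : topdual (topdual Z), forall phi : topdual Z, Phi phi = phi k.
      apply: (@bounded_functional _ _ _ `|k|) => // phi.
      by rewrite mulrC; exact: dual_le.
    have wc : weak_cvgn (fun n => A t0 (y t0 + n.+1%:R^-1 *: k)) (A t0 (y t0)).
      exact: (A_demi t0T vcvg).
    have := wc phi; rewrite phiE; under eq_fun do rewrite phiE.
    by [].
  rewrite -(mul0r (`|h| ^+ 2)); apply: cvgM; last exact: cvg_cst.
  rewrite -(mulr0 (2 * c)); apply: cvgM => //; exact: cvg_cst.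
apply/cvgrPdist_le => eps e0.
pose del := mm * (eps / 2) ^+ 2 / 2.
have del0 : 0 < del by rewrite divr_gt0// mulr_gt0// exprn_gt0// divr_gt0.
have [s [s0 s1 ws sk]] : exists s : R, [/\ 0 < s, s <= 1, `|w s| <= del & s * `|k| <= eps / 2].
  have H1 : \forall n \near \oo, `|w n.+1%:R^-1| <= del.
    have /cvgrPdist_le/(_ _ del0) := w0.
    by apply: filterS => n; rewrite sub0r normrN.
  have H2 : \forall n \near \oo, n.+1%:R^-1 * `|k| <= eps / 2.
    have : (n.+1%:R^-1 * `|k| : R) @[n --> \oo] --> 0.
      rewrite -(mul0r `|k|); apply: cvgM; [exact: cvg_harmonic|exact: cvg_cst].
    move=> /cvgrPdist_le/(_ (eps / 2)); rewrite divr_gt0// => /(_ isT).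
    by apply: filterS => n; rewrite sub0r normrN; exact: le_trans (ler_norm _).
  have [n [h1 h2]] := filter_ex (filterI H1 H2).
  by exists n.+1%:R^-1; split => //; rewrite ?invr_gt0// invf_le1// ler1n.
apply: filterS (step s del s0 s1 del0) => t ht.
have : `|y t - (y t0 + s *: k)| <= eps / 2.
  have e20 : 0 <= eps / 2 by rewrite divr_ge0// ltW.
  have h2 : `|y t - (y t0 + s *: k)| ^+ 2 <= (eps / 2) ^+ 2.
    rewrite -(ler_pM2l mm_gt0).
    by apply: le_trans ht _; move: ws; rewrite /del; lra.
  by rewrite -ler_sqr ?nnegrE.
move=> h1; rewrite distrC.
have -> : y t - y t0 = (y t - (y t0 + s *: k)) + s *: k by rewrite opprD addrA subrK.
apply: le_trans (ler_normD _ _) _.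
rewrite normrZ (gtr0_norm s0); lra.
Qed.

End at_point.

Lemma solution_continuous : {within `[0, T], continuous y}.
Proof.
apply/subspace_continuousP => t0 /=; rewrite in_itv/= => t0T.
have t0I : `[0, T]%classic t0 by rewrite /= in_itv.
apply: cvg_ultra => U UU FU; apply: ultra_continuity => //.
- by apply: FU; rewrite /within/=; near=> t; rewrite in_itv.
- move=> v; have /subspace_continuousP/(_ t0 t0I) H := @A_cont v.
  by move=> P /H /FU.
- move=> v; have /subspace_continuousP/(_ t0 t0I) H := @J_cont v.
  by move=> P /H /FU.
Unshelve. all: by end_near. Qed.

End continuous_dependence.

(** * The weakly singular kernel *)

Section abel_kernel.
Context {R : realType}.
Notation mu := (@lebesgue_measure R).
Variable kappa : R.
Hypothesis kappa_gt0 : 0 < kappa.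

Definition abel (t s : R) : R := (t - s) `^ (kappa - 1).

Lemma abel_ge0 t s : 0 <= abel t s.
Proof. exact: powR_ge0. Qed.

Lemma measurable_abel t (D : set R) : measurable_fun D (abel t).
Proof.
apply: measurable_funTS; rewrite /abel.
apply: (measurableT_comp (measurable_powR (kappa - 1))).
exact: measurable_funB.
Qed.

Lemma is_derive_abel_primitive (t s : R) : s < t ->
  is_derive s 1 (fun s => - kappa^-1 * (t - s) `^ kappa) (abel t s).
Proof.
move=> st; have ts : 0 < t - s by rewrite subr_gt0.
have d1 : is_derive s 1 (fun s : R => t - s) (- 1).
  rewrite -[X in is_derive _ _ _ X]add0r.
  exact: is_deriveB.
have d2 : is_derive s 1 (fun s => (t - s) `^ kappa) (kappa * abel t s * -1).
  apply: (@is_derive1_comp _ (fun x => x `^ kappa) (fun s : R => t - s)).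
  exact: is_derive1_powR.
have d3 := is_deriveZ (- kappa^-1) d2.
apply: (is_derive_eq d3).
rewrite /GRing.scale/= mulrN1 mulrNN mulrA mulVf ?mul1r//.
by rewrite gt_eqF.
Qed.

Lemma continuous_abel (t s : R) : s < t -> {for s, continuous (abel t)}.
Proof.
move=> st; apply: differentiable_continuous; apply/derivable1_diffP.
have ts : 0 < t - s by rewrite subr_gt0.
have d1 : is_derive s 1 (fun s : R => t - s) (- 1).
  rewrite -[X in is_derive _ _ _ X]add0r.
  exact: is_deriveB.
have d2 : is_derive s 1 (abel t) ((kappa - 1) * (t - s) `^ (kappa - 1 - 1) * -1).
  apply: (@is_derive1_comp _ (fun x => x `^ (kappa - 1)) (fun s : R => t - s)).
  exact: is_derive1_powR.
by apply: ex_derive.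
Qed.

Lemma integral_abel_lt (t a b : R) : a <= b -> b < t ->
  (\int[mu]_(s in `[a, b]) (abel t s)%:E =
   (((t - a) `^ kappa - (t - b) `^ kappa) / kappa)%:E)%E.
Proof.
rewrite le_eqVlt => /predU1P[<- _|ab bt].
  by rewrite set_itv1 integral_set1 subrr mul0r.
have lt s : s <= b -> s < t by move=> /le_lt_trans; apply.
rewrite (@continuous_FTC2 _ _ (fun s => - kappa^-1 * (t - s) `^ kappa))//.
- by rewrite -EFinB; congr (_%:E); field; rewrite gt_eqF.
- apply: continuous_in_subspaceT => s /set_mem/=; rewrite in_itv/= => /andP[_ sb].
  exact: continuous_abel (lt _ sb).
- have c s : s <= b -> {for s, continuous (fun s => - kappa^-1 * (t - s) `^ kappa)}.
    move=> sb; apply: differentiable_continuous; apply/derivable1_diffP.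
    by have ? := is_derive_abel_primitive (lt _ sb); exact: ex_derive.
  split.
  + move=> s; rewrite in_itv/= => /andP[_ sb].
    by have ? := is_derive_abel_primitive (lt _ (ltW sb)); exact: ex_derive.
  + by apply: cvg_at_right_filter; apply: c; exact: ltW.
  + by apply: cvg_at_left_filter; apply: c.
- move=> s; rewrite in_itv/= => /andP[_ sb].
  have h := is_derive_abel_primitive (lt _ (ltW sb)).
  by rewrite derive1E derive_val.
Qed.

(** The singular end is reached by exhausting [[a, t[[] from within. *)
Lemma integral_abel_le (t a : R) : a <= t ->
  (\int[mu]_(s in `[a, t[) (abel t s)%:E <= ((t - a) `^ kappa / kappa)%:E)%E.
Proof.
move=> at_.
pose F (n : nat) : set R := `[a, t - n.+1%:R^-1]%classic.
have -> : `[a, t[%classic = \bigcup_n F n.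
  apply/seteqP; split => s /=.
    rewrite in_itv/= => /andP[as_ st].
    have ts : 0 < t - s by rewrite subr_gt0.
    have [n nts] := ltr_add_invr ts.
    exists n => //=; rewrite /F/= in_itv/= as_/= lerBrDr -lerBrDl ltW//.
    by move: nts; rewrite add0r.
  move=> [n _]; rewrite /F/= !in_itv/= => /andP[-> /le_lt_trans]; apply.
  by rewrite ltrBlDr ltrDl invr_gt0.
have nF : nondecreasing_seq F.
  move=> m n mn; apply/subsetPset => s; rewrite /F/= !in_itv/= => /andP[-> /=].
  by move=> /le_trans; apply; rewrite lerD2l lerN2 lef_pV2 ?posrE// ler_nat.
have mF i : measurable (F i) by exact: measurable_itv.
have mf i : measurable_fun (F i) (EFin \o abel t).
  by apply/measurable_EFinP; exact: measurable_abel.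
have f0 i s : F i s -> (0 <= (abel t s)%:E)%E by rewrite lee_fin abel_ge0.
have H := @ge0_nondecreasing_set_cvg_integral _ (measurableTypeR R) R F (EFin \o abel t) (@lebesgue_measure R) nF mF mf f0.
have Hc : cvg ((\int[mu]_(s in F n) (EFin \o abel t) s)%E @[n --> \oo]).
  by apply/cvg_ex; eexists; exact: H.
have -> : (\int[mu]_(s in \bigcup_n F n) (abel t s)%:E =
    limn (fun n => \int[mu]_(s in F n) (EFin \o abel t) s))%E.
  by apply/esym/cvg_lim.
apply: lime_le => //.
near=> n; rewrite /F; have [an|na] := leP a (t - n.+1%:R^-1).
  rewrite integral_abel_lt//; last by rewrite ltrBlDr ltrDl invr_gt0.
  by rewrite lee_fin ler_pM2r ?invr_gt0// lerBlDr lerDl powR_ge0.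
rewrite set_itv_ge ?bnd_simp -?ltNge// integral_set0 lee_fin.
by rewrite divr_ge0 ?powR_ge0// ltW.
Unshelve. all: by end_near. Qed.

Lemma integrable_abel t a : mu.-integrable `[a, t[ (EFin \o abel t).
Proof.
apply/integrableP; split; first by apply/measurable_EFinP; exact: measurable_abel.
under eq_integral do rewrite /= ger0_norm ?abel_ge0//.
have [at_|ta] := leP a t.
  by apply: le_lt_trans (integral_abel_le at_) _; rewrite ltry.
by rewrite set_itv_ge ?bnd_simp -?leNgt ?ltW// integral_set0.
Qed.

End abel_kernel.

Section abel_bielecki.
Context {R : realType}.
Notation mu := (@lebesgue_measure R).

Lemma powR_expR_le (a x : R) : 0 < a -> a <= 1 -> 0 < x -> x `^ a <= expR x.
Proof.
move=> a0 a1 x0; apply: (@le_trans _ _ (1 + x)); last exact: expR_ge1Dx.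
have [x1|x1] := leP x 1.
  apply: (@le_trans _ _ 1); last by rewrite lerDl ltW.
  have := @ge0_ler_powR R a (ltW a0) x 1; rewrite powR1; apply => //.
    by rewrite nnegrE ltW.
  by rewrite nnegrE.
apply: (@le_trans _ _ x); last by rewrite lerDr.
by apply: ler1_powR => //; exact: ltW.
Qed.

(** This is what makes a Bielecki weight [exp (lam t)] absorb the weakly singular
    kernel: a large [lam] concentrates the integral near [t], where the kernel
    has little mass. *)
Lemma integral_abel_expR_small (kappa T eps : R) : 0 < kappa -> kappa <= 1 ->
  0 < eps -> exists2 lam : R, 0 <= lam & forall t : R, 0 <= t <= T ->
  (\int[mu]_(s in `[0%R, t[) (abel kappa t s * expR (lam * s))%R%:E <=
     (eps * expR (lam * t))%R%:E)%E.
Proof.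
move=> k0 k1 eps0.
(* half of the exponent is traded for the factor [lam ^ (- al)] by means of
   [powR_expR_le]; the remaining kernel of exponent [al - 1] is integrable *)
pose al := kappa / 2; have al0 : 0 < al by rewrite divr_gt0.
have al1 : al <= 1 by rewrite /al; lra.
pose B := (`|T| + 1) `^ al / al.
have T1 : 0 < `|T| + 1 by rewrite ltr_wpDl.
have B0 : 0 < B by rewrite divr_gt0// powR_gt0.
pose lam := (B / eps) `^ al^-1.
have lam0 : 0 < lam by rewrite powR_gt0// divr_gt0.
have lamal : lam `^ al = B / eps.
  by rewrite -powRrM mulVf ?gt_eqF// powRr1// ltW// divr_gt0.
have eB0 : 0 <= eps / B by rewrite ltW// divr_gt0.
exists lam; first exact: ltW.
move=> t /andP[t0 tT].
apply: (@le_trans _ _ (\int[mu]_(s in `[0%R, t[)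
    ((eps / B * expR (lam * t))%R%:E * (abel al t s)%:E))%E).
  apply: ge0_le_integral => //.
  - by move=> s _; rewrite lee_fin mulr_ge0 ?abel_ge0// expR_ge0.
  - apply/measurable_EFinP/measurable_funM; first exact: measurable_abel.
    apply: measurable_funTS; apply: (measurableT_comp (@measurable_expR R)).
    exact: measurable_funM.
  - apply/measurable_EFinP/measurable_funM; first exact: measurable_cst.
    exact: measurable_abel.
  - move=> s /=; rewrite in_itv/= => /andP[s0 st].
    have ts : 0 < t - s by rewrite subr_gt0.
    rewrite -EFinM lee_fin.
    have -> : expR (lam * s) = expR (lam * t) / expR (lam * (t - s)).
      by rewrite -expRN -expRD; congr expR; ring.
    have lts : 0 < lam * (t - s) by rewrite mulr_gt0.
    have : (lam * (t - s)) `^ al <= expR (lam * (t - s)).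
      exact: powR_expR_le.
    rewrite (powRM _ (ltW lam0) (ltW ts)) lamal => h.
    have -> : abel kappa t s = abel al t s * (t - s) `^ al.
      rewrite /abel -powRD; last by rewrite (gt_eqF ts) implybT.
      by congr (_ `^ _); rewrite /al; field.
    rewrite [leRHS]mulrC -mulrA ler_wpM2l ?abel_ge0//.
    rewrite mulrCA [leRHS]mulrC ler_wpM2l ?expR_ge0//.
    rewrite ler_pdivrMr ?expR_gt0// -(invf_div B eps) ler_pdivlMl ?divr_gt0//.
rewrite ge0_integralZl//.
- apply: (@le_trans _ _ ((eps / B * expR (lam * t))%R%:E * (t `^ al / al)%R%:E)%E).
    apply: lee_wpmul2l.
      by rewrite lee_fin mulr_ge0// expR_ge0.
    by have := integral_abel_le al0 t0; rewrite subr0.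
  have tB : t `^ al / al <= B.
    rewrite ler_pM2r ?invr_gt0//; apply: ge0_ler_powR; rewrite ?nnegrE ?(ltW al0) ?(ltW T1)//.
    by apply: le_trans tT _; apply: le_trans (ler_norm T) _; rewrite lerDl.
  rewrite -EFinM lee_fin mulrAC ler_wpM2r ?expR_ge0//.
  by apply: le_trans (ler_wpM2l eB0 tB) _; rewrite divfK// gt_eqF.
- by apply/measurable_EFinP; exact: measurable_abel.
- by move=> s _; rewrite lee_fin abel_ge0.
- by rewrite lee_fin mulr_ge0// expR_ge0.
Qed.

End abel_bielecki.

(** * Weak integrals and Bochner integrals *)

Section weak_integral.
Context {R : realType} {d : measure_display} {T : measurableType d}.
Context {X : normedModType R}.
Variables (mu : {measure set T -> \bar R}) (D : set T).
Hypothesis mD : measurable D.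
Hypothesis muD : (mu D < +oo)%E.
Implicit Types (f s : T -> X) (phi : topdual X).

Lemma integrable_level_set s x : simple_on mu D s ->
  mu.-integrable D (fun t => (\1_(D `&` s @^-1` [set x]) t)%:E).
Proof.
move=> [_ /(_ x)[mE _]]; apply/integrableP; split.
  by apply/measurable_EFinP; exact: measurable_indic.
under eq_integral do rewrite gee0_abs ?lee_fin//.
rewrite integral_indic//; apply: le_lt_trans muD; apply: le_measure; rewrite ?inE//.
  exact: measurableI.
Qed.

(** The shape of the sum matches [simple_integral], whose terms are indexed by
    the values of [s]. *)
Lemma simple_on_level_sum (K : X -> R) s t : simple_on mu D s -> D t ->
  K (s t) = \sum_(x <- finmap.enum_fset (fset_set (range s)))
    K x * \1_(D `&` s @^-1` [set x]) t.
Proof.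
move=> [fs _] Dt.
have st : s t \in finmap.enum_fset (fset_set (range s)).
  by have /(_ (s t)) -> := in_fset_set fs; rewrite inE; exists t.
rewrite (big_rem _ st)/= big_seq big1 => [|x xs].
  by rewrite addr0 indicE mem_set ?mulr1.
rewrite indicE memNset ?mulr0// => -[_ /= e].
by move: xs; rewrite -e mem_rem_uniq ?finmap.fset_uniq// inE eqxx.
Qed.

Lemma simple_integral_dual s phi : simple_on mu D s ->
  mu.-integrable D (fun t => (phi (s t))%:E) /\
  phi (simple_integral mu D s) = \int[mu]_(t in D) phi (s t).
Proof.
move=> ss; set A := finmap.enum_fset (fset_set (range s)).
pose h x t : \bar R := ((phi x)%:E * (\1_(D `&` s @^-1` [set x]) t)%:E)%E.
have ih x : mu.-integrable D (h x).
  by apply: integrableZl => //; exact: integrable_level_set.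
have E t : t \in D -> (phi (s t))%:E = (\sum_(x <- A) h x t)%E.
  move=> /set_mem Dt; rewrite (simple_on_level_sum phi ss Dt) -sumEFin.
  by apply: eq_bigr => x _; rewrite EFinM.
have iS : mu.-integrable D (fun t => \sum_(x <- A) h x t)%E.
  by apply: integrable_sum.
split; first by apply: eq_integrable iS => // t /E ->.
have hE x : (\int[mu]_(t in D) h x t)%E =
    (fine (mu (D `&` s @^-1` [set x])) * phi x)%:E.
  have [mE _] := ss.2 x.
  rewrite integralZl//; last exact: integrable_level_set.
  rewrite integral_indic// setIAC setIid.
  have fE : mu (D `&` s @^-1` [set x]) \is a fin_num.
    by rewrite ge0_fin_numE//; apply: le_lt_trans muD; apply: le_measure; rewrite ?inE//.
  by rewrite EFinM fineK// muleC.
rewrite /Rintegral (eq_integral _ _ E) integral_sum//.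
rewrite (eq_bigr _ (fun x _ => hE x)) sumEFin/=.
rewrite /simple_integral fsbig_finite/=; last by case: ss.
by rewrite dual_sum; apply: eq_bigr => x _; rewrite dualZ.
Qed.

(** Distances to points are the only real functions of [f] that the
    approximation by simple functions needs to be measurable. *)
Definition norm_measurable f := forall c, measurable_fun D (fun t => `|f t - c|).

Lemma measurable_dist_simple f s : norm_measurable f -> simple_on mu D s ->
  measurable_fun D (fun t => `|f t - s t|).
Proof.
move=> mf ss; set A := finmap.enum_fset (fset_set (range s)).
pose h x t : R := `|f t - x| * \1_(D `&` s @^-1` [set x]) t.
apply: (@eq_measurable_fun _ _ _ _ _ (fun t => \sum_(x <- A) h x t)).
  by move=> t /set_mem Dt; rewrite (simple_on_level_sum (fun x => `|f t - x|) ss Dt).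
apply: measurable_sum => x; apply: measurable_funM; first exact: mf.
by apply: measurable_indic; case: ss => _ /(_ x)[].
Qed.

(** The Pettis integral. *)
Definition is_weak_integral f v :=
  forall phi, phi v = \int[mu]_(t in D) phi (f t).

Lemma norm_integrable_dual f (u : T -> R) phi :
  measurable_fun D (fun t => phi (f t)) ->
  (forall t, D t -> `|f t| <= u t) -> mu.-integrable D (EFin \o u) ->
  mu.-integrable D (fun t => (phi (f t))%:E).
Proof.
move=> mf fu iu.
apply: (@le_integrable _ _ _ mu D mD _ (fun t => (`|phi|%:E * (u t)%:E)%E)).
- exact/measurable_EFinP.
- move=> t Dt; rewrite /= lee_fin; apply: le_trans (dual_norm_le _ _) _.
  apply: le_trans _ (ler_norm _); rewrite ler_wpM2l//; exact: fu.
- exact: integrableZl.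
Qed.

Lemma weak_integral_norm f (u : T -> R) v :
  is_weak_integral f v -> (forall phi, measurable_fun D (fun t => phi (f t))) ->
  (forall t, D t -> `|f t| <= u t) -> mu.-integrable D (EFin \o u) ->
  `|v| <= \int[mu]_(t in D) u t.
Proof.
move=> fv mf fu iu; apply: norm_le_dual => phi phi1; rewrite fv.
apply: le_Rintegral => //; first exact: norm_integrable_dual (mf phi) fu iu.
move=> t Dt; apply: le_trans (ler_norm _) _.
by apply: le_trans (phi1 _) _; exact: fu.
Qed.

(** [phi |-> int (phi o f)] is bounded by the integral of [u], hence is
    evaluation at a point of the reflexive space. *)
Lemma weak_integral_exists f (u : T -> R) : reflexive_space X ->
  (forall phi, measurable_fun D (fun t => phi (f t))) ->
  (forall t, D t -> `|f t| <= u t) -> mu.-integrable D (EFin \o u) ->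
  exists v, is_weak_integral f v.
Proof.
move=> refl mf fu iu.
have ip phi : mu.-integrable D (fun t => (phi (f t))%:E).
  exact: norm_integrable_dual (mf phi) fu iu.
pose l phi : R := \int[mu]_(t in D) phi (f t).
have [||Phi PhiE] := @bounded_functional R (topdual X) l (\int[mu]_(t in D) u t).
- move=> a phi psi; pose p t : R := phi (f t); pose q t : R := psi (f t).
  have ip' : mu.-integrable D (EFin \o p) by exact: ip.
  have iq' : mu.-integrable D (EFin \o q) by exact: ip.
  have iap : mu.-integrable D (EFin \o (fun t => a * p t)).
    exact: (integrableZl mD a ip').
  change (\int[mu]_(t in D) (a * p t + q t) =
    a * \int[mu]_(t in D) p t + \int[mu]_(t in D) q t).
  by rewrite RintegralD// RintegralZl.
- move=> phi; rewrite /l mulrC -RintegralZl//; apply: le_Rintegral => //.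
  - exact: ip.
  - exact: (integrableZl mD _ iu).
  move=> t Dt; apply: le_trans (dual_le _ _) _.
  by rewrite ler_wpM2l//; exact: fu.
have [v vE] := refl Phi.
by exists v => phi; rewrite -vE PhiE.
Qed.

(** Passing to the limit in [simple_integral_dual]; measurability of [f] is
    assumed since almost everywhere limits of Borel functions need not be Borel. *)
Lemma is_bochner_integral_weak f v :
  (forall phi, measurable_fun D (fun t => phi (f t))) -> norm_measurable f ->
  is_bochner_integral mu D f v ->
  is_weak_integral f v /\ forall phi, mu.-integrable D (fun t => (phi (f t))%:E).
Proof.
move=> mf nf [_ [s [ss sf sv]]].
have md n : measurable_fun D (fun t => `|f t - s n t|).
  exact: measurable_dist_simple (ss n).
pose e n : \bar R := (\int[mu]_(t in D) `|f t - s n t|%R%:E)%E.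
have e0 n : (0 <= e n)%E by apply: integral_ge0 => t _; rewrite lee_fin.
have e_small (eps : R) : 0 < eps -> \forall n \near \oo, (e n < eps%:E)%E.
  move=> eps0; apply: (sf [set y | (y < eps%:E)%E]).
  by apply: open_ereal_lt'; rewrite lte_fin.
have idist n : (e n < +oo)%E -> mu.-integrable D (fun t => (`|f t - s n t|)%:E).
  move=> en; apply/integrableP; split; first exact/measurable_EFinP.
  by under eq_integral do rewrite gee0_abs ?lee_fin//.
have iphi phi : mu.-integrable D (fun t => (phi (f t))%:E).
  have [n en] := filter_ex (e_small 1 ltr01).
  have {}en := lt_trans en (ltry 1).
  have isn := (simple_integral_dual phi (ss n)).1.
  have : mu.-integrable D (fun t => (phi (f t - s n t))%:E).
    apply: (norm_integrable_dual _ _ (idist n en)) => //.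
    under eq_fun do rewrite dualB.
    apply: measurable_funB => //; apply/measurable_EFinP.
    by case/integrableP: isn.
  move=> h; have := integrableD mD h isn.
  apply: eq_integrable => // t _.
  by rewrite /= dualB -EFinD subrK.
split => // phi.
apply: (@cvg_unique _ _ ((fun n => phi (simple_integral mu D (s n))) @ \oo)) => //.
  by apply: continuous_cvg => //; exact: (@blin_continuous _ _ _ phi).
apply/cvgrPdist_le => eps eps0.
have eps1 : 0 < eps / (`|phi| + 1) by rewrite divr_gt0// ltr_wpDl.
near=> n.
have en : (e n < (eps / (`|phi| + 1))%:E)%E by near: n; exact: e_small.
have en' : (e n < +oo)%E := lt_trans en (ltry _).
have [isn ->] := simple_integral_dual phi (ss n).
rewrite -(RintegralB mD (iphi phi) isn).
have ib : mu.-integrable D (fun t => (phi (f t) - phi (s n t))%:E).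
  by under eq_fun do rewrite EFinB; exact: integrableB.
apply: le_trans (le_normr_Rintegral mD ib) _.
apply: (@le_trans _ _ (\int[mu]_(t in D) (`|phi| * `|f t - s n t|))).
  apply: le_Rintegral => //.
  - by move/integrable_norm: ib.
  - exact: (integrableZl mD _ (idist n en')).
  - by move=> t _; rewrite -dualB; exact: dual_norm_le.
rewrite RintegralZl//; last exact: idist.
have : fine (e n) <= eps / (`|phi| + 1).
  by rewrite -lee_fin fineK ?ltW// ge0_fin_numE.
rewrite -/(Rintegral mu D (fun t => `|f t - s n t|)) => h.
apply: le_trans (ler_wpM2l (normr_ge0 _) h) _.
by rewrite mulrA ler_pdivrMr ?ltr_wpDl// mulrC ler_wpM2l ?lerDl// ltW.
Unshelve. all: by end_near. Qed.

End weak_integral.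

(** * Bochner integrability in separable spaces *)

Lemma dense_sequence {R : realType} {X : normedModType R} :
  separable_space X ->
  exists e : nat -> X, forall x (eps : R), 0 < eps -> exists n, `|x - e n| < eps.
Proof.
move=> [E [cE dE]].
have close x (eps : R) : 0 < eps -> exists2 y, E y & `|x - y| < eps.
  move=> eps0; have [||y [/interior_subset xy Ey]] := dE (ball x eps)°.
  - by exists x; apply: nbhs_singleton; apply: nbhs_interior; exact: nbhsx_ballx.
  - exact: open_interior.
  - by exists y => //; move: xy; rewrite -ball_normE.
have /pfcard_geP[E0|[e]] := cE.
  by have [y] := close 0 1 ltr01; rewrite E0.
exists e => x eps eps0; have [y Ey xy] := close x eps eps0.
by have [n _ en] := @surj _ _ _ _ e y Ey; exists n; rewrite en.
Qed.

Section bochner_exists.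
Context {R : realType} {d : measure_display} {T : measurableType d}.
Context {X : normedModType R}.
Variables (mu : {measure set T -> \bar R}) (D : set T).
Hypothesis mD : measurable D.
Hypothesis muD : (mu D < +oo)%E.
Variable f : T -> X.
Hypothesis nf : norm_measurable D f.
Variable e : nat -> X.

(** The point closest to [f t] among [0, e 0, ..., e (n - 1)], defined
    recursively so that its level sets are visibly measurable.  Starting from 0
    keeps the error below [|f t|], which dominates the convergence. *)
Fixpoint nearest (n : nat) (t : T) : X := if n is k.+1 then
  (if `|f t - e k| < `|f t - nearest k t| then e k else nearest k t) else 0.

Lemma nearest_step k t :
  `|f t - nearest k.+1 t| = Num.min `|f t - e k| `|f t - nearest k t|.
Proof. by rewrite /= /Order.min; case: ifP. Qed.

Lemma nearest_le_norm n t : `|f t - nearest n t| <= `|f t|.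
Proof.
elim: n => [|n IH]; first by rewrite /= subr0.
by rewrite nearest_step ge_min IH orbT.
Qed.

Lemma nearest_le n k t : (k < n)%N -> `|f t - nearest n t| <= `|f t - e k|.
Proof.
elim: n => // n IH; rewrite ltnS leq_eqVlt => /predU1P[->|/IH h];
by rewrite nearest_step ge_min ?lexx// h orbT.
Qed.

Lemma simple_nearest n : simple_on mu D (nearest n).
Proof.
have fin (E : set T) : measurable (D `&` E) -> (mu (D `&` E) < +oo)%E.
  move=> mE; apply: le_lt_trans muD; apply: le_measure; rewrite ?inE//.
elim: n => [|n IH]; split.
- by apply: (@sub_finite_set _ _ [set 0]); [move=> _ [t _ <-]|exact: finite_set1].
- move=> x; have mx : measurable (D `&` nearest 0 @^-1` [set x]).
    have [->|x0] := eqVneq x 0.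
      have -> : nearest 0 @^-1` [set 0 : X] = setT by apply/seteqP; split.
      by rewrite setIT.
    have -> : nearest 0 @^-1` [set x] = set0.
      by apply/seteqP; split => // t /= e0; rewrite -e0 eqxx in x0.
    by rewrite setI0.
  by split => // _; exact: fin.
- apply: (@sub_finite_set _ _ ([set e n] `|` range (nearest n))).
    by move=> _ [t _ <-] /=; case: ifP => _; [left|right; exists t].
  by rewrite finite_setU; split; [exact: finite_set1|exact: IH.1].
- move=> x; have mx : measurable (D `&` nearest n.+1 @^-1` [set x]).
    pose C := D `&` [set t | `|f t - e n| < `|f t - nearest n t|].
    have mC : measurable C.
      have mg : measurable_fun D (fun t => `|f t - nearest n t| - `|f t - e n|).
        by apply: measurable_funB; [exact: (measurable_dist_simple (mu := mu))|exact: nf].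
      have := mg mD `]0, +oo[%classic (measurable_itv _).
      congr (measurable _); apply/seteqP; split => t /= [Dt h]; split => //;
      by move: h; rewrite /= in_itv/= andbT subr_gt0.
    have -> : D `&` nearest n.+1 @^-1` [set x] =
        (C `&` [set t | e n = x]) `|` ((D `&` nearest n @^-1` [set x]) `\` C).
      apply/seteqP; split => t /=.
        move=> [Dt]; case: ifPn => [lt <-|nlt <-]; first by left.
        by right; split => // -[_ /= lt]; rewrite lt in nlt.
      move=> [[[Dt /= ->] ->]//|[[Dt h] nC]]; split => //.
      by case: ifPn => // lt; exfalso; apply: nC.
    apply: measurableU; last by apply: measurableD => //; exact: (IH.2 x).1.
    have [ex|ex] := pselect (e n = x).
      have -> : [set t : T | e n = x] = setT by apply/seteqP; split.
      by rewrite setIT.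
    have -> : [set t : T | e n = x] = set0 by apply/seteqP; split.
    by rewrite setI0.
  by split => // _; exact: fin.
Qed.

Hypothesis dense_e : forall x (eps : R), 0 < eps -> exists n, `|x - e n| < eps.

Lemma nearest_cvg t : `|f t - nearest n t| @[n --> \oo] --> 0.
Proof.
apply/cvgrPdist_le => eps eps0; have [k fk] := dense_e (f t) eps0.
near=> n; rewrite sub0r normrN normr_id.
by apply: le_trans (ltW fk); apply: nearest_le; near: n; exact: nbhs_infty_gt.
Unshelve. all: by end_near. Qed.

(** Pettis' theorem for a function whose weak integral is already known. *)
Lemma weak_integral_bochner v :
  (forall phi : topdual X, measurable_fun D (fun t => phi (f t))) ->
  mu.-integrable D (fun t => (`|f t|)%:E) ->
  is_weak_integral mu D f v -> is_bochner_integral mu D f v.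
Proof.
move=> mf intf fv.
have mdist n : measurable_fun D (fun t => `|f t - nearest n t|).
  exact: (measurable_dist_simple nf (simple_nearest n)).
have idist n : mu.-integrable D (fun t => (`|f t - nearest n t|)%:E).
  apply: (le_integrable mD _ _ intf); first exact/measurable_EFinP.
  by move=> t _ /=; rewrite lee_fin !normr_id nearest_le_norm.
have cvg0 : (\int[mu]_(t in D) `|f t - nearest n t|%:E)%E @[n --> \oo] --> 0%E.
  have [|||||_ _ H] := @dominated_convergence _ T R mu D mD
    (fun n t => (`|f t - nearest n t|)%:E) (cst 0%E) (fun t => (`|f t|)%:E).
  - by move=> n; exact/measurable_EFinP.
  - exact: measurable_cst.
  - apply: aeW => t _; apply: cvg_EFin; first exact: nearW.
    exact: nearest_cvg.
  - exact: intf.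
  - by apply: aeW => t n _; rewrite /= lee_fin normr_id nearest_le_norm.
  - by move: H; rewrite integral0.
split.
  exists nearest; split; first exact: simple_nearest.
  apply: aeW => t _; apply/cvgrPdist_le => eps eps0.
  have /cvgrPdist_le/(_ _ eps0) := nearest_cvg t.
  by apply: filterS => n; rewrite sub0r normrN normr_id.
exists nearest; split => //; first exact: simple_nearest.
apply/cvgrPdist_le => eps eps0.
have : \forall n \near \oo, (\int[mu]_(t in D) `|f t - nearest n t|%:E < eps%:E)%E.
  apply: (cvg0 [set y | (y < eps%:E)%E]).
  by apply: open_ereal_lt'; rewrite lte_fin.
apply: filterS => n en; apply: (@le_trans _ _ (\int[mu]_(t in D) `|f t - nearest n t|)).
  apply: norm_le_dual => phi phi1.
  have [isn sn] := simple_integral_dual mD muD phi (simple_nearest n).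
  rewrite dualB fv sn.
  have iphi : mu.-integrable D (fun t => (phi (f t))%:E).
    apply: (norm_integrable_dual mD (mf phi) (fun t _ => lexx _)); exact: intf.
  rewrite -(RintegralB mD iphi isn).
  apply: le_Rintegral => //.
  - exact: (integrableB mD iphi isn).
  - exact: idist.
  by move=> t _; rewrite -dualB; apply: le_trans (ler_norm _) (phi1 _).
rewrite -lee_fin fineK ?ltW// ge0_fin_numE ?(lt_trans en) ?ltry//.
by apply: integral_ge0 => t _; rewrite lee_fin.
Qed.

End bochner_exists.

(** * Riemann-Liouville integrals of piecewise continuous functions *)

Section piecewise_measurability.
Context {R : realType}.
Notation mu := (@lebesgue_measure R).

(** The points of discontinuity and the endpoints form a finite set, on which
    every function is measurable; the rest is open. *)
Lemma measurable_piecewise (S : set R) (t : R) (u : R -> R) : finite_set S ->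
  (forall s, 0 < s < t -> ~ S s -> {for s, continuous u}) ->
  measurable_fun (`[0, t]%classic : set (measurableTypeR R)) u.
Proof.
move=> finS cu.
pose O : set R := `]0, t[%classic `&` ~` S.
pose E : set R := `[0, t]%classic `&` (S `|` [set 0; t]).
have oO : open O.
  apply: openI; first exact: interval_open.
  rewrite openC; apply: accessible_finite_set_closed.1 => //.
  exact/hausdorff_accessible/Rhausdorff.
have finE : finite_set E.
  apply: (@sub_finite_set _ _ (S `|` [set 0; t])); first by move=> s [].
  by rewrite finite_setU; split => //; exact: finite_set2.
have mfin (A : set R) : finite_set A -> measurable (A : set (measurableTypeR R)).
  move=> fA; apply: countable_measurable; last exact: finite_set_countable.
  by move=> s; exact: measurable_set1.
have -> : `[0, t]%classic = O `|` E.
  apply/seteqP; split => s; last first.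
    move=> [[/=]|[]//]; rewrite !in_itv/= => /andP[s0 st] _.
    by rewrite (ltW s0) (ltW st).
  move=> Is; have := Is; rewrite /= in_itv/= => /andP[s0 st].
  have [Ss|nSs] := pselect (S s); first by right; split => //; left.
  have [es|s0'] := eqVneq s 0; first by right; split => //; right; left.
  have [es|st'] := eqVneq s t; first by right; split => //; right; right.
  by left; split => //=; rewrite in_itv/= !lt_def s0' s0 eq_sym st' st.
apply/measurable_funU; [exact: open_measurable|exact: mfin|split].
  apply: open_continuous_measurable_fun => // s /set_mem[/=]; rewrite in_itv/=.
  exact: cu.
by move=> mE B mB; apply: mfin; apply: sub_finite_set finE => s [].
Qed.

End piecewise_measurability.

Section riemann_liouville.
Context {R : realType} {X : normedModType R}.
Notation mu := (@lebesgue_measure R).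
Variables (kappa T : R) (S : set R).
Hypothesis kappa_gt0 : 0 < kappa.
Hypothesis kappa_le1 : kappa <= 1.
Hypothesis finS : finite_set S.
Implicit Types h : R -> X.

Definition piecewise_continuous h :=
  forall s, 0 < s < T -> ~ S s -> {for s, continuous h}.

Definition bounded_on_segment h C := forall s, 0 <= s <= T -> `|h s| <= C.

Definition abel_integrand t h (s : measurableTypeR R) : X := abel kappa t s *: h s.

Lemma abel_integrand_continuous t h s : piecewise_continuous h -> t <= T ->
  0 < s < t -> ~ S s -> {for s, continuous (abel_integrand t h)}.
Proof.
move=> ch tT /andP[s0 st] nSs.
apply: cvgZ; first exact: continuous_abel.
by apply: ch => //; rewrite s0 (lt_le_trans st).
Qed.

Lemma abel_integrand_dual_measurable t h (phi : topdual X) :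
  piecewise_continuous h -> t <= T ->
  measurable_fun `[0, t]%classic (fun s => phi (abel_integrand t h s)).
Proof.
move=> ch tT; apply: (measurable_piecewise finS) => s st nSs.
apply: continuous_comp; first exact: abel_integrand_continuous.
exact: (@blin_continuous _ _ _ phi).
Qed.

Lemma abel_integrand_norm_measurable t h : piecewise_continuous h -> t <= T ->
  norm_measurable `[0, t]%classic (abel_integrand t h).
Proof.
move=> ch tT c; apply: (measurable_piecewise finS) => s st nSs.
apply: cvg_norm; apply: cvgB; last exact: cvg_cst.
exact: abel_integrand_continuous.
Qed.

Lemma abel_integrand_dual_measurableo t h (phi : topdual X) :
  piecewise_continuous h -> t <= T ->
  measurable_fun `[0, t[%classic (fun s => phi (abel_integrand t h s)).
Proof.
move=> ch tT; apply/measurable_fun_itv_bndo_bndcP.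
exact: abel_integrand_dual_measurable.
Qed.

Lemma integrable_abelZ (C t : R) :
  mu.-integrable `[0, t[ (EFin \o (fun s => C * abel kappa t s)).
Proof.
have := @integrableZl _ _ _ mu _ (measurable_itv `[0, t[) C _ (integrable_abel kappa_gt0 t 0).
by [].
Qed.

Lemma abel_integrand_le t h C s : bounded_on_segment h C -> t <= T ->
  0 <= s < t -> `|abel_integrand t h s| <= C * abel kappa t s.
Proof.
move=> hC tT /andP[s0 st].
rewrite normrZ ger0_norm ?abel_ge0// mulrC ler_wpM2r ?abel_ge0//.
by apply: hC; rewrite s0 (le_trans (ltW st)).
Qed.

(** The Riemann-Liouville integral of [h] up to the factor [1 / Gamma kappa].
    The endpoint [t] is left out because the singular kernel is only compared
    with kernels for other times on [[0, t[[]. *)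
Definition rl_integral t h v := is_weak_integral mu `[0, t[%classic (abel_integrand t h) v.

Lemma rl_integrable t h C (phi : topdual X) : piecewise_continuous h ->
  bounded_on_segment h C -> t <= T ->
  mu.-integrable `[0, t[%classic (fun s => (phi (abel_integrand t h s))%:E).
Proof.
move=> ch hC tT.
refine (@norm_integrable_dual R _ (measurableTypeR R) X mu `[0, t[%classic (measurable_itv _) (abel_integrand t h) (fun s => C * abel kappa t s) phi _ _ _).
- exact: abel_integrand_dual_measurableo.
- by move=> s; rewrite /= in_itv/= => s0t; exact: abel_integrand_le hC tT s0t.
- exact: integrable_abelZ.
Qed.

Lemma rl_integral_exists t h C : reflexive_space X -> piecewise_continuous h ->
  bounded_on_segment h C -> t <= T -> exists v, rl_integral t h v.
Proof.
move=> refl ch hC tT.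
refine (@weak_integral_exists R _ (measurableTypeR R) X mu `[0, t[%classic
  (measurable_itv _) (abel_integrand t h) (fun s => C * abel kappa t s) refl _ _ _).
- by move=> phi; exact: abel_integrand_dual_measurableo.
- by move=> s; rewrite /= in_itv/= => s0t; exact: abel_integrand_le hC tT s0t.
- exact: integrable_abelZ.
Qed.

Lemma segment_finite (t : R) : (mu `[0%R, t] < +oo)%E.
Proof.
by rewrite lebesgue_measure_itv/=; case: ifP => _; rewrite ?ltry.
Qed.

Lemma rl_integral_bochner t h C v : separable_space X -> piecewise_continuous h ->
  bounded_on_segment h C -> 0 <= t <= T -> rl_integral t h v ->
  is_bochner_integral mu `[0, t]%classic (abel_integrand t h) v.
Proof.
move=> sep ch hC /andP[t0 tT] hv.
have [e de] := dense_sequence sep.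
refine (@weak_integral_bochner R _ (measurableTypeR R) X mu `[0, t]%classic
  (measurable_itv _) (segment_finite t) (abel_integrand t h)
  (abel_integrand_norm_measurable ch tT) e de v _ _ _).
- by move=> phi; exact: abel_integrand_dual_measurable.
- have m : measurable_fun `[0, t]%classic (fun s => `|abel_integrand t h s|).
    have := abel_integrand_norm_measurable ch tT 0.
    by apply: eq_measurable_fun => s _; rewrite subr0.
  apply/integrableP; split; first exact/measurable_EFinP.
  rewrite -integral_itv_bndo_bndc; last first.
    apply/measurable_EFinP/measurable_fun_itv_bndo_bndcP.
    by apply: measurableT_comp.
  have /integrableP[_] := integrable_abelZ C t.
  apply: le_lt_trans; apply: ge0_le_integral => //.
  - apply/measurable_EFinP/measurable_fun_itv_bndo_bndcP.
    by apply: measurableT_comp.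
  - apply/measurable_EFinP; apply: measurableT_comp => //.
    by apply: measurable_funM => //; exact: measurable_abel.
  - move=> s; rewrite /= in_itv/= => s0t; rewrite lee_fin normr_id.
    by apply: le_trans (abel_integrand_le hC tT s0t) (ler_norm _).
- move=> phi; rewrite hv; apply: Rintegral_itv_bndo_bndc.
  exact: rl_integrable ch hC tT.
Qed.

Lemma bochner_rl_integral t h v : piecewise_continuous h -> t <= T ->
  is_bochner_integral mu `[0, t]%classic (abel_integrand t h) v ->
  rl_integral t h v.
Proof.
move=> ch tT bv.
have [hv ih] := @is_bochner_integral_weak R _ (measurableTypeR R) X mu
  `[0, t]%classic (measurable_itv _) (segment_finite t) (abel_integrand t h) v
  (fun phi => abel_integrand_dual_measurable phi ch tT)
  (abel_integrand_norm_measurable ch tT) bv.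
move=> phi; rewrite hv; apply/esym/Rintegral_itv_bndo_bndc.
apply: integrableS (ih phi) => //; apply: subset_itvl; by rewrite bnd_simp.
Qed.

Lemma rl_integral_le_bielecki t h C h' C' v v' (B lam eps : R) :
  piecewise_continuous h -> bounded_on_segment h C -> rl_integral t h v ->
  piecewise_continuous h' -> bounded_on_segment h' C' -> rl_integral t h' v' ->
  t <= T -> 0 <= B ->
  (forall s, 0 <= s < t -> `|h s - h' s| <= B * expR (lam * s)) ->
  (\int[mu]_(s in `[0%R, t[) (abel kappa t s * expR (lam * s))%R%:E <=
     (eps * expR (lam * t))%R%:E)%E ->
  `|v - v'| <= B * (eps * expR (lam * t)).
Proof.
move=> ch hC hv ch' hC' hv' tT B0 hh' small.
pose w s := abel kappa t s * expR (lam * s).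
have w0 s : 0 <= w s by rewrite mulr_ge0 ?abel_ge0 ?expR_ge0.
have mw : measurable_fun `[0, t[%classic w.
  apply: measurable_funM; first exact: measurable_abel.
  apply: measurable_funTS; apply: (measurableT_comp (@measurable_expR R)).
  exact: measurable_funM.
have iw : mu.-integrable `[0, t[%classic (EFin \o w).
  apply/integrableP; split; first exact/measurable_EFinP.
  under eq_integral do rewrite /= ger0_norm//.
  by apply: le_lt_trans small _; rewrite ltry.
have iBw : mu.-integrable `[0, t[%classic (EFin \o (fun s => B * w s)).
  exact: (@integrableZl _ _ _ mu _ (measurable_itv `[0, t[) B _ iw).
apply: (@le_trans _ _ (\int[mu]_(s in `[0, t[) (B * w s))).
  refine (@weak_integral_norm R _ (measurableTypeR R) X mu `[0, t[%classic
    (measurable_itv _) (fun s => abel_integrand t h s - abel_integrand t h' s)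
    (fun s => B * w s) (v - v') _ _ _ _).
  - move=> phi; rewrite dualB hv hv' -RintegralB//.
    + by apply: eq_Rintegral => s _; exact/esym/dualB.
    + exact: rl_integrable ch hC tT.
    + exact: rl_integrable ch' hC' tT.
  - move=> phi.
    apply: (@eq_measurable_fun _ _ _ _ _ (fun s => phi (abel_integrand t h s) -
      phi (abel_integrand t h' s))) => [s _|]; first exact/esym/dualB.
    by apply: measurable_funB; exact: abel_integrand_dual_measurableo.
  - move=> s; rewrite /= in_itv/= => s0t.
    rewrite -scalerBr normrZ ger0_norm ?abel_ge0// /w mulrCA ler_wpM2l ?abel_ge0//.
    exact: hh'.
  - exact: iBw.
rewrite RintegralZl//; apply: ler_wpM2l => //.
rewrite -lee_fin fineK//; exact: integrable_fin_num.
Qed.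

(** On [[0, t[[] the kernel for [t'] is below the one for [t], so the total
    variation of the kernel is an explicit difference of primitives, and what
    remains are two copies of the integral over [[t, t'[[]. *)
Lemma rl_integral_holder t t' h C v v' :
  piecewise_continuous h -> bounded_on_segment h C -> 0 <= C ->
  0 <= t -> t < t' -> t' <= T ->
  rl_integral t h v -> rl_integral t' h v' ->
  `|v' - v| <= C * (2 * (t' - t) `^ kappa / kappa).
Proof.
move=> ch hC C0 t0 tt' t'T hv hv'.
have tT : t <= T := le_trans (ltW tt') t'T.
have sub1 : `[0, t[%classic `<=` (`[0, t'[%classic : set R).
  by apply: subset_itvl; rewrite bnd_simp ltW.
have sub2 : `[t, t'[%classic `<=` (`[0, t'[%classic : set R).
  by apply: subset_itvr; rewrite bnd_simp.
have iph' phi := rl_integrable phi ch hC t'T.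
have iph phi := rl_integrable phi ch hC tT.
have i1 (phi : topdual X) : mu.-integrable `[0, t[%classic (fun s => (phi (abel_integrand t' h s))%:E).
  exact: (@integrableS _ _ _ mu _ _ _ (measurable_itv _) (measurable_itv _) sub1 (iph' phi)).
have i2 (phi : topdual X) : mu.-integrable `[t, t'[%classic (fun s => (phi (abel_integrand t' h s))%:E).
  exact: (@integrableS _ _ _ mu _ _ _ (measurable_itv _) (measurable_itv _) sub2 (iph' phi)).
have ia' : mu.-integrable `[0, t'[%classic (EFin \o abel kappa t').
  exact: integrable_abel.
have ia1 : mu.-integrable `[0, t[%classic (EFin \o abel kappa t').
  exact: (@integrableS _ _ _ mu _ _ _ (measurable_itv _) (measurable_itv _) sub1 ia').
have ia2 : mu.-integrable `[t, t'[%classic (EFin \o abel kappa t').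
  exact: (@integrableS _ _ _ mu _ _ _ (measurable_itv _) (measurable_itv _) sub2 ia').
have ia : mu.-integrable `[0, t[%classic (EFin \o abel kappa t).
  exact: integrable_abel.
have abel_anti s : 0 <= s < t -> abel kappa t' s <= abel kappa t s.
  move=> /andP[s0 st]; rewrite /abel.
  have ts : 0 < t - s by rewrite subr_gt0.
  have ts' : 0 < t' - s by rewrite subr_gt0 (lt_trans st).
  have -> : kappa - 1 = - (1 - kappa) by ring.
  rewrite !powRN lef_pV2 ?posrE ?powR_gt0//.
  apply: ge0_ler_powR; rewrite ?nnegrE ?subr_ge0 ?(ltW st)//.
    by rewrite (le_trans (ltW st)) ?ltW.
  by rewrite lerD2r ltW.
have Ia2 : \int[mu]_(s in `[t, t'[) abel kappa t' s <= (t' - t) `^ kappa / kappa.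
  rewrite -lee_fin fineK; last exact: integrable_fin_num.
  exact: integral_abel_le (ltW tt').
have Ia : \int[mu]_(s in `[0, t[) abel kappa t s <= t `^ kappa / kappa.
  rewrite -lee_fin fineK; last exact: integrable_fin_num.
  by have := integral_abel_le kappa_gt0 t0; rewrite subr0.
have Ia1 : \int[mu]_(s in `[0, t[) abel kappa t' s =
    (t' `^ kappa - (t' - t) `^ kappa) / kappa.
  rewrite Rintegral_itv_bndo_bndc// /Rintegral.
  by rewrite integral_abel_lt// subr0.
apply: norm_le_dual => phi phi1; rewrite dualB hv hv'.
have split_int : \int[mu]_(s in `[0, t'[) phi (abel_integrand t' h s) =
    \int[mu]_(s in `[0, t[) phi (abel_integrand t' h s) +
    \int[mu]_(s in `[t, t'[) phi (abel_integrand t' h s).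
  have U : `[0, t'[%classic = (`[0, t[%classic `|` `[t, t'[%classic : set R).
    by rewrite -itv_bndbnd_setU// bnd_simp ltW.
  rewrite U Rintegral_setU//.
    by rewrite -U; exact: iph'.
  apply/disj_setPS => s [/=]; rewrite !in_itv/= => /andP[_ st] /andP[ts _].
  by have := lt_le_trans st ts; rewrite ltxx.
rewrite split_int addrAC -(@RintegralB _ _ _ mu _ _ _ (measurable_itv _) (i1 phi) (iph phi)).
have b1 : \int[mu]_(s in `[0, t[) (phi (abel_integrand t' h s) - phi (abel_integrand t h s))
    <= C * (\int[mu]_(s in `[0, t[) abel kappa t s - \int[mu]_(s in `[0, t[) abel kappa t' s).
  have iaa : mu.-integrable `[0, t[%classic
      (EFin \o (fun s => abel kappa t s - abel kappa t' s)).
    exact: (@integrableB _ _ _ mu _ (measurable_itv _) _ _ ia ia1).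
  rewrite -RintegralB// -RintegralZl//.
  apply: le_Rintegral => //.
  - exact: (@integrableB _ _ _ mu _ (measurable_itv _) _ _ (i1 phi) (iph phi)).
  - exact: (@integrableZl _ _ _ mu _ (measurable_itv _) C _ iaa).
  - move=> s; rewrite /= in_itv/= => s0t.
    rewrite -dualB -scalerBl dualZ.
    apply: le_trans (ler_norm _) _; rewrite normrM mulrC.
    apply: ler_pM => //.
      apply: le_trans (phi1 _) _; apply: hC.
      by case/andP: s0t => -> /ltW st; rewrite (le_trans st).
    by rewrite ler0_norm ?opprB// subr_le0 abel_anti.
have b2 : \int[mu]_(s in `[t, t'[) phi (abel_integrand t' h s) <=
    C * \int[mu]_(s in `[t, t'[) abel kappa t' s.
  rewrite -RintegralZl//; apply: le_Rintegral => //.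
  - exact: i2.
  - exact: (@integrableZl _ _ _ mu _ (measurable_itv _) C _ ia2).
  - move=> s; rewrite /= in_itv/= => /andP[ts st'].
    apply: le_trans (ler_norm _) _; apply: le_trans (phi1 _) _.
    by apply: abel_integrand_le => //; rewrite (le_trans t0 ts).
apply: le_trans (lerD b1 b2) _; rewrite -mulrDr ler_wpM2l//.
rewrite Ia1.
have mono : t `^ kappa <= t' `^ kappa.
  by apply: ge0_ler_powR; rewrite ?nnegrE ?(ltW kappa_gt0)// ?(le_trans t0) ?ltW.
have mono' : t `^ kappa / kappa <= t' `^ kappa / kappa by rewrite ler_pM2r ?invr_gt0.
have Iab := le_trans Ia mono'.
rewrite mulrBl -mulrA mulr_natl mulr2n; apply: lerD Ia2.
by rewrite opprB addrCA gerDl subr_le0.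
Qed.

End riemann_liouville.

(** * Functions with impulses *)

(** Perturbing the state argument of a map that is Lipschitz in it, uniformly
    in time, turns separate continuity in time into joint continuity. *)
Lemma cvg_lipschitz_comp {R : realType} {X W : normedModType R} (T L t0 : R)
    (F : R -> X -> W) (G : set_system R) (z : R -> X) (zeta : X) : Filter G ->
  (forall x, {within `[0, T], continuous (fun t => F t x)}) ->
  (forall t, 0 <= t <= T -> forall x1 x2 : X, `|F t x1 - F t x2| <= L * `|x1 - x2|) ->
  0 <= t0 <= T -> within `[0, T] (nbhs t0) `<=` G -> z @ G --> zeta ->
  F s (z s) @[s --> G] --> F t0 zeta.
Proof.
move=> FG Fc FL t0T GT zz.
have t0I : `[0, T]%classic t0 by rewrite /= in_itv.
have Fz : F s zeta @[s --> G] --> F t0 zeta.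
  have /subspace_continuousP/(_ t0 t0I) H := @Fc zeta.
  by move=> P /H /GT.
have GI : \forall s \near G, 0 <= s <= T.
  by apply: GT; rewrite /within/=; near=> s; rewrite in_itv.
apply/cvgrPdist_le => e e0.
have e1 : 0 < e / 2 / (`|L| + 1) by rewrite !divr_gt0// ltr_wpDl.
have e2 : 0 < e / 2 by rewrite divr_gt0.
near=> s.
have sT : 0 <= s <= T by near: s.
have h1 : `|F t0 zeta - F s zeta| <= e / 2.
  by near: s; have /cvgrPdist_le := Fz; apply.
have h2 : `|zeta - z s| <= e / 2 / (`|L| + 1).
  by near: s; have /cvgrPdist_le := zz; apply.
have h3 : `|F s zeta - F s (z s)| <= e / 2.
  apply: le_trans (FL s sT _ _) _.
  apply: (@le_trans _ _ ((`|L| + 1) * `|zeta - z s|)).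
    by rewrite ler_wpM2r// (le_trans (ler_norm L))// lerDl.
  by rewrite mulrC -ler_pdivlMr// ltr_wpDl.
rewrite -(subrKA (F s zeta)); apply: le_trans (ler_normD _ _) _; lra.
Unshelve. all: by end_near. Qed.

Section impulsive_functions.
Context {R : realType}.
Variables (T : R) (m : nat) (tau : nat -> R).
Hypothesis tau_first : tau 0%N = 0.
Hypothesis tau_last : tau m.+1 = T.
Hypothesis tau_incr : forall j, (j <= m)%N -> tau j < tau j.+1.

Lemma tau_lt i j : (i < j)%N -> (j <= m.+1)%N -> tau i < tau j.
Proof.
elim: j => // j IH; rewrite ltnS leq_eqVlt => /predU1P[->|ij] jm.
  exact: tau_incr.
by apply: lt_trans (IH ij (ltnW jm)) _; exact: tau_incr.
Qed.

Lemma tau_le i j : (i <= j)%N -> (j <= m.+1)%N -> tau i <= tau j.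
Proof. by rewrite leq_eqVlt => /predU1P[->//|ij] jm; apply/ltW/tau_lt. Qed.

Lemma tau_gt0 j : (0 < j <= m.+1)%N -> 0 < tau j.
Proof. by move=> /andP[j0 jm]; rewrite -tau_first; exact: tau_lt. Qed.

Lemma tau_ltT j : (j <= m)%N -> tau j < T.
Proof. by move=> jm; rewrite -tau_last; exact: tau_lt. Qed.

Definition impulse_times : set R := [set tau j | j in [set j | (0 < j <= m)%N]].

Lemma finite_impulse_times : finite_set impulse_times.
Proof.
apply: finite_image; apply: (@sub_finite_set _ _ `I_m.+1) => [j /=|].
  by move=> /andP[_]; rewrite ltnS.
exact: finite_II.
Qed.

Lemma impulse_times_itv t : impulse_times t -> 0 < t < T.
Proof.
move=> [j /= /andP[j0 jm] <-]; rewrite tau_gt0 ?tau_ltT// j0 ltnW//.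
Qed.

Lemma within_right t : 0 <= t < T -> within `[0, T] (nbhs t) `<=` t^'+.
Proof.
move=> /andP[t0 tT] P wP; have {}wP : \forall s \near t, 0 <= s <= T -> P s.
  have H : nbhs t [set s | `[0, T]%classic s -> P s] := wP.
  by apply: filterS H => s h sT; apply: h; rewrite /= in_itv.
rewrite /at_right/within/=; near=> s => ts.
have : 0 <= s <= T -> P s by near: s.
apply; rewrite (le_trans t0 (ltW ts))/= ltW//.
by near: s; exact: lt_nbhsl.
Unshelve. all: by end_near. Qed.

Lemma within_left t : 0 < t <= T -> within `[0, T] (nbhs t) `<=` t^'-.
Proof.
move=> /andP[t0 tT] P wP; have {}wP : \forall s \near t, 0 <= s <= T -> P s.
  have H : nbhs t [set s | `[0, T]%classic s -> P s] := wP.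
  by apply: filterS H => s h sT; apply: h; rewrite /= in_itv.
rewrite /at_left/within/=; near=> s => st.
have : 0 <= s <= T -> P s by near: s.
apply; rewrite (le_trans (ltW st) tT) andbT ltW//.
by near: s; exact: lt_nbhsr.
Unshelve. all: by end_near. Qed.

Lemma within_interior t : 0 < t < T -> within `[0, T] (nbhs t) `<=` nbhs t.
Proof.
move=> /andP[t0 tT] P wP; have {}wP : \forall s \near t, 0 <= s <= T -> P s.
  have H : nbhs t [set s | `[0, T]%classic s -> P s] := wP.
  by apply: filterS H => s h sT; apply: h; rewrite /= in_itv.
near=> s.
have : 0 <= s <= T -> P s by near: s.
apply; apply/andP; split; apply/ltW; near: s.
  exact: lt_nbhsr.
exact: lt_nbhsl.
Unshelve. all: by end_near. Qed.

Section IC_facts.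
Context {X : normedModType R}.
Implicit Types x : R -> X.

Lemma ICP x : IC T m tau x <->
  (forall t, 0 <= t <= T -> ~ impulse_times t -> x @ within `[0, T] (nbhs t) --> x t) /\
  (forall j, (0 < j <= m)%N ->
     cvg (x @ (tau j)^'+) /\ x @ (tau j)^'- --> x (tau j)).
Proof.
have oS : open (~` impulse_times).
  rewrite openC; apply: accessible_finite_set_closed.1; last exact: finite_impulse_times.
  exact/hausdorff_accessible/Rhausdorff.
have sub t : ~ impulse_times t ->
    within (`[0, T] `\` impulse_times) (nbhs t) = within `[0, T] (nbhs t).
  move=> nt; have nS : \forall s \near t, ~ impulse_times s.
    exact: open_nbhs_nbhs.
  apply/seteqP; split => P; rewrite /within/= => wP; near=> s.
    by move=> sT; have := near wP s; move=> /(_ _)h; apply: h => //; split => //; near: s.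
  by move=> [sT _]; have := near wP s; move=> /(_ _)h; apply: h.
split=> -[cx jx]; split => //.
  move=> t tT nt; move/subspace_continuousP : cx => /(_ t); rewrite sub//; apply.
  by split => //=; rewrite in_itv.
apply/subspace_continuousP => t [/=]; rewrite in_itv/= => tT nt.
rewrite sub//; exact: cx.
Unshelve. all: by end_near. Qed.

Lemma IC_piecewise_continuous x : IC T m tau x ->
  piecewise_continuous T impulse_times x.
Proof.
move=> /ICP[cx _] s /[dup] sT /andP[s0 sT'] ns.
have := cx s; rewrite (ltW s0) (ltW sT') => /(_ isT ns) c.
by move=> P /c; exact: within_interior.
Qed.

(** Near every time the function is bounded: by continuity, or by the two
    one-sided limits at an impulse; compactness of the segment concludes. *)
Lemma IC_bounded x : IC T m tau x -> exists2 C, 0 <= C & bounded_on_segment T x C.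
Proof.
move=> /ICP[cx jx].
have bnd (G : set_system R) (l : X) : Filter G -> x @ G --> l ->
    \forall s \near G & C \near +oo, `|x s| <= C.
  move=> FG xl; exists ([set s | `|x s| <= `|l| + 1], [set C | `|l| + 1 <= C]) => /=.
    split; last by apply: nbhs_pinfty_ge; exact: num_real.
    move/cvgrPdist_le : xl => /(_ _ ltr01); apply: filterS => s h /=.
    by rewrite -[x s](subrK l) addrC; apply: le_trans (ler_normD _ _) _; rewrite lerD2l distrC.
  by move=> [s C] [/=]; exact: le_trans.
have loc t : `[0, T]%classic t ->
    \forall s \near t & C \near +oo, `[0, T]%classic s -> `|x s| <= C.
  move=> /=; rewrite in_itv/= => tT.
  have [[j jm tj]|nt] := pselect (impulse_times t); last first.
    have [[A B] /= [tA CB] AB] := bnd _ _ _ (cx t tT nt).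
    exists ([set s | `[0, T]%classic s -> A s], B) => //= -[s C] [/= sA CB'] sT.
    by apply: (AB (s, C)); split => //=; exact: sA.
  have [/cvg_ex[l xr] xl] := jx j jm; rewrite tj in xr xl.
  have [[A B] /= [tA CB] AB] := bnd _ _ _ xr.
  have [[A' B'] /= [tA' CB'] AB'] := bnd _ _ _ xl.
  have H : nbhs t [set s | (t < s -> A s) /\ (s < t -> A' s)] by apply: filterI.
  exists ([set s | (t < s -> A s) /\ (s < t -> A' s)],
    [set C | [/\ B C, B' C & `|x t| <= C]]).
    split => //=; near=> C; split; [by near: C|by near: C|].
    by near: C; apply: nbhs_pinfty_ge; exact: num_real.
  move=> [s C] [/= [sA sA'] [BC B'C xtC]] _.
  have [ts|st|e] := ltgtP t s; last by rewrite -e.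
    by apply: (AB (s, C)); split => //=; exact: sA.
  by apply: (AB' (s, C)); split => //=; exact: sA'.
have cov := (near_covering_withinP _).2 ((compact_near_coveringP _).1 (@segment_compact R 0 T)).
have : \forall C \near +oo, `[0, T]%classic `<=` (fun s => `|x s| <= C).
  exact: cov.
move=> /pinfty_ex_gt0[C C0 H]; exists C; first exact: ltW.
by move=> s sT; apply: H; rewrite /= in_itv.
Unshelve. all: by end_near. Qed.

Lemma IC_left_limit x j : IC T m tau x -> (0 < j <= m)%N ->
  left_limit x (tau j) = x (tau j).
Proof.
move=> [_ /(_ j) H] jm; apply: cvg_lim; first exact: norm_hausdorff.
by have [] := H jm.
Qed.

(** One-sided limits pass through [F] by joint continuity. *)
Lemma IC_comp (W : normedModType R) (L : R) (F : R -> X -> W) x :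
  (forall v, {within `[0, T], continuous (fun t => F t v)}) ->
  (forall t, 0 <= t <= T -> forall x1 x2 : X, `|F t x1 - F t x2| <= L * `|x1 - x2|) ->
  IC T m tau x ->
  (forall t, 0 <= t <= T -> ~ impulse_times t ->
     (fun s => F s (x s)) @ within `[0, T] (nbhs t) --> F t (x t)) /\
  (forall j, (0 < j <= m)%N -> cvg ((fun s => F s (x s)) @ (tau j)^'+) /\
    (fun s => F s (x s)) @ (tau j)^'- --> F (tau j) (x (tau j))).
Proof.
move=> Fc FL /ICP[cx jx]; split => [t tT nt|j jm].
  by apply: (cvg_lipschitz_comp _ Fc FL) => //; exact: cx.
have tj : 0 < tau j < T by apply: impulse_times_itv; exists j.
have /andP[tj0 tjT] := tj.
have [/cvg_ex[l xr] xl] := jx j jm; split.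
  apply/cvg_ex; exists (F (tau j) l).
  apply: (cvg_lipschitz_comp _ Fc FL) => //; first by rewrite (ltW tj0) ltW.
  by apply: within_right; rewrite ltW.
apply: (cvg_lipschitz_comp _ Fc FL) => //; first by rewrite (ltW tj0) ltW.
by apply: within_left; rewrite tj0 ltW.
Qed.

End IC_facts.

Lemma IC_lipschitz_comp (X W : normedModType R) (L : R) (F : R -> X -> W) x :
  (forall v, {within `[0, T], continuous (fun t => F t v)}) ->
  (forall t, 0 <= t <= T -> forall x1 x2 : X, `|F t x1 - F t x2| <= L * `|x1 - x2|) ->
  IC T m tau x -> IC T m tau (fun s => F s (x s)).
Proof. by move=> Fc FL xIC; apply/ICP; exact: IC_comp Fc FL xIC. Qed.

End impulsive_functions.

(** * Inserting the impulses into a continuous function *)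

Section impulses.
Context {R : realType} {X : normedModType R}.
Variables (T : R) (m : nat) (tau : nat -> R).
Hypothesis tau_first : tau 0%N = 0.
Hypothesis tau_last : tau m.+1 = T.
Hypothesis tau_incr : forall j, (j <= m)%N -> tau j < tau j.+1.
Variables (Theta : nat -> X -> X) (d : nat -> R).
Hypothesis d_gt0 : forall j, (0 < j <= m)%N -> 0 < d j.
Hypothesis Theta_lip : forall j, (0 < j <= m)%N -> forall z1 z2,
  `|Theta j z1 - Theta j z2| <= d j * `|z1 - z2|.

(** [w] followed by its first [n] jumps.  The jump at [tau k] is computed from
    the function with the earlier jumps included, which is the left limit of the
    final function there. *)
Fixpoint with_impulses (w : R -> X) (n : nat) : R -> X :=
  if n is k.+1 then fun t => with_impulses w k t +
    (if tau k.+1 < t then Theta k.+1 (with_impulses w k (tau k.+1)) else 0)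
  else w.

Definition step (k : nat) (v : X) (t : R) : X := if tau k < t then v else 0.

Lemma cvg_step (G : set_system R) k v (b : bool) : Filter G ->
  (\forall s \near G, (tau k < s) = b) ->
  step k v @ G --> (if b then v else 0).
Proof.
move=> FG H; apply: cvg_near_cst; apply: filterS H => s; rewrite /step => ->.
by [].
Qed.

Lemma IC_step x k v : (0 < k <= m)%N -> IC T m tau x ->
  IC T m tau (fun t => x t + step k v t).
Proof.
move=> km /ICP[cx jx].
apply/ICP; split => [t tT nt|j jm].
  apply: cvgD; first exact: cx.
  apply: cvg_step; apply: (@cvg_within _ (nbhs t)).
  have [lt|gt|e] := ltgtP (tau k) t.
  - near=> s; suff : tau k < s by []. 
    by near: s; exact: lt_nbhsr.
  - near=> s; apply/negbTE; rewrite -leNgt ltW//.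
    by near: s; exact: lt_nbhsl.
  - by exfalso; apply: nt; exists k.
have [xr xl] := jx j jm; split.
  apply/cvg_ex; exists (lim (x @ (tau j)^'+) + if tau k <= tau j then v else 0).
  apply: cvgD => //; apply: cvg_step.
  have [le|gt] := leP (tau k) (tau j).
    near=> s; suff : tau k < s by [].
    by apply: le_lt_trans le _; near: s; exact: nbhs_right_gt.
  near=> s; apply/negbTE; rewrite -leNgt.
  by near: s; apply: nbhs_right_le.
apply: cvgD => //; apply: cvg_step.
have [lt|ge] := ltP (tau k) (tau j).
  near=> s; suff : tau k < s by [].
  by near: s; exact: nbhs_left_gt.
near=> s; apply/negbTE; rewrite -leNgt; apply: le_trans ge.
by near: s; exact: nbhs_left_le.
Unshelve. all: by end_near. Qed.

Lemma continuous_IC (w : R -> X) : {within `[0, T], continuous w} -> IC T m tau w.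
Proof.
move=> /subspace_continuousP cw.
have {}cw t : 0 <= t <= T -> w @ within `[0, T] (nbhs t) --> w t.
  by move=> tT; apply: cw; rewrite /= in_itv.
apply/ICP; split => [t tT _|j jm]; first exact: cw.
have /andP[j0 jT] : 0 < tau j < T.
  by apply: (@impulse_times_itv _ _ m tau tau_first tau_last tau_incr); exists j.
have {}cw : w @ within `[0, T] (nbhs (tau j)) --> w (tau j).
  by apply: cw; rewrite !ltW.
split; first apply/cvg_ex; first exists (w (tau j)).
  by move=> P /cw; apply: within_right; rewrite jT ltW.
by move=> P /cw; apply: within_left; rewrite j0 ltW.
Qed.

Lemma with_impulses_IC w n : (n <= m)%N -> {within `[0, T], continuous w} ->
  IC T m tau (with_impulses w n).
Proof.
move=> + cw; elim: n => [_|n IH nm]; first exact: continuous_IC.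
exact: (IC_step _ _ (IH (ltnW nm))).
Qed.

(** Later jumps do not affect earlier times. *)
Lemma with_impulses_stable w n k t : (n <= k)%N -> (k <= m)%N ->
  t <= tau n.+1 -> with_impulses w k t = with_impulses w n t.
Proof.
move=> + + tn; elim: k => [|k IH]; first by rewrite leqn0 => /eqP->.
rewrite leq_eqVlt => /predU1P[->//|nk] km.
rewrite /= IH ?(ltnW km)// ifF ?addr0//.
apply/negbTE; rewrite -leNgt; apply: le_trans tn _.
apply: (tau_le tau_incr) => //; exact: ltnW.
Qed.

Lemma with_impulsesE w j t : (j <= m)%N ->
  (forall i, (0 < i <= j)%N -> tau i < t) -> t <= tau j.+1 ->
  with_impulses w m t =
    w t + \sum_(1 <= i < j.+1) Theta i (with_impulses w m (tau i)).
Proof.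
move=> jm jt tj; rewrite (@with_impulses_stable _ j)//.
have H n : (n <= j)%N -> with_impulses w n t =
    w t + \sum_(1 <= i < n.+1) Theta i (with_impulses w m (tau i)).
  elim: n => [_|n IH nj]; first by rewrite big_geq// addr0.
  rewrite /= IH ?(ltnW nj)// jt ?nj// [in RHS]big_nat_recr//= addrA.
  by rewrite (@with_impulses_stable w n m)// (leq_trans (ltnW nj)).
exact: H.
Qed.

Lemma with_impulses0 w : with_impulses w m 0 = w 0.
Proof.
rewrite (@with_impulsesE _ 0)//.
- by rewrite big_geq// addr0.
- by move=> i /andP[/leq_trans h /h].
- by rewrite -tau_first; apply/ltW/tau_incr.
Qed.

(** The reconstruction is causal: the bound up to time [t] uses the distance
    of the data up to time [t] only, as weighted estimates require. *)
Lemma with_impulses_lipschitz n : (n <= m)%N ->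
  exists2 C, 0 <= C & forall w w' B t, 0 <= B ->
    (forall s, 0 <= s <= t -> `|w s - w' s| <= B) ->
    forall s, 0 <= s <= t ->
      `|with_impulses w n s - with_impulses w' n s| <= C * B.
Proof.
elim: n => [_|n IH nm].
  by exists 1 => // w w' B t _ H s st; rewrite mul1r; exact: H.
have [C C0 HC] := IH (ltnW nm).
have dn := d_gt0 (nm : (0 < n.+1 <= m)%N).
exists (C + d n.+1 * C) => [|w w' B t B0 H s /andP[s0 st]].
  by rewrite addr_ge0// mulr_ge0// ltW.
rewrite /= opprD addrACA mulrDl; apply: le_trans (ler_normD _ _) _.
apply: lerD; first by apply: (HC _ _ _ t) => //; rewrite s0.
case: ifPn => ts; last by rewrite subrr normr0 !mulr_ge0// ltW.
apply: (le_trans (@Theta_lip n.+1 nm _ _)).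
rewrite -mulrA ler_wpM2l ?(ltW dn)//.
apply: (HC _ _ _ t) => //; rewrite (le_trans (ltW ts) st) andbT ltW//.
apply: (tau_gt0 tau_first tau_incr).
exact: leqW.
Qed.

End impulses.

(** * The impulsive integral equation *)

Section geometric_sequences.
Context {R : realType} {X : completeNormedModType R}.

Lemma geometric_cvg (u : nat -> X) (K : R) :
  (forall n, `|u n.+1 - u n| <= K * 2^-1 ^+ n) ->
  exists l, forall n, `|l - u n| <= 2 * K * 2^-1 ^+ n.
Proof.
move=> uK.
have K0 : 0 <= K by have := le_trans (normr_ge0 _) (uK 0%N); rewrite expr0 mulr1.
have dist n k : `|u (n + k)%N - u n| <= 2 * K * 2^-1 ^+ n - 2 * K * 2^-1 ^+ (n + k).
  elim: k => [|k IH]; first by rewrite addn0 !subrr normr0.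
  rewrite addnS -(subrKA (u (n + k)%N)); apply: le_trans (ler_normD _ _) _.
  have := uK (n + k)%N; move: IH; rewrite exprS; set q := 2^-1 ^+ (n + k); lra.
have p0 n : 0 <= 2^-1 ^+ n :> R by rewrite exprn_ge0// invr_ge0.
have dist' n k : `|u (n + k)%N - u n| <= 2 * K * 2^-1 ^+ n.
  apply: le_trans (dist n k) _; rewrite gerBl mulr_ge0//.
  by rewrite mulr_ge0.
have geo0 : 2 * K * 2^-1 ^+ n @[n --> \oo] --> (0 : R).
  rewrite -(mulr0 (2 * K)); apply: cvgM; first exact: cvg_cst.
  by apply: cvg_expr; rewrite ger0_norm ?invr_ge0// invf_lt1// ltr1n.
have cu : cvg (u @ \oo).
  apply: cauchy_cvg; apply/cauchy_ballP => e e0.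
  have e2 : 0 < e / 2 by rewrite divr_gt0.
  have [n /= nK] : exists n, 2 * K * 2^-1 ^+ n < e / 2.
    have /cvgr_lt/(_ _ e2) H := geo0.
    by have [n ?] := filter_ex H; exists n.
  pose A := [set x | `|x - u n| <= 2 * K * 2^-1 ^+ n].
  have uA : \forall k \near \oo, A (u k).
    by exists n => // k /= nk; have := dist' n (k - n)%N; rewrite subnKC.
  exists (A, A); first by split.
  move=> [x x'] [/= Ax Ax']; rewrite -ball_normE /ball_/=.
  rewrite -(subrKA (u n)); apply: le_lt_trans (ler_normD _ _) _.
  by move: Ax Ax'; rewrite /A/= (distrC (u n)); lra.
have /cvg_ex[l ul] := cu.
exists l => n.
have ln : `|u k - u n| @[k --> \oo] --> `|l - u n|.
  by apply: cvg_norm; apply: cvgB => //; exact: cvg_cst.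
apply: (cvgr_to_le ln); exists n => // k /= nk.
by have := dist' n (k - n)%N; rewrite subnKC.
Qed.

Lemma le_geometric_eq0 (a K : R) : (forall n, a <= K * 2^-1 ^+ n) -> a <= 0.
Proof.
move=> aK.
have geo0 : K * 2^-1 ^+ n @[n --> \oo] --> (0 : R).
  rewrite -(mulr0 K); apply: cvgM; first exact: cvg_cst.
  by apply: cvg_expr; rewrite ger0_norm ?invr_ge0// invf_lt1// ltr1n.
by apply: (cvgr_to_ge geo0); apply: nearW.
Qed.

End geometric_sequences.

Section impulsive_volterra.
Context {R : realType} {X : completeNormedModType R}.
Variables (kappa T L c : R) (m : nat) (tau : nat -> R) (z0 : X).
Variables (Theta : nat -> X -> X) (d : nat -> R) (F : R -> X -> X).
Hypothesis reflX : reflexive_space X.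
Hypothesis sepX : separable_space X.
Hypothesis kappa_gt0 : 0 < kappa.
Hypothesis kappa_le1 : kappa <= 1.
Hypothesis T_gt0 : 0 < T.
Hypothesis tau_first : tau 0%N = 0.
Hypothesis tau_last : tau m.+1 = T.
Hypothesis tau_incr : forall j, (j <= m)%N -> tau j < tau j.+1.
Hypothesis d_gt0 : forall j, (0 < j <= m)%N -> 0 < d j.
Hypothesis Theta_lip : forall j, (0 < j <= m)%N -> forall z1 z2,
  `|Theta j z1 - Theta j z2| <= d j * `|z1 - z2|.
Hypothesis F_cont : forall v, {within `[0, T], continuous (fun t => F t v)}.
Hypothesis L_ge0 : 0 <= L.
Hypothesis F_lip : forall t, 0 <= t <= T -> forall v1 v2,
  `|F t v1 - F t v2| <= L * `|v1 - v2|.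

Local Notation S := (impulse_times m tau).
Let finS : finite_set S := finite_impulse_times m tau.

(** The forcing [h] is kept separate from [F] because only its values on
    [[0, T]] are prescribed, while it enters the integral as a function on the
    whole line. *)
Definition impulsive_integral_equation (z : R -> X) (h : R -> X) :=
  [/\ IC T m tau z, z 0 = z0, (forall t, 0 <= t <= T -> h t = F t (z t)) &
    forall j t, (j <= m)%N -> tau j < t <= tau j.+1 ->
      exists2 I : X,
        is_bochner_integral lebesgue_measure `[0, t] (abel_integrand kappa t h) I &
        z t = z0 + \sum_(1 <= i < j.+1) Theta i (left_limit z (tau i)) + c *: I].

(** Regularity is inherited from [IC], since [h] agrees with
    [F s (z s)] around every interior time. *)
Lemma forcing_regular (z h : R -> X) : IC T m tau z ->
  (forall t, 0 <= t <= T -> h t = F t (z t)) ->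
  piecewise_continuous T S h /\ exists2 C, 0 <= C & bounded_on_segment T h C.
Proof.
move=> zIC hF.
have FIC := IC_lipschitz_comp tau_first tau_last tau_incr F_cont F_lip zIC.
split; last first.
  have [C C0 FC] := IC_bounded FIC.
  by exists C => // s sT; rewrite hF//; exact: FC.
move=> s /[dup] sT /andP[s0 sT'] nS.
have hs : h s = F s (z s) by rewrite hF// !ltW.
have c0 : F r (z r) @[r --> s] --> h s.
  by rewrite hs; exact: (IC_piecewise_continuous FIC sT nS).
change (h @ s --> h s); apply: cvg_trans c0; apply: near_eq_cvg; near=> r; apply/esym/hF.
by apply/andP; split; apply/ltW; near: r; [exact: lt_nbhsr|exact: lt_nbhsl].
Unshelve. all: by end_near. Qed.

(** Two solutions that agree up to [tau j] have the same jumps up to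
    [tau j.+1], so their difference on that interval is a fractional integral of
    a quantity it controls; in the weight [exp (lam t)] every pass halves the
    bound. *)
Lemma impulsive_integral_unique z h z' h' :
  impulsive_integral_equation z h -> impulsive_integral_equation z' h' ->
  forall t, 0 <= t <= T -> z' t = z t.
Proof.
move=> [zIC z00 hF zE] [zIC' z00' hF' zE'].
have [ch [C C0 hC]] := forcing_regular zIC hF.
have [ch' [C' C'0 hC']] := forcing_regular zIC' hF'.
have [M M0 zM] := IC_bounded zIC.
have [M' M'0 zM'] := IC_bounded zIC'.
(* chosen so that [|c| L eps <= 1 / 2] *)
pose eps := (2 * (`|c| * L + 1))^-1.
have cL : 0 < `|c| * L + 1 by rewrite ltr_wpDl// mulr_ge0.
have eps0 : 0 < eps by rewrite invr_gt0 mulr_gt0.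
have [lam lam0 small] := integral_abel_expR_small T kappa_gt0 kappa_le1 eps0.
have H j : (j <= m.+1)%N -> forall t, 0 <= t <= tau j -> z' t = z t.
  elim: j => [_ t|j IH jm t /andP[t0 tj]].
    by rewrite tau_first -eq_le => /eqP <-; rewrite z00 z00'.
  have {}IH := IH (ltnW jm); have jm' : (j <= m)%N by [].
  have tjT : tau j.+1 <= T by rewrite -tau_last; exact: (tau_le tau_incr).
  have step (B : R) : 0 <= B ->
      (forall s, 0 <= s <= tau j.+1 -> `|z' s - z s| <= B * expR (lam * s)) ->
      forall s, 0 <= s <= tau j.+1 -> `|z' s - z s| <= B / 2 * expR (lam * s).
    move=> B0 HB s /andP[s0 sj].
    have [sj'|js] := leP s (tau j).
      rewrite IH ?s0// subrr normr0 mulr_ge0 ?expR_ge0//; exact: divr_ge0.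
    have sT : s <= T := le_trans sj tjT.
    have [|I bI ->] := zE j s jm; first by rewrite js.
    have [|I' bI' ->] := zE' j s jm; first by rewrite js.
    have -> : \sum_(1 <= i < j.+1) Theta i (left_limit z' (tau i)) =
        \sum_(1 <= i < j.+1) Theta i (left_limit z (tau i)).
      rewrite !big_nat; apply: eq_bigr => i /andP[i0 ij].
      have im : (0 < i <= m)%N by rewrite i0 (leq_trans _ jm').
      rewrite (IC_left_limit zIC im) (IC_left_limit zIC' im) IH//.
      rewrite ltW/=; first by apply: (tau_le tau_incr) => //; exact: ltnW.
      by apply: (tau_gt0 tau_first tau_incr); rewrite i0 (leq_trans _ (ltnW jm)).
    rewrite opprD addrACA subrr add0r -scalerBr normrZ.
    have rI := bochner_rl_integral finS ch sT bI.
    have rI' := bochner_rl_integral finS ch' sT bI'.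
    have : `|I' - I| <= L * B * (eps * expR (lam * s)).
      apply: (rl_integral_le_bielecki kappa_gt0 finS ch' hC' rI' ch hC rI sT).
      - exact: mulr_ge0.
      - move=> r /andP[r0 rs].
        have rT : 0 <= r <= T by rewrite r0 (le_trans (ltW rs)).
        rewrite hF// hF'//; apply: le_trans (F_lip rT _ _) _.
        rewrite -mulrA ler_wpM2l//; apply: HB.
        by rewrite r0 (le_trans (ltW rs)).
      - by apply: small; rewrite s0.
    move=> h1; apply: le_trans (ler_wpM2l (normr_ge0 c) h1) _.
    have -> : `|c| * (L * B * (eps * expR (lam * s))) =
        (`|c| * L * eps) * (B * expR (lam * s)) by ring.
    have -> : B / 2 * expR (lam * s) = 2^-1 * (B * expR (lam * s)) by field.
    rewrite ler_wpM2r ?mulr_ge0 ?expR_ge0//.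
    by rewrite /eps invfM mulrCA ler_piMr ?invr_ge0// ler_pdivrMr// mul1r lerDl.
  have bound n s : 0 <= s <= tau j.+1 ->
      `|z' s - z s| <= (M' + M) * 2^-1 ^+ n * expR (lam * s).
    elim: n s => [|n IHn] s sj.
      have sT : 0 <= s <= T by case/andP: sj => -> /le_trans ->.
      rewrite expr0 mulr1; apply: le_trans (ler_normB _ _) _.
      apply: (@le_trans _ _ (M' + M)); first by apply: lerD; [exact: zM'|exact: zM].
      rewrite ler_peMr ?addr_ge0// -expR0 ler_expR mulr_ge0//.
      by case/andP: sj.
    rewrite exprS mulrCA [X in X * _]mulrC; apply: step => //.
    by rewrite mulr_ge0 ?addr_ge0// exprn_ge0// invr_ge0.
  apply/eqP; rewrite -subr_eq0 -normr_le0.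
  apply: (@le_geometric_eq0 _ _ ((M' + M) * expR (lam * t))) => n.
  by rewrite mulrAC; apply: bound; rewrite t0.
by move=> t tT; apply: (H m.+1) => //; rewrite tau_last.
Qed.

Definition forcing (w : R -> X) (s : R) : X := F s (with_impulses tau Theta w m s).

Definition rl_value (t : R) (h : R -> X) : X := xget 0 [set v | rl_integral kappa t h v].

Definition picard (w : R -> X) (t : R) : X := z0 + c *: rl_value t (forcing w).

Lemma rlP h C t : piecewise_continuous T S h -> bounded_on_segment T h C ->
  t <= T -> rl_integral kappa t h (rl_value t h).
Proof.
move=> ch hC tT; have [v hv] := rl_integral_exists kappa_gt0 finS reflX ch hC tT.
by rewrite /rl_value; case: xgetP => [//|/(_ v)].
Qed.

Lemma forcing_regular_continuous w : {within `[0, T], continuous w} ->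
  piecewise_continuous T S (forcing w) /\
  exists2 C, 0 <= C & bounded_on_segment T (forcing w) C.
Proof.
move=> cw; apply: (@forcing_regular (with_impulses tau Theta w m)) => //.
exact: with_impulses_IC.
Qed.

(** Hoelder continuity of the fractional integral. *)
Lemma picard_continuous w : {within `[0, T], continuous w} ->
  {within `[0, T], continuous (picard w)}.
Proof.
move=> cw; have [ch [C C0 hC]] := forcing_regular_continuous cw.
have hol t t' : 0 <= t -> t < t' -> t' <= T ->
    `|rl_value t' (forcing w) - rl_value t (forcing w)| <= C * (2 * (t' - t) `^ kappa / kappa).
  move=> t0 tt' t'T.
  apply: (rl_integral_holder kappa_gt0 kappa_le1 finS ch hC C0 t0 tt' t'T).
    by apply: rlP ch hC _; rewrite (le_trans (ltW tt')).
  exact: rlP ch hC _.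
apply/subspace_continuousP => t tI; have := tI; rewrite /= in_itv/= => /andP[t0 tT].
suff rlc : rl_value s (forcing w) @[s --> within `[0, T] (nbhs t)] --> rl_value t (forcing w).
  have crl : c *: rl_value s (forcing w) @[s --> within `[0, T] (nbhs t)] -->
      c *: rl_value t (forcing w) by apply: cvgZr.
  exact: (cvgD (cvg_cst z0) crl).
apply/cvgrPdist_le => e e0.
(* the Hoelder constant, made positive *)
pose B := C * (2 / kappa) + 1.
have B0 : 0 < B by rewrite ltr_wpDl// mulr_ge0// divr_ge0// ltW.
pose del := (e / B) `^ kappa^-1.
have del0 : 0 < del by rewrite powR_gt0// divr_gt0.
have delk : del `^ kappa = e / B.
  by rewrite -powRrM mulVf ?gt_eqF// powRr1// ltW// divr_gt0.
have key a b : 0 <= a -> a < b -> b <= T -> b - a <= del ->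
    `|rl_value b (forcing w) - rl_value a (forcing w)| <= e.
  move=> a0 ab bT bad; apply: le_trans (hol _ _ a0 ab bT) _.
  have : (b - a) `^ kappa <= e / B.
    rewrite -delk; apply: ge0_ler_powR; rewrite ?nnegrE ?(ltW kappa_gt0) ?(ltW del0)//.
    by rewrite subr_ge0 ltW.
  move=> h1; have -> : C * (2 * (b - a) `^ kappa / kappa) = C * (2 / kappa) * (b - a) `^ kappa.
    by ring.
  have C2 : 0 <= C * (2 / kappa) by rewrite mulr_ge0// divr_ge0// ltW.
  apply: le_trans (ler_wpM2l C2 h1) _.
  rewrite mulrCA ler_piMr ?(ltW e0)// ler_pdivrMr// mul1r lerDl.
  by [].
have nt : \forall s \near t, `|t - s| <= del.
  have /cvgrPdist_le : id y @[y --> t] --> t by exact: cvg_id.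
  by apply.
have ntw : \forall s \near within `[0, T] (nbhs t), `|t - s| <= del.
  by apply: filterS nt => s.
near=> s.
have sI : `[0, T]%classic s by near: s; exact: withinT.
have := sI; rewrite /= in_itv/= => /andP[s0 sT].
have ts : `|t - s| <= del by near: s; exact: ntw.
have [lt|gt|->] := ltgtP t s.
- by rewrite distrC; apply: key => //; move: ts; rewrite distrC ger0_norm// subr_ge0 ltW.
- by apply: key => //; move: ts; rewrite ger0_norm// subr_ge0 ltW.
- by rewrite subrr normr0 ltW.
Unshelve. all: by end_near. Qed.

(** The distance of the reconstructed functions up to time [s] is at most
    [K B exp (lam s)] because the weight is increasing. *)
Lemma picard_contraction : exists2 lam : R, 0 <= lam & forall w w' (B : R),
  {within `[0, T], continuous w} -> {within `[0, T], continuous w'} -> 0 <= B ->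
  (forall s, 0 <= s <= T -> `|w s - w' s| <= B * expR (lam * s)) ->
  forall s, 0 <= s <= T -> `|picard w s - picard w' s| <= B / 2 * expR (lam * s).
Proof.
have [K K0 HK] := with_impulses_lipschitz tau_first tau_incr d_gt0 Theta_lip (leqnn m).
(* chosen so that [|c| L K eps <= 1 / 2] *)
pose eps := (2 * (`|c| * (L * K) + 1))^-1.
have cL : 0 < `|c| * (L * K) + 1 by rewrite ltr_wpDl// mulr_ge0// mulr_ge0.
have eps0 : 0 < eps by rewrite invr_gt0 mulr_gt0.
have [lam lam0 small] := integral_abel_expR_small T kappa_gt0 kappa_le1 eps0.
exists lam => // w w' B cw cw' B0 HB s /andP[s0 sT].
have [ch [C C0 hC]] := forcing_regular_continuous cw.
have [ch' [C' C'0 hC']] := forcing_regular_continuous cw'.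
have -> : picard w s - picard w' s = c *: (rl_value s (forcing w) - rl_value s (forcing w')).
  by rewrite /picard opprD addrACA subrr add0r scalerBr.
have rI := rlP ch hC sT; have rI' := rlP ch' hC' sT.
rewrite normrZ.
have h1 : `|rl_value s (forcing w) - rl_value s (forcing w')| <= L * K * B * (eps * expR (lam * s)).
  apply: (rl_integral_le_bielecki kappa_gt0 finS ch hC rI ch' hC' rI' sT).
  - by rewrite !mulr_ge0.
  - move=> r /andP[r0 rs].
    have rT : 0 <= r <= T by rewrite r0 (le_trans (ltW rs)).
    apply: le_trans (F_lip rT _ _) _.
    rewrite -!mulrA ler_wpM2l//; apply: (HK _ _ _ r).
    + by rewrite mulr_ge0 ?expR_ge0.
    + move=> q /andP[q0 qr]; have qT : 0 <= q <= T.
        by rewrite q0 (le_trans qr)//; case/andP: rT.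
      apply: le_trans (HB q qT) _; rewrite ler_wpM2l// ler_expR ler_wpM2l//.
    + by rewrite r0 lexx.
  - by apply: small; rewrite s0.
apply: le_trans (ler_wpM2l (normr_ge0 c) h1) _.
have -> : `|c| * (L * K * B * (eps * expR (lam * s))) =
    (`|c| * (L * K) * eps) * (B * expR (lam * s)) by ring.
have -> : B / 2 * expR (lam * s) = 2^-1 * (B * expR (lam * s)) by field.
rewrite ler_wpM2r ?mulr_ge0 ?expR_ge0//.
by rewrite /eps invfM mulrCA ler_piMr ?invr_ge0// ler_pdivrMr// mul1r lerDl.
Qed.

(** Banach's iteration, run pointwise with the weighted bounds; the convergence
    is uniform on [[0, T]], so the limit is continuous. *)
Lemma picard_fixpoint : exists2 w, {within `[0, T], continuous w} &
  forall t, 0 <= t <= T -> w t = picard w t.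
Proof.
have [lam lam0 contr] := picard_contraction.
pose u n := iter n picard (fun=> z0).
have cu n : {within `[0, T], continuous (u n)}.
  elim: n => [|n IH]; last exact: picard_continuous.
  by apply: continuous_subspaceT => t; exact: cvg_cst.
have [M M0 uM] := IC_bounded (continuous_IC tau_first tau_last tau_incr (cu 1%N)).
pose B0 := M + `|z0|.
have B00 : 0 <= B0 by rewrite addr_ge0.
have p0 n : 0 <= 2^-1 ^+ n :> R by rewrite exprn_ge0// invr_ge0.
have du n t : 0 <= t <= T -> `|u n.+1 t - u n t| <= B0 * 2^-1 ^+ n * expR (lam * t).
  elim: n t => [|n IH] t tT.
    rewrite expr0 mulr1; apply: le_trans (ler_normB _ _) _.
    apply: (@le_trans _ _ B0); first by rewrite lerD2r; exact: uM.
    rewrite ler_peMr// -expR0 ler_expR mulr_ge0//.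
    by case/andP: tT.
  rewrite exprS mulrCA [X in X * _]mulrC; apply: (contr _ _ _ (cu n.+1) (cu n) _ IH) => //.
    exact: mulr_ge0.
have lim_ex t : exists l, 0 <= t <= T ->
    forall n, `|l - u n t| <= 2 * (B0 * expR (lam * t)) * 2^-1 ^+ n.
  have [tT|ntT] := pselect (0 <= t <= T); last by exists 0.
  have [|l Hl] := @geometric_cvg _ X (fun n => u n t) (B0 * expR (lam * t)).
    by move=> n; rewrite mulrAC; exact: du.
  by exists l.
pose w t := sval (cid (lim_ex t)).
have wu n t : 0 <= t <= T -> `|w t - u n t| <= 2 * B0 * 2^-1 ^+ n * expR (lam * t).
  move=> tT; rewrite /w; case: cid => l /= /(_ tT n).
  by have -> : 2 * (B0 * expR (lam * t)) * 2^-1 ^+ n = 2 * B0 * 2^-1 ^+ n * expR (lam * t) by ring.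
have geo0 (K : R) : K * 2^-1 ^+ n @[n --> \oo] --> (0 : R).
  rewrite -[X in _ --> X](mulr0 K); apply: cvgM; first exact: cvg_cst.
  by apply: cvg_expr; rewrite ger0_norm ?invr_ge0// invf_lt1// ltr1n.
have cw : {within `[0, T], continuous w}.
  apply/subspace_continuousP => t tI; have := tI; rewrite /= in_itv/= => tT.
  apply/cvgrPdist_le => e e0; have e3 : 0 < e / 3 by rewrite divr_gt0.
  have [n nK] : exists n, 2 * B0 * expR (lam * T) * 2^-1 ^+ n < e / 3.
    have /cvgr_lt/(_ _ e3) H := @geo0 (2 * B0 * expR (lam * T)).
    by have [n ?] := filter_ex H; exists n.
  have wn s : 0 <= s <= T -> `|w s - u n s| <= e / 3.
    move=> sT; apply: le_trans (wu n s sT) _; apply: le_trans (ltW nK).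
    rewrite mulrAC ler_wpM2r// ler_wpM2l ?mulr_ge0// ler_expR ler_wpM2l//.
    by case/andP: sT.
  have /subspace_continuousP/(_ t tI)/cvgrPdist_le/(_ _ e3) nu := @cu n.
  near=> s.
  have sI : `[0, T]%classic s by near: s; exact: withinT.
  have := sI; rewrite /= in_itv/= => sT.
  have h1 := wn t tT; have h2 := wn s sT.
  have h3 : `|u n t - u n s| <= e / 3 by near: s.
  have -> : w t - w s = (w t - u n t) + (u n t - u n s) + (u n s - w s).
    by rewrite !addrA !subrK.
  apply: le_trans (ler_normD _ _) _; rewrite (distrC (u n s)).
  have := ler_normD (w t - u n t) (u n t - u n s); lra.
exists w => // t tT.
apply/eqP; rewrite -subr_eq0 -normr_le0.
apply: (@le_geometric_eq0 _ _ (2 * B0 * expR (lam * t))) => n.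
have h1 := wu n.+1 t tT.
have h2 : `|picard w t - u n.+1 t| <= 2 * B0 * 2^-1 ^+ n / 2 * expR (lam * t).
  apply: (contr w (u n)) => //.
    by rewrite !mulr_ge0.
  by move=> s sT; exact: wu.
have -> : w t - picard w t = (w t - u n.+1 t) + (u n.+1 t - picard w t).
  by rewrite addrA subrK.
apply: le_trans (ler_normD _ _) _; rewrite (distrC (u n.+1 t)).
move: h1 h2; rewrite exprS; lra.
Unshelve. all: by end_near. Qed.

Lemma impulsive_integral_exists : exists z : R -> X,
  forall h, (forall t, h t = F t (z t)) -> impulsive_integral_equation z h.
Proof.
have [w cw wE] := picard_fixpoint.
have [ch [C C0 hC]] := forcing_regular_continuous cw.
pose z := with_impulses tau Theta w m.
have zIC : IC T m tau z by apply: with_impulses_IC.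
exists z => h hE.
have {hE} -> : h = forcing w by apply/funext => t; rewrite hE.
split => //.
- rewrite /z (with_impulses0 tau_first tau_incr).
  rewrite wE ?lexx ?ltW// /picard.
  have := rlP ch hC (ltW T_gt0) => r0.
  suff -> : rl_value 0 (forcing w) = 0 by rewrite scaler0 addr0.
  apply: dual_separates => phi; rewrite r0 set_itv_ge ?bnd_simp ?ltxx//.
  by rewrite Rintegral_set0 dual0.
- move=> j t jm /andP[jt tj].
  have t0 : 0 < t.
    by apply: le_lt_trans jt; rewrite -tau_first; apply: (tau_le tau_incr) => //; exact: leqW.
  have tT : t <= T by apply: le_trans tj _; rewrite -tau_last; apply: (tau_le tau_incr).
  have tT0 : 0 <= t <= T by rewrite (ltW t0).
  exists (rl_value t (forcing w)).
    apply: (rl_integral_bochner kappa_gt0 finS sepX ch hC tT0).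
    exact: rlP ch hC tT.
  rewrite {1}/z (with_impulsesE tau_incr _ _ jm) => [|i /andP[i0 ij]|//].
    rewrite wE// /picard addrAC; congr (_ + _ + _).
    rewrite !big_nat; apply: eq_bigr => i /andP[i0 ij].
    have im : (0 < i <= m)%N by rewrite i0 (leq_trans _ jm)// -ltnS.
    by rewrite (IC_left_limit zIC im).
  apply: le_lt_trans jt; apply: (tau_le tau_incr) => //; exact: leqW.
Qed.

End impulsive_volterra.

(** * The coupled problem *)

Theorem theorem3p1 (R : realType) (Y Z1 Z2 : completeNormedModType R)
  (T kappa p M1 mA mJ cJ mg : R) (m : nat) (tau : nat -> R) (d : nat -> R)
  (z0 : Z1) (phi : R -> R)
  (f : R -> Z1 -> Z2 -> Z1) (A : R -> Z2 -> topdual Z2) (N : 'L(Z2, Y))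
  (J : R -> Y -> R) (g : R -> Z1 -> topdual Z2) (Theta : nat -> Z1 -> Z1)
  (reflY : reflexive_space Y) (sepY : separable_space Y)
  (reflZ1 : reflexive_space Z1) (sepZ1 : separable_space Z1)
  (reflZ2 : reflexive_space Z2) (sepZ2 : separable_space Z2)
  (T_gt0 : 0 < T)
  (tau_first : tau 0%N = 0) (tau_last : tau m.+1 = T)
  (tau_incr : forall j, (j <= m)%N -> tau j < tau j.+1)
  (p_gt0 : 0 < p) (p_lt_kappa : p < kappa) (kappa_lt1 : kappa < 1)
  (* Hf *)
  (f_cont : forall z y, {within `[0, T], continuous (fun t => f t z y)})
  (M1_gt0 : 0 < M1)
  (f_lip : forall t, 0 <= t <= T -> forall z1 z2 y1 y2,
     `|f t z1 y1 - f t z2 y2| <= M1 * (`|z1 - z2| + `|y1 - y2|))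
  (phi_ge0 : forall t, 0 <= t <= T -> 0 <= phi t)
  (phi_Lfun : phi \_ `[0, T] \in Lfun lebesgue_measure (p^-1)%:E)
  (f_le_phi : forall t, 0 <= t <= T -> forall z y, `|f t z y| <= phi t)
  (* HI *)
  (Theta_bounded : forall j, (0 < j <= m)%N -> bounded_map (Theta j))
  (d_gt0 : forall j, (0 < j <= m)%N -> 0 < d j)
  (Theta_lip : forall j, (0 < j <= m)%N -> forall z1 z2,
     `|Theta j z1 - Theta j z2| <= d j * `|z1 - z2|)
  (* HA *)
  (A_cont : forall y, {within `[0, T], continuous (fun t => A t y)})
  (A_bounded : forall t, 0 <= t <= T -> bounded_map (A t))
  (A_demicont : forall t, 0 <= t <= T -> demicontinuous (A t))
  (mA_gt0 : 0 < mA)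
  (A_smono : forall t, 0 <= t <= T -> strongly_monotone (A t) mA)
  (* HN *)
  (N_compact : compact_operator N)
  (N_surj : forall x, exists y, N y = x)
  (* HJ *)
  (J_cont : forall x, {within `[0, T], continuous (fun t => J t x)})
  (J_loclip : forall t, 0 <= t <= T -> locally_lipschitz (J t))
  (mJ_gt0 : 0 < mJ)
  (J_growth : forall t, 0 <= t <= T -> forall x eta,
     clarke_gradient (J t) x eta -> `|eta| <= mJ * (`|x| + 1))
  (cJ_gt0 : 0 < cJ)
  (J_relmono : forall t, 0 <= t <= T -> forall y1 y2 theta1 theta2,
     clarke_gradient (J t) y1 theta1 -> clarke_gradient (J t) y2 theta2 ->
     - cJ * `|y1 - y2| ^+ 2 <= (theta1 - theta2) (y1 - y2))
  (* Hg *)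
  (g_cont : forall z, {within `[0, T], continuous (fun t => g t z)})
  (mg_gt0 : 0 < mg)
  (g_lip : forall t, 0 <= t <= T -> forall z1 z2,
     `|g t z1 - g t z2| <= mg * `|z1 - z2|)
  (* HO *)
  (mA_gt : cJ * `|N| ^+ 2 < mA)
  (HO_lt1 : T `^ kappa * M1 * mg /
      (kappa * (mA - cJ * `|N| ^+ 2) * Gamma kappa) < 1) :
  exists z y,
    is_solution T kappa m tau z0 f A N J g Theta z y /\
    forall z' y', is_solution T kappa m tau z0 f A N J g Theta z' y' ->
      forall t, 0 <= t <= T -> z' t = z t /\ y' t = y t.
Proof.
pose mm := mA - cJ * `|N| ^+ 2.
have mm0 : 0 < mm by rewrite subr_gt0.
have cJ0 := ltW cJ_gt0.
have kappa0 : 0 < kappa := lt_trans p_gt0 p_lt_kappa.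
have sol_ex t (b : topdual Z2) : exists y, 0 <= t <= T -> exists2 eta : topdual Z2,
    (adjoint N @` clarke_gradient (J t) (N y)) eta & A t y + eta = b.
  have [tT|ntT] := pselect (0 <= t <= T); last by exists 0.
  have [y Hy] := inclusion_solvable reflZ2 (A_demicont t tT) (A_smono t tT) N_surj
    (J_loclip t tT) cJ0 (J_relmono t tT) mA_gt b.
  by exists y.
pose sol t b := sval (cid (sol_ex t b)).
have solP t (b : topdual Z2) : 0 <= t <= T -> exists2 eta : topdual Z2,
    (adjoint N @` clarke_gradient (J t) (N (sol t b))) eta & A t (sol t b) + eta = b.
  by rewrite /sol; case: cid.
have sol_lip_at t y1 y2 (b1 b2 : topdual Z2) : 0 <= t <= T ->
    (exists2 eta : topdual Z2, (adjoint N @` clarke_gradient (J t) (N y1)) eta &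
       A t y1 + eta = b1) ->
    (exists2 eta : topdual Z2, (adjoint N @` clarke_gradient (J t) (N y2)) eta &
       A t y2 + eta = b2) -> `|y1 - y2| <= mm^-1 * `|b1 - b2|.
  move=> tT [_ [e1 G1 <-] E1] [_ [e2 G2 <-] E2]; rewrite mulrC.
  exact: (inclusion_lipschitz (A_smono t tT) cJ0 (J_relmono t tT) mA_gt G1 G2 E1 E2).
have sol_lip t : 0 <= t <= T -> forall b1 b2,
    `|sol t b1 - sol t b2| <= mm^-1 * `|b1 - b2|.
  by move=> tT b1 b2; apply: (sol_lip_at t) => //; exact: solP.
have sol_cont (b : topdual Z2) : {within `[0, T], continuous (fun t => sol t b)}.
  have eta_ex t : exists eta : topdual Y, 0 <= t <= T ->
      clarke_gradient (J t) (N (sol t b)) eta /\ A t (sol t b) + adjoint N eta = b.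
    have [tT|ntT] := pselect (0 <= t <= T); last by exists 0.
    by have [_ [eta Ge <-] E] := solP t b tT; exists eta.
  pose eta t := sval (cid (eta_ex t)).
  apply: (@solution_continuous R Y Z2 T A N J mA cJ mJ b (fun t => sol t b) eta) => //.
  by move=> t tT; rewrite /eta; case: cid => e /= /(_ tT).
pose G t x := sol t (g t x).
have G_cont x : {within `[0, T], continuous (fun t => G t x)}.
  apply/subspace_continuousP => t tI; have := tI; rewrite /= in_itv/= => tT.
  apply: (cvg_lipschitz_comp _ sol_cont sol_lip tT) => //.
  by have /subspace_continuousP := @g_cont x; apply.
have G_lip t : 0 <= t <= T -> forall x1 x2, `|G t x1 - G t x2| <= mm^-1 * mg * `|x1 - x2|.
  move=> tT x1 x2; apply: le_trans (sol_lip t tT _ _) _.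
  by rewrite -mulrA ler_wpM2l ?invr_ge0 ?(ltW mm0)//; exact: g_lip.
pose F t x := f t x (G t x).
have F_cont x : {within `[0, T], continuous (fun t => F t x)}.
  apply/subspace_continuousP => t tI; have := tI; rewrite /= in_itv/= => tT.
  apply: (@cvg_lipschitz_comp _ _ _ T M1 t (fun t y => f t x y)) => //.
  - by move=> s sT y1 y2; have := f_lip s sT x x y1 y2; rewrite subrr normr0 add0r.
  - by have /subspace_continuousP := @G_cont x; apply.
pose L := M1 * (1 + mm^-1 * mg).
have L0 : 0 <= L.
  by rewrite mulr_ge0 ?(ltW M1_gt0)// addr_ge0// mulr_ge0 ?invr_ge0 ?(ltW mm0) ?(ltW mg_gt0).
have F_lip t : 0 <= t <= T -> forall x1 x2, `|F t x1 - F t x2| <= L * `|x1 - x2|.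
  move=> tT x1 x2; apply: le_trans (f_lip t tT _ _ _ _) _.
  rewrite -mulrA ler_wpM2l ?(ltW M1_gt0)// mulrDl mul1r lerD2l.
  exact: G_lip.
have [z zP] := impulsive_integral_exists (Gamma kappa)^-1 z0 reflZ1 sepZ1 kappa0
  (ltW kappa_lt1) T_gt0 tau_first tau_last tau_incr d_gt0 Theta_lip F_cont L0 F_lip.
pose y t := G t (z t).
have zE := zP (fun t => f t (z t) (y t)) (fun=> erefl).
exists z, y; split.
  have [zIC z00 _ zeq] := zE; split => //.
  - exact: (IC_lipschitz_comp tau_first tau_last tau_incr G_cont G_lip zIC).
  - by move=> t tT; exact: solP.
move=> z' y' [zIC' yIC' z00' zeq' yeq'].
have yE t : 0 <= t <= T -> y' t = G t (z' t).
  move=> tT; apply/eqP; rewrite -subr_eq0 -normr_le0.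
  have := sol_lip_at t _ _ _ _ tT (yeq' t tT) (solP t (g t (z' t)) tT).
  by rewrite subrr normr0 mulr0.
have zE' : impulsive_integral_equation kappa T (Gamma kappa)^-1 m tau z0 Theta F z'
    (fun t => f t (z' t) (y' t)).
  by split => // t tT; rewrite yE.
have zz t : 0 <= t <= T -> z' t = z t.
  apply: (impulsive_integral_unique kappa0 (ltW kappa_lt1) tau_first tau_last
    tau_incr F_cont L0 F_lip zE zE').
by move=> t tT; split; [exact: zz|rewrite yE// zz].
Qed.
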